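(* Let $0\le\alpha_0<\alpha_1\le1$ and $0\le\alpha_2<\alpha_3\le1$. Let $\Psi:\mathbb X_{\alpha_0}\to L_2(l^2;\mathbb X_{\alpha_2})$ be a locally Lipschitz continuous map (Lipschitz on each ball of $\mathbb X_{\alpha_0}$), and suppose that for every $R>0$ there is a constant $C_R$ such that for all $x\in\mathbb X_{\alpha_1}$ with $\|x\|_{\mathbb X_{\alpha_0}}\le R$ $$\|\Psi(x)\|_{L_2(l^2;\mathbb X_{\alpha_3})}\le C_R(1+\|x\|_{\mathbb X_{\alpha_1}}).$$ Then for any $0<\theta'<\theta<1$ and $R>0$ there is a finite constant $C_R'$ such that $$\sup_{\|x\|_{\mathbb X_{\alpha_0+\theta(\alpha_1-\alpha_0)}}\le R}\|\Psi(x)\|_{L_2(l^2;\mathbb X_{\alpha_2+\theta'(\alpha_3-\alpha_2)})}\le C_R' .$$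
   Context: $\mathbb X$ is a separable 2-smooth Banach space, i.e. there is $C_{\mathbb X}\ge2$ with $\|x+y\|^2+\|x-y\|^2\le2\|x\|^2+C_{\mathbb X}\|y\|^2$ for all $x,y\in\mathbb X$. $\mathfrak L$ is a densely defined closed linear operator on $\mathbb X$ which is sectorial: for some $\phi\in(0,\pi/2)$ and $C\ge1$, $\{\lambda\in\mathbb C:\phi\le|\arg\lambda|\le\pi\}\subset\rho(\mathfrak L)$ and $\|(\lambda-\mathfrak L)^{-1}\|\le C/(1+|\lambda|)$ on this set; moreover $0\in\rho(\mathfrak L)$. Thus $-\mathfrak L$ generates the analytic semigroup $\mathfrak T_t=e^{-\mathfrak Lt}$ and fractional powers $\mathfrak L^\alpha$ are defined. For $\alpha\ge0$, $\mathbb X_\alpha:=\mathscr D(\mathfrak L^\alpha)$ with norm $\|x\|_{\mathbb X_\alpha}:=\|\mathfrak L^\alpha x\|_{\mathbb X}$. $l^2$ is the space of square summable real sequences with standard orthonormal basis $(e_k)$ and $(W^k)_{k\in\mathbb N}$ are independent standard real Brownian motions. For a Banach space $\mathbb Y$, $L_2(l^2;\mathbb Y)$ is the space of radonifying operators: bounded linear $B:l^2\to\mathbb Y$ such that $\sum_kBe_k\,W^k(1)$ converges in $L^2(\Omega;\mathbb Y)$, with norm $\|B\|_{L_2(l^2;\mathbb Y)}=\big(\mathbb E\|\sum_kBe_kW^k(1)\|_{\mathbb Y}^2\big)^{1/2}$. *)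

(* Defs.v *)
From HB Require Import structures.
From mathcomp Require Import all_boot all_order all_algebra.
From mathcomp Require Import complex ring.
From mathcomp Require Import all_classical all_reals all_analysis.

Set Implicit Arguments.
Unset Strict Implicit.
Unset Printing Implicit Defensive.

Import Order.TTheory GRing.Theory Num.Theory.
Import numFieldNormedType.Exports.

Local Open Scope classical_set_scope.
Local Open Scope ring_scope.

Definition separable (T : topologicalType) : Prop :=
  exists2 S : set T, countable S & dense S.

Definition two_smooth (R : realType) (X : normedModType R) : Prop :=
  exists2 C : R, 2 <= C &
    forall x y : X,
      `|x + y| ^+ 2 + `|x - y| ^+ 2 <= 2 * `|x| ^+ 2 + C * `|y| ^+ 2.

(* The values of [opfun] outside [opdom] are irrelevant. *)
Record operator (R : realType) (X : normedModType R) := Operator {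
  opdom : set X ;
  opfun :> X -> X ;
  opdom0 : opdom 0 ;
  opdomP : forall (a : R) (x y : X), opdom x -> opdom y -> opdom (a *: x + y) ;
  opfunP : forall (a : R) (x y : X), opdom x -> opdom y ->
    opfun (a *: x + y) = a *: opfun x + opfun y }.

Section Operators.
Context {R : realType} {X : normedModType R}.
Implicit Types (L : operator X) (lambda : R[i]).

Definition densely_defined L : Prop := dense (opdom L).

Definition closed_operator L : Prop :=
  closed [set z : X * X | opdom L z.1 /\ z.2 = L z.1].

(* As [X] is a real space, the resolvent set is that of the complexification
   of [L]. The pair (x, y) : X * X stands for x + iy, and the norm is Taylor's,
   which is a complex norm extending that of [X]. If [X] is the real space
   underlying a complex Banach space and [L] is complex linear, then the
   complexification of [L] is similar to the direct sum of [L] and its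
   conjugate; as the sectors below are symmetric, being sectorial then means
   the same for [L] seen as a real or as a complex operator. *)

Definition cnorm (z : X * X) : R :=
  sup [set `|cos t *: z.1 + sin t *: z.2| | t in [set: R]].

Definition cdom L : set (X * X) := [set z | opdom L z.1 /\ opdom L z.2].

Definition cshift L lambda (z : X * X) : X * X :=
  (complex.Re lambda *: z.1 - complex.Im lambda *: z.2 - L z.1,
   complex.Re lambda *: z.2 + complex.Im lambda *: z.1 - L z.2).

Definition is_resolvent L lambda (T : X * X -> X * X) : Prop :=
  (forall w, cdom L (T w) /\ cshift L lambda (T w) = w) /\
  (forall z, cdom L z -> T (cshift L lambda z) = z).

Definition cbounded_by (T : X * X -> X * X) (M : R) : Prop :=
  forall w, cnorm (T w) <= M * cnorm w.

Definition resolvent_set L : set R[i] :=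
  [set lambda | exists T M, is_resolvent L lambda T /\ cbounded_by T M].

(* phi <= |arg lambda| <= pi *)
Definition sector (phi : R) : set R[i] :=
  [set lambda | exists r psi : R,
     [/\ 0 < r, phi <= `|psi| <= pi &
         lambda = Complex (r * cos psi) (r * sin psi)]].

Definition sectorial L : Prop :=
  exists phi C : R,
    [/\ 0 < phi < pi / 2, 1 <= C, sector phi `<=` resolvent_set L &
        forall lambda, sector phi lambda ->
        forall T, is_resolvent L lambda T ->
          cbounded_by T (C / (1 + ComplexField.Normc.normc lambda))].

(* y is the weak (Gelfand-Pettis) integral of f over D for Lebesgue measure. *)
Definition is_integral (D : set R) (f : R -> X) (y : X) : Prop :=
  forall ell : {linear X -> R^o}, continuous ell ->
    lebesgue_measure.-integrable D (EFin \o (fun t => ell (f t) : R)) /\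
    (ell y : R) = \int[lebesgue_measure]_(t in D) (ell (f t) : R).

(* (t + L)^-1 x *)
Definition inv_shift L (t : R) (x : X) : X :=
  xget 0 [set u | opdom L u /\ t *: u + L u = x].

(* For 0 < b < 1, Balakrishnan's formula
     L^-b x = sin (pi b) / pi * \int_0^oo t^-b (t + L)^-1 x dt. *)
Definition neg_power_lt1 L (b : R) (x : X) : X :=
  if b == 0 then x else
  xget 0 [set y | is_integral `]0, +oo[
    (fun t => (sin (pi * b) / pi * t `^ (- b)) *: inv_shift L t x) y].

(* L^-a = (L^-1)^n L^-(a - n) with n the integral part of a >= 0. *)
Definition neg_power L (a : R) (x : X) : X :=
  let n := Num.truncn a in
  iter n (inv_shift L 0) (neg_power_lt1 L (a - n%:R) x).

(* L^a is the inverse of L^-a, and its domain is the range of L^-a. *)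
Definition power_dom L (a : R) : set X := range (neg_power L a).

Definition power L (a : R) (x : X) : X := xget 0 [set y | neg_power L a y = x].

End Operators.

(* A normed space whose underlying set is a subspace of [X], with its own norm,
   which is only meaningful on the carrier. *)
Record nspace (R : realType) (X : normedModType R) := NSpace {
  carrier : set X ;
  nnorm : X -> R }.

Definition Xpow (R : realType) (X : normedModType R) (L : operator X) (a : R) :
  nspace X := NSpace (power_dom L a) (fun x => `|power L a x|).

Section L2seq.
Variable R : realType.

Definition l2_pred : {pred nat -> R^o} :=
  [pred a : nat -> R^o | `[< cvgn (series (fun k => (a k : R) ^+ 2)) >]].

Lemma l2_submod : submod_closed l2_pred.
Proof.
split=> [|c a b].
  apply/asboolP; rewrite [X in cvgn X](_ : _ = (cst 0 : R^nat)).
    exact: (@is_cvg_cst R 0 nat).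
  by apply/funext => n; rewrite /series /= big1 // => k _; rewrite expr0n.
move=> /asboolP ha /asboolP hb; apply/asboolP.
apply: (@series_le_cvg R _
  (fun k => 2 * c ^+ 2 * (a k : R) ^+ 2 + 2 * (b k : R) ^+ 2)).
- by move=> k; exact: sqr_ge0.
- by move=> k; rewrite addr_ge0 // mulr_ge0 ?sqr_ge0 // mulr_ge0 ?sqr_ge0.
- move=> k; rewrite -subr_ge0 -[(c *: a + b) k]/(c * (a k : R) + (b k : R)).
  have -> : 2 * c ^+ 2 * (a k : R) ^+ 2 + 2 * (b k : R) ^+ 2
            - (c * (a k : R) + (b k : R)) ^+ 2
            = (c * (a k : R) - (b k : R)) ^+ 2 by ring.
  exact: sqr_ge0.
- rewrite [X in cvgn X](_ : _ =
      (fun n => 2 * c ^+ 2 * series (fun k => (a k : R) ^+ 2) n +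
                2 * series (fun k => (b k : R) ^+ 2) n)); last first.
    by apply/funext => n; rewrite /series /= big_split /= !mulr_sumr.
  move/cvg_ex: ha => [A hA]; move/cvg_ex: hb => [B hB].
  apply/cvg_ex; exists (2 * c ^+ 2 * A + 2 * B).
  by apply: cvgD; apply: cvgM => //; exact: cvg_cst.
Qed.

Record l2 := L2seq { l2val :> nat -> R^o ; _ : l2val \in l2_pred }.

HB.instance Definition _ := [isSub for l2val].
HB.instance Definition _ := [Choice of l2 by <:].
HB.instance Definition _ :=
  GRing.SubChoice_isSubLmodule.Build R (nat -> R^o) l2_pred l2 l2_submod.

Definition l2norm (a : l2) : R :=
  Num.sqrt (limn (series (fun k => (a k : R) ^+ 2))).

Lemma l2_basis_subproof (k : nat) :
  (fun j => (j == k)%:R : R^o) \in l2_pred.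
Proof.
apply/asboolP; apply/cvg_ex; exists (1 : R).
apply: cvg_near_cst.
exists k.+1 => //= n /= kn.
rewrite /series /= (bigD1_seq k) ?mem_index_iota ?iota_uniq //=.
by rewrite eqxx expr1n big1 ?addr0 // => j /negPf ->; rewrite expr0n.
Qed.

Definition l2_basis (k : nat) : l2 := L2seq (l2_basis_subproof k).

End L2seq.

Section Brownian.
Context {R : realType} {d : measure_display} {Omega : measurableType d}.
Variable P : probability Omega R.

Definition independent (I : eqType) (F : I -> set (set Omega)) : Prop :=
  forall (J : seq I) (A : I -> set Omega), uniq J ->
    (forall i, i \in J -> F i (A i)) ->
    P (\big[setI/setT]_(i <- J) A i) = (\prod_(i <- J) P (A i))%E.

Definition sigma_var (f : Omega -> R) : set (set Omega) :=
  [set f @^-1` B | B in [set B : set R | measurable B]].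

(* The sigma-algebra generated by (W t) for t >= 0. *)
Definition sigma_process (W : R -> Omega -> R) : set (set Omega) :=
  <<s \bigcup_(t in `[0, +oo[) sigma_var (W t) >>.

Definition brownian_motion (W : R -> Omega -> R) : Prop :=
  [/\ forall t, 0 <= t -> measurable_fun setT (W t),
      {ae P, forall w, W 0 w = 0} /\
      {ae P, forall w, {within `[0, +oo[, continuous (fun t => W t w)}},
      forall s t, 0 <= s < t -> forall B : set R, measurable B ->
        P ((fun w => W t w - W s w) @^-1` B)
          = normal_prob 0 (Num.sqrt (t - s)) B &
      forall (n : nat) (t : nat -> R), 0 <= t 0%N ->
        {homo t : i j / (i <= j)%N >-> i <= j} ->
        independent (fun i : 'I_n =>
          sigma_var (fun w => W (t i.+1) w - W (t i) w))].

Definition independent_brownian_motions (W : nat -> R -> Omega -> R) : Prop :=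
  (forall k, brownian_motion (W k)) /\
  independent (fun k => sigma_process (W k)).

Context {X : normedModType R}.
Variable W : nat -> R -> Omega -> R.
Implicit Types (Y : nspace X) (S : Omega -> X) (B : l2 R -> X).

(* Since [Y] is separable whenever this is used, the Borel sigma-algebra of
   [Y] is generated by the balls. *)
Definition random_element Y S : Prop :=
  (forall w, carrier Y (S w)) /\
  forall y, carrier Y y -> measurable_fun setT (fun w => nnorm Y (S w - y)).

Definition in_L2 Y S : Prop :=
  random_element Y S /\
  (\int[P]_w ((nnorm Y (S w)) ^+ 2)%:E < +oo)%E.

Definition cvg_L2 Y (Sn : nat -> Omega -> X) S : Prop :=
  (fun n => \int[P]_w ((nnorm Y (Sn n w - S w)) ^+ 2)%:E)%E @ \oo --> 0%E.

(* [S] is a sum of the series of the B e_k W^k(1) in L^2(Omega; Y). *)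
Definition is_gauss_sum Y B S : Prop :=
  in_L2 Y S /\
  cvg_L2 Y (fun n w => \sum_(k < n) W k 1 w *: B (l2_basis R k)) S.

Definition bounded_linear Y B : Prop :=
  [/\ linear B, forall h, carrier Y (B h) &
      exists M : R, forall h, nnorm Y (B h) <= M * l2norm h].

Definition radonifying Y : set (l2 R -> X) :=
  [set B | bounded_linear Y B /\ exists S, is_gauss_sum Y B S].

Definition rad_norm Y B : R :=
  let S := xget (cst 0) (is_gauss_sum Y B) in
  Num.sqrt (fine (\int[P]_w ((nnorm Y (S w)) ^+ 2)%:E)%E).

End Brownian.

(* Main.v *)
Require Import Defs.
From HB Require Import structures.
From mathcomp Require Import all_boot all_order all_algebra.
From mathcomp Require Import complex ring lra.
From mathcomp Require Import all_classical all_reals all_analysis measurable_realfun.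
Set Implicit Arguments.
Unset Strict Implicit.
Unset Printing Implicit Defensive.
Import Order.TTheory GRing.Theory Num.Theory.
Import numFieldNormedType.Exports.
Local Open Scope classical_set_scope.
Local Open Scope ring_scope.

(** Let [gamma = alpha0 + theta * delta] with [delta = alpha1 - alpha0], and let
    [x] be a point of the domain of [L^gamma]. Its regularizations
    [x_n = 2^n (2^n + L)^-1 x] approach it in X_alpha0 at the rate
    [2^(- n theta delta)], while in X_alpha1 they grow at most as
    [2^(n (1 - theta) delta)]. By the Lipschitz condition the increments
    [Psi x_(n+1) - Psi x_n] then decrease as [2^(- n theta delta)] in
    L_2(l^2; X_alpha2), and by the growth condition they are at most of the order
    [2^(n (1 - theta) delta)] in L_2(l^2; X_alpha3). Between these two spaces the
    moment inequality gives the order [2^(n (theta' - theta) delta)] at the index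
    [theta']. As [theta' < theta], the increments are summable there, and
    [Psi x], which is [Psi x_0] plus the sum of the increments, inherits a bound
    that depends only on the constants. This is [gauss_telescope].

    The argument uses a few properties of the negative powers, collected in
    [fractional_scale] and proved in [neg_power_scale]. As [L^-c] is given by a
    weak integral of the resolvent, everything rests on the law
    [L^-c L^-(1 - c) = k L^-1] for some [k > 0]: [frac_integral_complement]. It
    makes [L^-c] injective, and it leads to [frac_integral_range], which reads off
    a bound for [L^c y] from the decay of [L (t + L)^-1 y] in [t]. The element
    [L^-a z] has the decay [t^-a], by [Yosida_frac_integral]. The embeddings, the
    moment inequality and the rates of approximation are obtained by playing two
    such decay rates against each other. The law itself is tested with a
    functional; after subtraction of the scalar resolvent [1 / (1 + t)] the
    remaining double integral vanishes by Fubini's theorem and dilation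
    invariance: [double_integral_vanish].

    On the probabilistic side, the values of the Brownian motions at time 1 are
    independent standard normal variables ([brownian_gaussian]). A new
    independent centred term cannot decrease the mean square of the norm of a
    sum: [gauss_step]. Hence the partial sums of a Gaussian series are bounded in
    mean square by its sum, and for real series the same step gives the
    orthogonality that bounds the norm of an operator by its radonifying norm
    ([gauss_operator_bound]). With the completeness of L^2 along geometric
    increments ([l2_complete]), both facts show that a sequence of radonifying
    operators with geometrically decreasing increments has a radonifying limit:
    [gauss_operator_limit]. The moment inequality passes to radonifying norms
    because it may be applied pointwise to finite Gaussian sums
    ([gauss_interpolate]). Finally, a radonifying operator with values in the
    domain of [L^a] is [L^-a] composed with a radonifying operator of the ambient
    space ([radonifying_gauss] and [gauss_radonifying]). *)

(** * Norming functionals *)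

Section HahnBanach.
Context {R : realType} {X : normedModType R}.

Definition linear_graph (G : set (X * R)) : Prop :=
  forall (a : R) u v, G u -> G v -> G (a *: u.1 + v.1, a * u.2 + v.2).

Definition norm_dominated (G : set (X * R)) : Prop :=
  forall u, G u -> u.2 <= `|u.1|.

Lemma linear_graph0 (G : set (X * R)) u : linear_graph G -> G u -> G (0, 0).
Proof.
move=> lG Gu; have := lG (-1) _ _ Gu Gu.
by rewrite scaleN1r addNr mulN1r addNr.
Qed.

Lemma linear_graph_fun (G : set (X * R)) v r s :
  linear_graph G -> norm_dominated G -> G (v, r) -> G (v, s) -> r = s.
Proof.
move=> lG dG Gr Gs; apply/eqP; rewrite eq_le.
have le (p q : R) : G (v, p) -> G (v, q) -> p <= q.
  move=> Gp Gq; have /dG /= := lG (-1) _ _ Gq Gp.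
  by rewrite scaleN1r addNr mulN1r normr0 addrC subr_le0.
by rewrite !le.
Qed.

(** The value [c] at the new vector [v0] has to lie above all [u.2 - |u.1 - v0|] and
    below all [|u'.1 + v0| - u'.2]; these are separated by the triangle
    inequality, and the supremum of the former will do. *)
Lemma graph_extend (G : set (X * R)) u0 v0 :
  linear_graph G -> norm_dominated G -> G u0 ->
  exists c : R,
    norm_dominated [set w | exists (a : R) u,
                      G u /\ w = (u.1 + a *: v0, u.2 + a * c)].
Proof.
move=> lG dG Gu0.
pose S := [set u.2 - `|u.1 - v0| | u in G].
have Sub u' : G u' -> ubound S (`|u'.1 + v0| - u'.2).
  move=> Gu' _ [u Gu <-].
  have := dG _ (lG 1 _ _ Gu Gu'); rewrite /= scale1r mul1r => h.
  have : `|u.1 + u'.1| <= `|u.1 - v0| + `|u'.1 + v0|.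
    by apply: le_trans (ler_normD _ _); rewrite addrACA addNr addr0.
  lra.
have hS : has_sup S.
  split; first by exists (u0.2 - `|u0.1 - v0|), u0.
  by exists (`|u0.1 + v0| - u0.2); exact: Sub.
exists (sup S) => _ [a [u [Gu ->]]] /=.
have G0 := linear_graph0 lG Gu.
have Gs b : G (b *: u.1, b * u.2).
  by have := lG b _ _ Gu G0; rewrite /= !addr0.
have [a0|a0|->] := ltgtP a 0.
- have b0 : 0 < - a by rewrite oppr_gt0.
  have := ub_le_sup hS.2 (ex_intro2 _ _ _ (Gs (- a)^-1) erefl).
  move=> /(ler_wpM2l (ltW b0)) /=.
  have -> : `|u.1 + a *: v0| = (- a) * `|(- a)^-1 *: u.1 - v0|.
    rewrite -[X in X * _](gtr0_norm b0) -normrZ scalerBr scalerA.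
    by rewrite divff ?gt_eqF// scale1r scaleNr opprK.
  rewrite mulrBr mulrA divff ?gt_eqF// mul1r; lra.
- have := ge_sup hS.1 (Sub _ (Gs a^-1)).
  move=> /(ler_wpM2l (ltW a0)) /=.
  have -> : `|u.1 + a *: v0| = a * `|a^-1 *: u.1 + v0|.
    rewrite -[X in X * _](gtr0_norm a0) -normrZ scalerDr scalerA.
    by rewrite divff ?gt_eqF// scale1r.
  rewrite mulrBr [a * (_ * _)]mulrA divff ?gt_eqF// mul1r; lra.
- by rewrite scale0r addr0 mul0r addr0; exact: dG.
Qed.

(** Hahn-Banach, in the form that is used to bound a vector by testing it
    against functionals: the graphs of norm-dominated functionals that take the
    value [|x|] at [x] are closed under unions of chains, and a maximal one is
    everywhere defined because it extends by one dimension. *)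
Lemma norming_functional (x : X) : exists ell : {linear X -> R^o},
  [/\ continuous ell, (ell x : R) = `|x| &
      forall v, `|ell v : R| <= `|v|].
Proof.
pose good G := [/\ linear_graph G, norm_dominated G & G (x, `|x|)].
pose P (G : set (X * R)) := G = set0 \/ good G.
have [|A [PA maxA]] := @Zorn_bigcup _ P.
  move=> F FP Ftot; have [F0|] := pselect (exists2 G, F G & G !=set0).
    right; case: F0 => G FG [g Gg].
    have nG H h : F H -> H h -> good H.
      by move=> FH Hh; case: (FP _ FH) => // H0; move: Hh; rewrite H0.
    have [_ _ Gx] := nG _ _ FG Gg.
    split; last by exists G.
      move=> a u v [H FH Hu] [K FK Kv].
      have [HK|KH] := Ftot _ _ FH FK.
        by exists K => //; have [lK _ _] := nG _ _ FK Kv; apply: lK => //; exact: HK.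
      by exists H => //; have [lH _ _] := nG _ _ FH Hu; apply: lH => //; exact: KH.
    by move=> u [H FH Hu]; have [_ dH _] := nG _ _ FH Hu; exact: dH.
  move=> F0; left; rewrite -subset0 => u [G FG Gu].
  by apply: F0; exists G => //; exists u.
have {PA} [lA dA Ax] : good A.
  case: PA => // A0; exfalso.
  apply: (maxA [set (a *: x, a * `|x|) | a in setT]).
    rewrite A0; split; first by move=> /= u [].
    by move=> /(_ (1 *: x, 1 * `|x|)); apply; exists 1.
  right; split.
  - move=> a _ _ [b _ <-] [c _ <-] /=; exists (a * b + c) => //.
    by rewrite scalerDl scalerA mulrDl mulrA.
  - move=> _ [a _ <-] /=; rewrite normrZ ler_wpM2r//; exact: ler_norm.
  - by exists 1; rewrite ?scale1r ?mul1r.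
have A00 := linear_graph0 lA Ax.
have Atot v : exists r, A (v, r).
  apply: contrapT => nv.
  have [c dc] := graph_extend v lA dA Ax.
  set B := [set w | _] in dc.
  have AB : A `<=` B.
    by move=> u Au; exists 0, u; rewrite scale0r addr0 mul0r addr0; case: u Au.
  apply: (maxA B).
    split=> // /(_ (v, c)) h; apply: nv; exists c; apply: h.
    by exists 1, (0, 0); rewrite /= scale1r mul1r !add0r.
  right; split => //; last exact: AB.
  move=> a _ _ [b [u [Au ->]]] [b' [u' [Au' ->]]] /=.
  exists (a * b + b'), (a *: u.1 + u'.1, a * u.2 + u'.2).
  split; first exact: lA.
  rewrite /= scalerDr scalerDl scalerA; congr pair; first by rewrite addrACA.
  by ring.
have [f Af] := choice Atot.
have lf : linear (f : X -> R^o).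
  move=> a u v; apply: (linear_graph_fun lA dA (Af _)).
  exact: lA (Af u) (Af v).
pose fl : {linear X -> R^o} := HB.pack f (GRing.isLinear.Build _ _ _ _ f lf).
have fle v : `|f v| <= `|v|.
  rewrite ler_norml; apply/andP; split; last exact: dA (Af v).
  have := dA _ (Af (- v)); rewrite /= normrN.
  have -> : f (- v) = - f v by exact: (raddfN fl).
  by rewrite lerNl.
exists fl; split => //; last exact: (linear_graph_fun lA dA (Af _)).
apply: bounded_linear_continuous; apply/linear_boundedP => /=.
by exists 1; split=> // r r1 u; rewrite (le_trans (fle u))// ler_peMl// ltW.
Qed.

End HahnBanach.

(** * Norm-measurable maps into a separable space *)

Section Nearest.
Context {R : realType} {X : normedModType R}.
Variable xs : nat -> X.

(** The index of a nearest point to [z] among the first [n + 1] points; the smallest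
    such index is taken, so that its level sets are described by comparisons of
    distances. *)
Fixpoint nearest_idx (n : nat) (z : X) : nat :=
  if n is m.+1 then
    if `|z - xs n| < `|z - xs (nearest_idx m z)| then n else nearest_idx m z
  else 0%N.

Definition nearest (n : nat) (z : X) : X := xs (nearest_idx n z).

Lemma nearest_idx_le n z : (nearest_idx n z <= n)%N.
Proof. by elim: n => //= n IH; case: ifP => // _; exact: leqW. Qed.

Lemma nearestS n z :
  `|z - nearest n.+1 z| = Num.min `|z - xs n.+1| `|z - nearest n z|.
Proof. by rewrite /nearest /= minEle le_eqVlt; case: ltgtP. Qed.

Lemma nearest_le n j z : (j <= n)%N -> `|z - nearest n z| <= `|z - xs j|.
Proof.
elim: n => [|n IH]; first by rewrite leqn0 => /eqP ->.
rewrite nearestS leq_eqVlt => /predU1P[->|jn]; first by rewrite ge_min lexx.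
by rewrite ge_min IH ?orbT.
Qed.

Hypothesis xs0 : xs 0%N = 0.
Hypothesis xs_dense : forall z e, 0 < e -> exists n, `|z - xs n| < e.

Lemma nearest_le_norm n z : `|z - nearest n z| <= `|z|.
Proof. by have := nearest_le z (leq0n n); rewrite xs0 subr0. Qed.

Lemma nearest_norm n z : `|nearest n z| <= 2 * `|z|.
Proof.
have := nearest_le_norm n z; have := ler_distD z (nearest n z) 0.
rewrite !subr0 distrC; lra.
Qed.

Lemma nearest_cvg z : nearest n z @[n --> \oo] --> z.
Proof.
apply/cvgrPdist_lt => e e0; have [m zm] := xs_dense z e0.
near=> n; apply: le_lt_trans zm; apply: nearest_le.
by near: n; exists m.
Unshelve. all: end_near. Qed.

End Nearest.

Section NormMeasurable.
Context {R : realType} {X : normedModType R}.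

(** Measurability with respect to the balls: for maps into a separable space it is
    Borel measurability, and it speaks of real functions only. *)
Definition norm_measurable d (T : measurableType d) (D : set T) (f : T -> X) :=
  forall z, measurable_fun D (fun t => `|f t - z|).

Lemma separable_seq : separable X -> exists xs : nat -> X,
  xs 0%N = 0 /\ forall z e, 0 < e -> exists n, `|z - xs n| < e.
Proof.
move=> [S cS dS]; have [f fS] := elimT pcard_surjP cS.
exists (fun n => if n is m.+1 then f m else 0); split=> // z e e0.
have [|y [zy Sy]] := dS (ball z e) _ (ball_open z e).
  by exists z; exact: ballxx.
have [n _ fn] := fS _ Sy; exists n.+1 => /=; rewrite fn.
by move: zy; rewrite -ball_normE.
Qed.

Context d (T : measurableType d) (D : set T) (mD : measurable D).
Implicit Types f g : T -> X.

Lemma measurable_nearest xs n f : norm_measurable D f ->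
  measurable_fun D (fun t => `|f t - nearest xs n (f t)|) /\
  forall j, measurable (D `&` [set t | nearest_idx xs n (f t) = j]).
Proof.
move=> mf; elim: n => [|n [IH1 IH2]].
  split=> [|[|j]]; first exact: (mf (xs 0%N)).
    by rewrite [X in D `&` X](_ : _ = setT) ?setIT//; apply/seteqP; split.
  by rewrite [X in D `&` X](_ : _ = set0) ?setI0//; apply/seteqP; split.
split.
  under eq_fun do rewrite nearestS.
  by apply: measurable_minr.
move=> j; pose A := D `&` [set t | `|f t - xs n.+1| < `|f t - nearest xs n (f t)|].
have mA : measurable A.
  have := measurable_fun_ltr (mf (xs n.+1)) IH1.
  move=> /(_ mD [set true] I); congr (measurable (D `&` _)).
have -> : D `&` [set t | nearest_idx xs n.+1 (f t) = j] =
    (A `&` [set _ | n.+1 = j]) `|`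
    ((D `&` [set t | nearest_idx xs n (f t) = j]) `\` A).
  apply/seteqP; split=> t /=.
    move=> [Dt]; case: ifPn => h <-; first by left.
    by right; split=> // -[_ /= h']; rewrite /nearest h' in h.
  move=> [[[Dt h] <-]|[[Dt <-]]].
    by split=> //; rewrite /nearest in h; rewrite h.
  move=> h; split=> //; case: ifPn => // h'.
  by exfalso; apply: h; split.
apply: measurableU; last exact: measurableD.
have [->|nj] := pselect (n.+1 = j).
  by rewrite [X in A `&` X](_ : _ = setT) ?setIT//; apply/seteqP; split.
by rewrite [X in A `&` X](_ : _ = set0) ?setI0//; apply/seteqP; split.
Qed.

Lemma measurable_nearest2 xs n f g (phi : nat -> nat -> R) :
  norm_measurable D f -> norm_measurable D g ->
  measurable_fun D
    (fun t => phi (nearest_idx xs n (f t)) (nearest_idx xs n (g t))).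
Proof.
move=> mf mg _ B mB.
have -> : D `&` (fun t => phi (nearest_idx xs n (f t)) (nearest_idx xs n (g t)))
    @^-1` B = \bigcup_i \bigcup_(j in [set j | B (phi i j)])
      ((D `&` [set t | nearest_idx xs n (f t) = i]) `&`
       (D `&` [set t | nearest_idx xs n (g t) = j])).
  apply/seteqP; split=> t /=.
    by move=> [Dt Bt]; exists (nearest_idx xs n (f t)) => //; eexists; first exact: Bt.
  by move=> [i _ [j /= Bij [[Dt iE] [_ jE]]]]; rewrite iE jE.
apply: bigcupT_measurable => i; apply: bigcup_measurable => j _.
by apply: measurableI; [apply: (measurable_nearest xs n mf).2
                       |apply: (measurable_nearest xs n mg).2].
Qed.

Hypothesis sepX : separable X.

(** A norm-measurable map into a separable space is the pointwise limit of maps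
    with finitely many values, namely the nearest points among the first [n]
    points of a dense sequence; hence it may be composed with any continuous
    function, which is how sums and images of random vectors are handled. *)
Lemma measurable_continuous2 f g (psi : X * X -> R) :
  continuous psi -> norm_measurable D f -> norm_measurable D g ->
  measurable_fun D (fun t => psi (f t, g t)).
Proof.
move=> cpsi mf mg; have [xs [xs0 xsd]] := separable_seq sepX.
apply: (@measurable_fun_cvg _ _ _ D
  (fun n t => psi (nearest xs n (f t), nearest xs n (g t)))).
  by move=> n; exact: (measurable_nearest2 xs n (fun i j => psi (xs i, xs j))).
move=> t Dt.
apply: (@cvg_comp _ _ _ (fun n => (nearest xs n (f t), nearest xs n (g t))) psi);
  last exact: cpsi.
by apply: cvg_pair; exact: nearest_cvg.
Qed.

Lemma measurable_continuous f (psi : X -> R) :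
  continuous psi -> norm_measurable D f -> measurable_fun D (psi \o f).
Proof.
move=> cpsi mf; apply: (@measurable_continuous2 f f (psi \o fst)) => // z.
by apply: continuous_comp; [exact: cvg_fst|exact: cpsi].
Qed.

Lemma norm_measurable_continuous2 f g (psi : X * X -> X) :
  continuous psi -> norm_measurable D f -> norm_measurable D g ->
  norm_measurable D (fun t => psi (f t, g t)).
Proof.
move=> cpsi mf mg z.
apply: (@measurable_continuous2 f g (fun u => `|psi u - z|)) => // u.
by apply: cvg_norm; apply: cvgB; [exact: cpsi|exact: cvg_cst].
Qed.

Lemma norm_measurable_continuous f (psi : X -> X) :
  continuous psi -> norm_measurable D f -> norm_measurable D (psi \o f).
Proof.
move=> cpsi mf; apply: (@norm_measurable_continuous2 f f (psi \o fst)) => // z.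
by apply: continuous_comp; [exact: cvg_fst|exact: cpsi].
Qed.

Lemma norm_measurableD f g : norm_measurable D f -> norm_measurable D g ->
  norm_measurable D (f \+ g).
Proof.
apply: (@norm_measurable_continuous2 f g (fun u => u.1 + u.2)) => u.
by apply: cvgD; [exact: cvg_fst|exact: cvg_snd].
Qed.

Lemma norm_measurableB f g : norm_measurable D f -> norm_measurable D g ->
  norm_measurable D (f \- g).
Proof.
apply: (@norm_measurable_continuous2 f g (fun u => u.1 - u.2)) => u.
by apply: cvgB; [exact: cvg_fst|exact: cvg_snd].
Qed.

End NormMeasurable.

Section NormMeasurableOperations.
Context {R : realType} {X : normedModType R}.
Context d (T : measurableType d) (D : set T) (mD : measurable D).

Lemma norm_measurable_norm (f : T -> X) : norm_measurable D f ->
  measurable_fun D (fun t => `|f t|).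
Proof. by move=> /(_ 0); under eq_fun do rewrite subr0. Qed.

Lemma norm_measurable_cst (x : X) : norm_measurable D (fun=> x).
Proof. by move=> z; exact: measurable_cst. Qed.

Lemma norm_measurable_scale (r : T -> R) (x : X) : measurable_fun D r ->
  norm_measurable D (fun t => r t *: x).
Proof.
move=> mr z; apply: (@measurableT_comp _ _ _ _ _ _ (fun a : R => `|a *: x - z|)) => //.
apply: continuous_measurable_fun => a.
apply: cvg_norm; apply: cvgB; last exact: cvg_cst.
by apply: cvgZl; exact: cvg_id.
Qed.

Lemma norm_measurable_cvg (f_ : nat -> T -> X) (f : T -> X) :
  (forall n, norm_measurable D (f_ n)) ->
  (forall t, D t -> f_ n t @[n --> \oo] --> f t) -> norm_measurable D f.
Proof.
move=> mf ff z.
apply: (@measurable_fun_cvg _ _ _ D (fun n t => `|f_ n t - z|)).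
  by move=> n; exact: mf.
move=> t Dt; apply: cvg_norm; apply: cvgB; [exact: ff|exact: cvg_cst].
Qed.

End NormMeasurableOperations.

(** * Weak integrals *)

Section BoundedLinear.
Context {R : realType} {X Y : normedModType R}.

Lemma continuous_linear_bound (T : {linear X -> Y}) : continuous T ->
  exists2 K, 0 <= K & forall v, `|T v| <= K * `|v|.
Proof.
move=> cT; have : bounded_near T (nbhs (0 : X)).
  exact/linear_bounded_continuous.
move=> /linear_boundedP[K [_ hK]].
exists (`|K| + 1); first by rewrite addr_ge0.
by apply: hK; rewrite (le_lt_trans (ler_norm K))// ltrDl.
Qed.

Lemma linear_bound_continuous (T : {linear X -> Y}) K :
  (forall v, `|T v| <= K * `|v|) -> continuous T.
Proof.
move=> hK; apply: bounded_linear_continuous; apply/linear_boundedP.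
exists `|K|; split; first exact: normr_real.
move=> r Kr v; rewrite (le_trans (hK v))// ler_wpM2r//.
by rewrite (le_trans (ler_norm K))// ltW.
Qed.

End BoundedLinear.

Lemma cvg_of_dist (R : realType) (X : completeNormedModType R)
    (u : nat -> X) (e : nat -> R) :
  e n @[n --> \oo] --> 0 ->
  (forall n m, `|u n - u m| <= e n + e m) -> cvgn u.
Proof.
move=> e0 ue; apply: cauchy_cvg; apply/cauchy_ballP => r r0.
have r2 : 0 < r / 2 by rewrite divr_gt0.
have /cvgrPdist_lt /(_ _ r2) [N _ hN] := e0.
pose A := [set x | exists2 n, (N <= n)%N & x = u n].
exists (A, A); first by split; exists N => // n /= Nn; exists n.
move=> [_ _] /= [[n Nn ->] [m Nm ->]]; rewrite -ball_normE /ball_ /=.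
have := hN n Nn; have := hN m Nm; have := ue n m; rewrite !sub0r !normrN.
have := ler_norm (e n); have := ler_norm (e m); lra.
Qed.

Section Pettis.
Context {R : realType} {X : normedModType R}.
Notation mu := (@lebesgue_measure R).
Variables (D : set (measurableTypeR R)) (mD : measurable D).
Implicit Types (f g : R -> X) (y : X) (Phi : R -> R).

Lemma is_integralB f g y z : is_integral D f y -> is_integral D g z ->
  is_integral D (fun t => f t - g t) (y - z).
Proof.
move=> fy gz ell cell; have [If lf] := fy _ cell; have [Ig lg] := gz _ cell.
have E : (fun t => ell (f t - g t) : R) = (fun t => (ell (f t) : R) - (ell (g t) : R)).
  by apply/funext => t; rewrite linearB.
split.
  have := integrableB mD If Ig; rewrite E; congr (_.-integrable _ _).
by rewrite E RintegralB// -lf -lg linearB.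
Qed.

(** The integral is tested with a functional that norms it. *)
Lemma is_integral_norm_le f y Phi : mu.-integrable D (EFin \o Phi) ->
  (forall t, D t -> `|f t| <= Phi t) -> is_integral D f y ->
  `|y| <= \int[mu]_(t in D) Phi t.
Proof.
move=> IPhi fPhi fy; have [ell [cell elly ellle]] := norming_functional y.
have [Iell] := fy _ cell; rewrite elly => ->.
apply: le_Rintegral => // t Dt.
by rewrite (le_trans (ler_norm _))// (le_trans (ellle _))// fPhi.
Qed.

Lemma is_integral_unique f y z :
  is_integral D f y -> is_integral D f z -> y = z.
Proof.
move=> fy fz; have h := is_integralB fy fz.
apply/eqP; rewrite -subr_eq0 -normr_le0.
apply: (le_trans (is_integral_norm_le (Phi := cst 0) _ _ h)).
- exact: integrable0.
- by move=> t _; rewrite subrr normr0.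
- by rewrite /Rintegral integral0.
Qed.

Lemma eq_is_integral f g y : {in D, f =1 g} -> is_integral D f y -> is_integral D g y.
Proof.
move=> fg fy ell cell; have [If ->] := fy _ cell; split.
  by apply: eq_integrable If => // t Dt; rewrite /= fg.
by apply: eq_Rintegral => t Dt; rewrite fg.
Qed.

Lemma is_integral_linear (T : {linear X -> X}) f y : continuous T ->
  is_integral D f y -> is_integral D (T \o f) (T y).
Proof.
move=> cT fy ell cell.
have c : continuous (ell \o T : {linear X -> R^o}).
  by move=> x; apply: continuous_comp; [exact: cT|exact: cell].
exact: (fy _ c).
Qed.

Lemma is_integral0 : is_integral D (fun=> 0 : X) 0.
Proof.
move=> ell cell; rewrite linear0; split; last by rewrite /Rintegral integral0.
exact: integrable0.
Qed.

Lemma is_integralD f g y z : is_integral D f y -> is_integral D g z ->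
  is_integral D (fun t => f t + g t) (y + z).
Proof.
move=> fy gz; have := is_integralB fy (is_integralB is_integral0 gz).
by rewrite sub0r opprK; apply: eq_is_integral => t _; rewrite sub0r opprK.
Qed.

Lemma is_integralZ (a : R) f y : is_integral D f y ->
  is_integral D (fun t => a *: f t) (a *: y).
Proof.
move=> fy; apply: (@is_integral_linear (a \*: idfun : {linear X -> X})) => //.
by move=> x; apply: cvgZr; exact: cvg_id.
Qed.

End Pettis.

Section PettisExistence.
Context {R : realType} {X : completeNormedModType R}.
Notation mu := (@lebesgue_measure R).
Variables (D : set (measurableTypeR R)) (mD : measurable D).

(** For a map with finitely many values the integral is an explicit finite sum. *)
Lemma is_integral_simple (xs : nat -> X) (i : R -> nat) (n : nat) (Phi : R -> R) :
  (forall t, (i t <= n)%N) ->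
  (forall j, measurable (D `&` [set t | i t = j])) ->
  mu.-integrable D (EFin \o Phi) ->
  (forall t, D t -> `|xs (i t)| <= Phi t) ->
  exists y, is_integral D (fun t => xs (i t)) y.
Proof.
move=> hn mi IPhi iPhi; pose E j := D `&` [set t | i t = j].
have EE (ell : {linear X -> R^o}) t : D t ->
    (ell (xs (i t)) : R) = \sum_(j < n.+1) (ell (xs j) : R) * \1_(E j) t.
  move=> Dt; have it : (i t < n.+1)%N by rewrite ltnS.
  rewrite (bigD1 (Ordinal it))//= big1 ?addr0.
    by rewrite indicE mem_set ?mulr1.
  move=> j /eqP ji; rewrite indicE memNset ?mulr0// => -[_ /= ij].
  by apply: ji; apply: val_inj.
have Iterm (ell : {linear X -> R^o}) j : continuous ell ->
    mu.-integrable D (EFin \o (fun t => (ell (xs j) : R) * \1_(E j) t)).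
  move=> /continuous_linear_bound [K K0 hK].
  apply: (le_integrable mD _ _ (integrableZl mD K IPhi)).
    apply/measurable_EFinP; apply: measurable_funM; first exact: measurable_cst.
    apply: measurable_funTS; apply: measurable_indic; exact: mi.
  move=> t Dt /=; rewrite lee_fin.
  have Phi0 : 0 <= Phi t by exact: le_trans (iPhi _ Dt).
  rewrite [leRHS]ger0_norm ?mulr_ge0//.
  have [Et|Et] := pselect (E j t); last first.
    by rewrite indicE memNset// mulr0 normr0 mulr_ge0.
  rewrite indicE mem_set// mulr1 (le_trans (hK _))// ler_wpM2l//.
  by case: Et => _ <-; exact: iPhi.
exists (\sum_(j < n.+1) fine (mu (E j)) *: xs j) => ell cell.
split.
  apply: (eq_integrable mD (fun t => \sum_(j < n.+1) ((ell (xs j) : R) * \1_(E j) t)%:E)%E).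
    by move=> t /set_mem Dt; rewrite /= (EE ell t Dt) sumEFin.
  by apply: integrable_sum => // j _; exact: Iterm.
rewrite linear_sum /Rintegral.
rewrite (eq_integral (fun t => \sum_(j < n.+1) ((ell (xs j) : R) * \1_(E j) t)%:E)%E); last first.
  by move=> t /set_mem Dt; rewrite (EE ell t Dt) sumEFin.
rewrite integral_sum//; last by move=> j; exact: Iterm.
rewrite -sum_fine; last by move=> j _; apply: integrable_fin_num => //; exact: Iterm.
apply: eq_bigr => j _; rewrite linearZ /=.
have [->|nz] := eqVneq (ell (xs j) : R) 0.
  rewrite [LHS]mulr0; under eq_integral do rewrite mul0r.
  by rewrite integral0.
have Ij : mu.-integrable D (EFin \o (\1_(E j) : R -> R)).
  have := integrableZl mD (ell (xs j) : R)^-1 (Iterm ell j cell).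
  by apply: eq_integrable => // t _; rewrite /= -EFinM mulrA mulVf// mul1r.
under eq_integral do rewrite EFinM.
rewrite integralZl// integral_indic//; last exact: mi.
rewrite [E j `&` D](_ : _ = E j); last by apply/seteqP; split=> t [] // [].
have fm : mu (E j) \is a fin_num.
  have := integrable_fin_num mD Ij; rewrite integral_indic//; last exact: mi.
  by rewrite [E j `&` D](_ : _ = E j)//; apply/seteqP; split=> t [] // [].
by rewrite fineM//= mulrC.
Qed.

(** By dominated convergence the distances of [f_ n] to [f] have integrals that tend
    to 0, so that the integrals of the [f_ n] form a Cauchy sequence. *)
Lemma is_integral_cvg (f_ : nat -> R -> X) (f : R -> X) (ys : nat -> X)
    (Phi : R -> R) :
  (forall n, is_integral D (f_ n) (ys n)) ->
  norm_measurable D f -> (forall n, measurable_fun D (fun t => `|f t - f_ n t|)) ->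
  separable X ->
  mu.-integrable D (EFin \o Phi) -> (forall t, D t -> `|f t| <= Phi t) ->
  (forall n t, D t -> `|f t - f_ n t| <= Phi t) ->
  (forall t, D t -> f_ n t @[n --> \oo] --> f t) ->
  exists y, is_integral D f y.
Proof.
move=> fys mf mfn sepX IPhi fPhi fnPhi fnf.
pose eps n := \int[mu]_(t in D) `|f t - f_ n t|.
have Ien n : mu.-integrable D (EFin \o (fun t => `|f t - f_ n t|)).
  apply: (le_integrable mD _ _ IPhi); first exact/measurable_EFinP.
  move=> t Dt /=; rewrite lee_fin normr_id (le_trans (fnPhi n t Dt))//.
  exact: ler_norm.
have eps0 : eps n @[n --> \oo] --> 0.
  have [] := @dominated_convergence _ _ _ mu D mD
    (fun n t => (`|f t - f_ n t|)%:E) (cst 0%E) (EFin \o Phi).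
  - by move=> n; exact/measurable_EFinP.
  - exact: measurable_cst.
  - apply: aeW => t Dt.
    have h : `|f t - f_ n t| @[n --> \oo] --> `|f t - f t|.
      by apply: cvg_norm; apply: cvgB; [exact: cvg_cst|exact: fnf].
    rewrite subrr normr0 in h.
    by apply: (@cvg_EFin _ _ _ _ _ 0); [exact: nearW|exact: h].
  - exact: IPhi.
  - by apply: aeW => t n Dt /=; rewrite lee_fin normr_id fnPhi.
  move=> _ _; rewrite integral0 => h.
  exact: (fine_cvg (a:=0) h).
have cauchy n m : `|ys n - ys m| <= eps n + eps m.
  rewrite /eps -RintegralD//.
  apply: (is_integral_norm_le mD _ _ (is_integralB mD (fys n) (fys m))).
    exact: (integrableD mD (Ien n) (Ien m)).
  move=> t Dt; have := ler_distD (f t) (f_ n t) (f_ m t).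
  by rewrite (distrC (f_ n t) (f t)).
have [y ysy] : exists y : X, ys n @[n --> \oo] --> y.
  by have /cvg_ex[y ysy] := cvg_of_dist eps0 cauchy; exists y.
exists y => ell cell.
have [K K0 hK] := continuous_linear_bound cell.
have mell : measurable_fun D (fun t => ell (f t) : R).
  exact: (@measurable_continuous R X _ _ D mD sepX f ell cell mf).
have Iell : mu.-integrable D (EFin \o (fun t => ell (f t) : R)).
  apply: (le_integrable mD _ _ (integrableZl mD K IPhi)); first exact/measurable_EFinP.
  move=> t Dt /=; rewrite lee_fin (le_trans (hK _))//.
  by rewrite (le_trans _ (ler_norm _))// ler_wpM2l// fPhi.
split => //.
have c1 : (ell (ys n) : R) @[n --> \oo] --> (ell y : R).
  by apply: continuous_cvg => //; exact: cell.
have c2 : (ell (ys n) : R) @[n --> \oo] --> \int[mu]_(t in D) (ell (f t) : R).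
  apply/cvgrPdist_le => r r0.
  have : K * eps n @[n --> \oo] --> K * 0 by apply: cvgMr.
  rewrite mulr0 => /cvgrPdist_le /(_ _ r0); apply: filterS => n.
  rewrite sub0r normrN => h; apply: le_trans h; apply: le_trans (ler_norm _).
  have [In ->] := fys n _ cell.
  have IB : mu.-integrable D
      (EFin \o (fun t => (ell (f t) : R) - (ell (f_ n t) : R))).
    exact: (integrableB mD Iell In).
  rewrite -RintegralB// /eps -RintegralZl//.
  apply: (le_trans (le_normr_Rintegral mD IB)).
  apply: le_Rintegral => //.
  - exact: integrable_norm IB.
  - exact: (integrableZl mD K (Ien n)).
  - by move=> t Dt; rewrite -linearB; exact: hK.
by rewrite -(cvg_lim (@Rhausdorff R) c1) -(cvg_lim (@Rhausdorff R) c2).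
Qed.

End PettisExistence.

Section PettisIntegrable.
Context {R : realType} {X : completeNormedModType R}.
Notation mu := (@lebesgue_measure R).
Variables (D : set (measurableTypeR R)) (mD : measurable D).

Lemma is_integral_exists (f : R -> X) (Phi : R -> R) : separable X ->
  norm_measurable D f -> mu.-integrable D (EFin \o Phi) ->
  (forall t, D t -> `|f t| <= Phi t) -> exists y, is_integral D f y.
Proof.
move=> sepX mf IPhi fPhi; have [xs [xs0 xsd]] := separable_seq sepX.
have near_int n : exists y, is_integral D (fun t => nearest xs n (f t)) y.
  apply: (@is_integral_simple _ _ D mD xs (fun t => nearest_idx xs n (f t)) n
    (fun t => 2 * Phi t)).
  - by move=> t; exact: nearest_idx_le.
  - exact: (measurable_nearest mD xs n mf).2.
  - exact: (integrableZl mD 2 IPhi).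
  - move=> t Dt; apply: (le_trans (nearest_norm xs0 n (f t))).
    by rewrite ler_wpM2l// fPhi.
have [ys hys] := choice near_int.
apply: (@is_integral_cvg _ _ D mD (fun n t => nearest xs n (f t)) f ys Phi) => //.
- by move=> n; exact: (measurable_nearest mD xs n mf).1.
- by move=> n t Dt; rewrite (le_trans (nearest_le_norm xs0 n (f t)))// fPhi.
- by move=> t Dt; exact: nearest_cvg.
Qed.

End PettisIntegrable.

(** * Power kernels on the half-line *)

Lemma le_of_eq (R : numDomainType) (x y : R) : x = y -> x <= y.
Proof. by move=> ->. Qed.

Lemma powRD_gt0 (R : realType) (x r s : R) : 0 < x ->
  x `^ (r + s) = x `^ r * x `^ s.
Proof. by move=> x0; rewrite powRD//; apply/implyP => _; rewrite gt_eqF. Qed.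

Section PowerKernel.
Context {R : realType}.
Notation mu := (@lebesgue_measure R).

Lemma continuous_powR_gt0 (a x : R) : 0 < x -> {for x, continuous (fun t : R => t `^ a)}.
Proof.
move=> x0; apply: differentiable_continuous; apply/derivable1_diffP.
by apply: derivable_powR; rewrite in_itv /= x0.
Qed.

Lemma derive1_powR_div (a x : R) : a != 0 -> 0 < x ->
  derive1 (fun t : R => t `^ a / a) x = x `^ (a - 1).
Proof.
move=> a0 x0; have dx : derivable (fun t : R => t `^ a) x 1.
  by apply: derivable_powR; rewrite in_itv /= x0.
rewrite derive1E.
rewrite [X in 'D_1 X x](_ : _ = a^-1 *: (fun t : R => t `^ a)); last first.
  by apply/funext => t; rewrite mulrC.
rewrite deriveZ//= -derive1E powR_derive1 ?in_itv /= ?x0//.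
by rewrite /GRing.scale /= mulrA mulVf// mul1r.
Qed.

Lemma derivable_powR_div (a x : R) : 0 < x ->
  derivable (fun t : R => t `^ a / a) x 1.
Proof.
move=> x0; rewrite [X in derivable X](_ : _ = a^-1 *: (fun t : R => t `^ a)).
  by apply: derivableZ; apply: derivable_powR; rewrite in_itv /= x0.
by apply/funext => t; rewrite mulrC.
Qed.

Lemma measurable_powR_fun (a : R) (D : set R) : measurable_fun D (fun t : R => t `^ a).
Proof. by apply: measurable_funTS; exact: measurable_powR. Qed.

Lemma integral_powR_itv (a x y : R) : a != 0 -> 0 < x -> x < y ->
  (\int[mu]_(t in `[x, y]) (t `^ (a - 1))%:E = (y `^ a / a - x `^ a / a)%:E)%E.
Proof.
move=> a0 x0 xy; rewrite EFinB.
have pos t : x <= t -> 0 < t by exact: lt_le_trans.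
have cF (z : R) : 0 < z -> {for z, continuous (fun t : R => t `^ a / a)}.
  by move=> z0; apply: cvgMl; exact: continuous_powR_gt0.
apply: (@continuous_FTC2 R (fun t => t `^ (a - 1)) (fun t => t `^ a / a)) => //.
- apply: continuous_in_subspaceT => t; rewrite inE /= in_itv /= => /andP[xt _].
  exact: continuous_powR_gt0 (pos _ xt).
- split.
  + move=> t; rewrite in_itv /= => /andP[/ltW xt _].
    exact: derivable_powR_div (pos _ xt).
  + by apply: cvg_at_right_filter; exact: cF.
  + by apply: cvg_at_left_filter; apply: cF; exact: lt_trans xy.
- move=> t; rewrite in_itv /= => /andP[/ltW xt _].
  exact: derive1_powR_div (pos _ xt).
Qed.

(** The power may be unbounded at 0, so the integral is the limit of those over
    [[lam / (n + 2), lam]], where the fundamental theorem of calculus applies. *)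
Lemma integral_powR_near0 (p lam : R) : 0 < p -> 0 < lam ->
  (\int[mu]_(t in `]0%R, lam]) (t `^ (p - 1))%:E <= (lam `^ p / p)%:E)%E.
Proof.
move=> p0 l0.
pose D : set (measurableTypeR R) := `]0, lam]%classic.
pose E n : set (measurableTypeR R) := `[lam / n.+2%:R, lam]%classic.
have en0 n : 0 < lam / n.+2%:R by rewrite divr_gt0.
have enl n : lam / n.+2%:R < lam.
  by rewrite ltr_pdivrMr// ltr_pMr// (ltr_nat R 1).
pose f (t : measurableTypeR R) : \bar R := (t `^ (p - 1))%:E.
pose g n := f \_ (E n).
have mE n : measurable (E n) by exact: measurable_itv.
have mD : measurable D by exact: measurable_itv.
have mf A : measurable_fun A f by apply/measurable_EFinP; exact: measurable_powR_fun.
have mg n : measurable_fun D (g n).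
  by apply: measurable_funTS; apply/(measurable_restrictT _ (mE n)).
have f0 t : (0 <= f t)%E by rewrite lee_fin powR_ge0.
have g0 n t : (0 <= g n t)%E by rewrite /g /patch; case: ifP.
have En n m : (n <= m)%N -> E n `<=` E m.
  move=> nm; apply: subset_itvr; rewrite bnd_simp ler_pM2l//.
  by rewrite lef_pV2 ?posrE// ler_nat.
have nd t : nondecreasing_seq (g ^~ t).
  move=> n m nm; rewrite /g /patch; have [tn|_] := boolP (t \in E n).
    by rewrite (mem_set (En _ _ nm _ (set_mem tn))).
  by case: ifP.
have lim t : D t -> limn (g ^~ t) = f t.
  rewrite /D /= in_itv /= => /andP[t0 tl]; apply/cvg_lim => //.
  apply: cvg_near_cst.
  exists (Num.truncn (lam / t)) => // n /= hn.
  rewrite /g /patch mem_set// /E /= in_itv /= tl andbT.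
  rewrite ler_pdivrMr// mulrC -ler_pdivrMr//.
  apply: (le_trans (ltW (truncnS_gt _))); rewrite ler_nat.
  by rewrite (leq_trans (n := n.+1)).
have -> : (\int[mu]_(t in D) f t = \int[mu]_(t in D) limn (g ^~ t))%E.
  by apply: eq_integral => t /set_mem /lim ->.
have := @cvg_monotone_convergence _ _ _ mu D mD g mg (fun n t _ => g0 n t) (fun t _ => nd t).
move=> /cvg_lim <- //; apply: lime_le.
  apply: ereal_nondecreasing_is_cvgn => n m nm; apply: ge0_le_integral => //.
  by move=> t _; exact: nd.
apply: nearW => n; rewrite -integral_mkcondr.
rewrite [D `&` E n](_ : _ = E n); last first.
  apply/seteqP; split=> [t []//|t Et]; split=> //; move: Et.
  by rewrite /E /D /= !in_itv /= => /andP[h ->]; rewrite (lt_le_trans (en0 n) h).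
rewrite integral_powR_itv ?gt_eqF// lee_fin gerBl.
by rewrite divr_ge0 ?powR_ge0// ltW.
Qed.

Lemma powR_cvg_pinfty (q : R) : 0 < q -> (t `^ (- q) : R) @[t --> +oo%R] --> (0 : R).
Proof.
move=> q0; apply/cvgrPdist_lt => e e0.
exists (e `^ (- q^-1)); split; first exact: num_real.
move=> t et; rewrite sub0r normrN ger0_norm ?powR_ge0//.
have t0 : 0 < t by rewrite (le_lt_trans _ et)// powR_ge0.
rewrite powRN -[ltRHS]invrK ltf_pV2 ?posrE ?invr_gt0 ?powR_gt0//.
have : (e `^ (- q^-1)) `^ q < t `^ q.
  by apply: gt0_ltr_powR => //; rewrite nnegrE ?powR_ge0// ltW.
by rewrite -powRrM mulNr mulVf ?gt_eqF// powR_inv1// ltW.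
Qed.

Lemma integral_powR_infty (q lam : R) : 0 < q -> 0 < lam ->
  (\int[mu]_(t in `[lam, +oo[) (t `^ (- q - 1))%:E = (lam `^ (- q) / q)%:E)%E.
Proof.
move=> q0 l0; have nq0 : - q != 0 by rewrite oppr_eq0 gt_eqF.
have pos t : lam <= t -> 0 < t by exact: lt_le_trans.
rewrite (@ge0_continuous_FTC2y R _ (fun t => t `^ (- q) / (- q)) lam 0).
- by rewrite sub0e -EFinN invrN mulrN opprK.
- by move=> t _; exact: powR_ge0.
- apply: continuous_in_subspaceT => t; rewrite inE /= in_itv /= andbT => xt.
  exact: continuous_powR_gt0 (pos _ xt).
- rewrite -[X in _ --> X](mul0r (- q)^-1); apply: cvgMl; exact: powR_cvg_pinfty.
- by move=> t /ltW lt; exact: derivable_powR_div (pos _ lt).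
- apply: cvg_at_right_filter; apply: cvgMl; exact: continuous_powR_gt0.
- move=> t; rewrite in_itv /= andbT => /ltW lt.
  exact: derive1_powR_div (pos _ lt).
Qed.

Local Notation D := (`]0%R, +oo[%classic : set (measurableTypeR R)).

(** The function is compared with [t ^ (p - 1)] on [(0, lam]] and with
    [t ^ (- q - 1)] on the rest of the half-line. Optimizing over [lam] is what
    interpolates between the two bounds. *)
Lemma integral_power_kernel (f : R -> R) (p q a b lam : R) :
  0 < p -> 0 < q -> 0 < lam -> measurable_fun D f ->
  (forall t, 0 < t -> 0 <= f t) ->
  (forall t, 0 < t -> f t <= a * t `^ (p - 1)) ->
  (forall t, 0 < t -> f t <= b * t `^ (- q - 1)) ->
  (\int[mu]_(t in D) (f t)%:E <= (a * (lam `^ p / p) + b * (lam `^ (- q) / q))%:E)%E.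
Proof.
move=> p0 q0 l0 mf f0 fa fb.
have a0 : 0 <= a by have := le_trans (f0 _ ltr01) (fa _ ltr01); rewrite powR1 mulr1.
have b0 : 0 <= b by have := le_trans (f0 _ ltr01) (fb _ ltr01); rewrite powR1 mulr1.
have D1 : D = `]0, lam]%classic `|` `]lam, +oo[%classic.
  apply/seteqP; split=> t; rewrite /= !in_itv /= !andbT.
    by move=> t0; case: (leP t lam) => h; [left; rewrite t0|right].
  by case=> [/andP[]//|]; exact: lt_trans.
have mDf A : measurable A -> A `<=` D -> measurable_fun A (fun t => (f t)%:E).
  by move=> mA AD; apply/measurable_EFinP; apply: measurable_funS mf.
have s1 : `]0, lam]%classic `<=` D by rewrite D1; left.
have s2 : `]lam, +oo[%classic `<=` D by rewrite D1; right.
rewrite D1 ge0_integral_setU//=; last 3 first.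
- by rewrite -D1; exact: mDf.
- move=> t h; have : D t by rewrite D1.
  by rewrite /= in_itv /= andbT lee_fin => /f0.
- rewrite disj_set2E; apply/eqP; rewrite -subset0 => t [] /=.
  by rewrite !in_itv /= => /andP[_ tl]; rewrite ltNge tl.
rewrite EFinD; apply: leeD.
  apply: (@le_trans _ _ (\int[mu]_(t in `]0%R, lam]) (a%:E * (t `^ (p - 1))%:E))%E).
    apply: ge0_le_integral => //=.
    - by move=> t; rewrite in_itv /= => /andP[t0 _]; rewrite lee_fin f0.
    - exact: (mDf _ (measurable_itv _) s1).
    - apply/measurable_EFinP; apply: measurable_funM; first exact: measurable_cst.
      exact: measurable_powR_fun.
    - by move=> t; rewrite in_itv /= => /andP[t0 _]; rewrite -EFinM lee_fin fa.
  rewrite ge0_integralZl_EFin//.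
  - by rewrite EFinM lee_wpmul2l ?lee_fin// integral_powR_near0.
  - by move=> t _; rewrite lee_fin powR_ge0.
  - by apply/measurable_EFinP; exact: measurable_powR_fun.
apply: (@le_trans _ _ (\int[mu]_(t in `]lam, +oo[) (b%:E * (t `^ (- q - 1))%:E))%E).
  apply: ge0_le_integral => //=.
  - by move=> t /s2 /=; rewrite in_itv /= andbT => t0; rewrite lee_fin f0.
  - exact: (mDf _ (measurable_itv _) s2).
  - apply/measurable_EFinP; apply: measurable_funM; first exact: measurable_cst.
    exact: measurable_powR_fun.
  - by move=> t /s2 /=; rewrite in_itv /= andbT => t0; rewrite -EFinM lee_fin fb.
rewrite ge0_integralZl_EFin//.
- rewrite EFinM lee_wpmul2l ?lee_fin// integral_itv_obnd_cbnd.
    by rewrite integral_powR_infty.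
  by apply/measurable_EFinP; exact: measurable_powR_fun.
- by move=> t _; rewrite lee_fin powR_ge0.
- by apply/measurable_EFinP; exact: measurable_powR_fun.
Qed.

Lemma integrable_power_kernel (f : R -> R) (p q a b : R) :
  0 < p -> 0 < q -> measurable_fun D f ->
  (forall t, 0 < t -> `|f t| <= a * t `^ (p - 1)) ->
  (forall t, 0 < t -> `|f t| <= b * t `^ (- q - 1)) ->
  mu.-integrable D (EFin \o f).
Proof.
move=> p0 q0 mf fa fb; apply/integrableP; split; first exact/measurable_EFinP.
have := @integral_power_kernel (fun t => `|f t|) p q a b 1 p0 q0 ltr01.
have mf' : measurable_fun D (fun t => `|f t|) by exact: measurableT_comp.
move=> /(_ mf' (fun t _ => normr_ge0 _) fa fb) h.
by apply: le_lt_trans (ltry _); exact: h.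
Qed.

Lemma is_integral_power_kernel (X : completeNormedModType R) (f : R -> X)
    (p q a b : R) : separable X ->
  0 < p -> 0 < q -> norm_measurable D f ->
  (forall t, 0 < t -> `|f t| <= a * t `^ (p - 1)) ->
  (forall t, 0 < t -> `|f t| <= b * t `^ (- q - 1)) ->
  exists2 y, is_integral D f y &
    forall lam, 0 < lam -> `|y| <= a * (lam `^ p / p) + b * (lam `^ (- q) / q).
Proof.
move=> sepX p0 q0 mf fa fb.
have mn := norm_measurable_norm mf.
have In : mu.-integrable D (EFin \o (fun t => `|f t|)).
  by apply: (integrable_power_kernel p0 q0 mn); move=> t t0; rewrite normr_id; auto.
have mD : measurable D by exact: measurable_itv.
have [y fy] := is_integral_exists mD sepX mf In (fun t _ => lexx _).
exists y => // lam l0.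
apply: (le_trans (is_integral_norm_le mD In (fun t _ => lexx _) fy)).
rewrite /Rintegral -lee_fin fineK; last exact: integrable_fin_num.
exact: integral_power_kernel.
Qed.

End PowerKernel.

(** * Dilations of the half-line and a vanishing double integral *)

Section Scaling.
Context {R : realType}.
Notation mu := (@lebesgue_measure R).
Local Notation D := (`]0%R, +oo[%classic : set (measurableTypeR R)).

(** Both sides are measures that agree on the intervals [(a, b]]. *)
Lemma lebesgue_measure_scale (k : R) (k0 : 0 < k) (A : set (measurableTypeR R)) :
  measurable A -> mu A = (k%:E * mu [set t | A (k * t)%R])%E.
Proof.
move=> mA; pose phi : measurableTypeR R -> measurableTypeR R := fun t => k * t.
have mphi : measurable_fun setT phi by exact: mulrl_measurable.
have [m mE] : exists m : {measure set (measurableTypeR R) -> \bar R},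
    m = pushforward mu phi :> (set _ -> _).
  by unshelve (eexists; reflexivity).
transitivity (mscale (NngNum (ltW k0)) m A); last by rewrite /mscale mE.
apply: lebesgue_measure_unique => // _ [[a b] /= _ <-].
rewrite /mscale /= mE /pushforward.
have -> : phi @^-1` `]a, b] = `]a / k, b / k]%classic.
  apply/seteqP; split=> t; rewrite /phi /= !in_itv /=;
    by rewrite ltr_pdivrMr// ler_pdivlMr// mulrC.
rewrite !lebesgue_measure_itv /= !lte_fin ltr_pM2r ?invr_gt0//.
case: ifP => _; last by rewrite mule0.
by rewrite -EFinB -EFinM -mulrBl mulrCA mulfV ?gt_eqF// mulr1 EFinB.
Qed.

Lemma ge0_integral_scale (k : R) (f : R -> \bar R) : 0 < k ->
  measurable_fun D f -> (forall t, 0 < t -> (0 <= f t)%E) ->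
  (\int[mu]_(t in D) f t = k%:E * \int[mu]_(t in D) f (k * t)%R)%E.
Proof.
move=> k0 mf f0; have mD : measurable D by exact: measurable_itv.
pose phi : measurableTypeR R -> measurableTypeR R := fun t => k * t.
have mphi : measurable_fun setT phi by exact: mulrl_measurable.
have f0' x : D x -> (0 <= f x)%E by rewrite /= in_itv /= andbT; exact: f0.
have [m mE] : exists m : {measure set (measurableTypeR R) -> \bar R},
    m = pushforward mu phi :> (set _ -> _).
  by unshelve (eexists; reflexivity).
rewrite (eq_measure_integral (mscale (NngNum (ltW k0)) m)); last first.
  move=> A mA _; apply: (etrans (lebesgue_measure_scale k0 mA)).
  by congr (_ * _)%E; exact: (congr1 (@^~ A) (esym mE)).
rewrite ge0_integral_mscale//; congr (_ * _)%E.
rewrite (eq_measure_integral (pushforward mu phi)); last by move=> A _ _; rewrite mE.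
rewrite ge0_integral_pushforward//; last by move=> x /set_mem; exact: f0'.
congr (integral _ _ _); apply/seteqP; split=> t; rewrite /phi /= !in_itv /= !andbT;
  by rewrite pmulr_rgt0.
Qed.

Lemma measurable_scale (k : R) d (T : measurableType d) (f : R -> T) : 0 < k ->
  measurable_fun D f -> measurable_fun D (fun t : measurableTypeR R => f (k * t)).
Proof.
move=> k0 mf; have mD : measurable D by exact: measurable_itv.
apply: (measurable_comp mD _ mf); last exact: mulrl_measurable.
by move=> _ [t + <-]; rewrite /= !in_itv /= !andbT => t0; rewrite mulr_gt0.
Qed.

Lemma integrable_scale (k : R) (f : R -> R) : 0 < k ->
  mu.-integrable D (EFin \o f) -> mu.-integrable D (EFin \o (fun t => f (k * t))).
Proof.
move=> k0 /integrableP[mf If]; apply/integrableP; split.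
  exact: (@measurable_scale k _ _ (EFin \o f)).
rewrite (@ge0_integral_scale k (fun t => `|(f t)%:E|%E)) // in If; last first.
  exact: measurableT_comp.
move: If; case: (integral _ _ _) => [r| |]; rewrite ?ltry//.
by rewrite mulry gtr0_sg// mul1e.
Qed.

Lemma Rintegral_scale (k : R) (f : R -> R) : 0 < k ->
  mu.-integrable D (EFin \o f) ->
  \int[mu]_(t in D) f t = k * \int[mu]_(t in D) f (k * t).
Proof.
move=> k0 If; have If' := integrable_scale k0 If.
have mD : measurable D by exact: measurable_itv.
have mf := measurable_int mu If.
rewrite /Rintegral integralE (ge0_integral_scale k0); last 2 first.
- exact: measurable_funepos.
- by move=> t _; exact: funepos_ge0.
rewrite [X in (_ - X)%E](ge0_integral_scale k0); last 2 first.
- exact: measurable_funeneg.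
- by move=> t _; exact: funeneg_ge0.
have fP := integrable_pos_fin_num mD If'; have fN := integrable_neg_fin_num mD If'.
pose fk : measurableTypeR R -> \bar R := EFin \o (fun t => f (k * t)).
transitivity (fine (k%:E * \int[mu]_(t in D) fk^\+ t -
                    k%:E * \int[mu]_(t in D) fk^\- t)%E).
  by congr (fine (_ * _ - _ * _)%E); apply: eq_integral => t _; rewrite ?funeposE ?funenegE.
rewrite -muleBr//; last by apply: fin_num_adde_defl; rewrite fin_numN.
rewrite -integralE fineM//; rewrite /fk; apply: integrable_fin_num => //.
Qed.

End Scaling.

Section ScalarKernel.
Context {R : realType}.
Notation mu := (@lebesgue_measure R).
Local Notation RT := (measurableTypeR R).
Local Notation D := (`]0%R, +oo[%classic : set RT).

Lemma inDP (t : R) : D t <-> 0 < t.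
Proof. by rewrite /= in_itv /= andbT. Qed.

Lemma measurable_D : measurable D. Proof. exact: measurable_itv. Qed.

(** The integrand of the power [1^(c - 1)] of the scalar operator 1, up to a
    constant. *)
Definition kern (c t : R) : R := t `^ (c - 1) / (1 + t).

Lemma measurable_inv1D (A : set RT) : A `<=` D -> measurable A ->
  measurable_fun A (fun t : RT => (1 + t)^-1).
Proof.
move=> AD mA; apply: (measurable_funS measurable_D AD).
apply: open_continuous_measurable_fun; first exact: interval_open.
move=> t /set_mem /inDP t0; apply: (@cvgV _ _ _ _ (fun x : R => 1 + x) (1 + t)).
  by rewrite gt_eqF// addr_gt0.
by apply: (@cvgD _ R^o); [exact: cvg_cst|exact: cvg_id].
Qed.

Lemma measurable_kern c : measurable_fun D (kern c).
Proof.
apply: measurable_funM; first exact: measurable_powR_fun.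
by apply: measurable_inv1D => //; exact: measurable_D.
Qed.

Lemma kern_ge0 c t : 0 < t -> 0 <= kern c t.
Proof. by move=> t0; rewrite divr_ge0 ?powR_ge0// addr_ge0// ltW. Qed.

Lemma integrable_kern c : 0 < c < 1 -> mu.-integrable D (EFin \o kern c).
Proof.
move=> /andP[c0 c1].
apply: (@integrable_power_kernel R _ c (1 - c) 1 1) => //.
- by rewrite subr_gt0.
- exact: measurable_kern.
- move=> t t0; rewrite ger0_norm ?kern_ge0// mul1r ler_pdivrMr ?addr_gt0//.
  by rewrite ler_peMr ?powR_ge0// lerDl ltW.
- move=> t t0; rewrite ger0_norm ?kern_ge0// mul1r ler_pdivrMr ?addr_gt0//.
  have -> : t `^ (- (1 - c) - 1) = t `^ (c - 1) * t^-1.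
    rewrite opprB -[in RHS](powR_inv1 (ltW t0)) -powRD_gt0//.
  rewrite -mulrA ler_peMr ?powR_ge0//.
  by rewrite mulrDr mulVf ?gt_eqF// mulr1 lerDr invr_ge0 ltW.
Qed.

Lemma Rintegral_kern_gt0 c : 0 < c < 1 -> 0 < \int[mu]_(t in D) kern c t.
Proof.
move=> c01; have /andP[c0 c1] := c01.
pose I : set RT := `]0, 1]%classic.
have mI : measurable I by exact: measurable_itv.
have ID : I `<=` D by move=> t /=; rewrite !in_itv /= andbT => /andP[].
have muI : mu I = 1%E by rewrite lebesgue_measure_itv /= lte_fin ltr01 sube0.
have IkI : mu.-integrable I (EFin \o kern c).
  exact: integrableS (integrable_kern c01).
apply: (@lt_le_trans _ _ (\int[mu]_(t in I) (2^-1 : R))).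
  by rewrite Rintegral_cst// [fine _](congr1 fine muI) mulr1 invr_gt0.
apply: (@le_trans _ _ (\int[mu]_(t in I) kern c t)).
  apply: le_Rintegral => //.
    apply/integrableP; split; first exact: measurable_cst.
    by rewrite integral_cst//= muI mule1 ltry.
  move=> t; rewrite /I /= in_itv /= => /andP[t0 t1]; rewrite /kern.
  have h1 : 1 <= t `^ (c - 1).
    have -> : c - 1 = - (1 - c) by rewrite opprB.
    rewrite powRN invf_ge1 ?powR_gt0//.
    have : t `^ (1 - c) <= 1 `^ (1 - c).
      by apply: ge0_ler_powR; rewrite ?nnegrE ?subr_ge0 ?(ltW t0) ?(ltW c1) ?ler01.
    by rewrite powR1.
  rewrite ler_pdivlMr ?addr_gt0//; lra.
rewrite /Rintegral fine_le//.
- exact: integrable_fin_num.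
- by apply: integrable_fin_num => //; exact: (integrable_kern c01).
- apply: ge0_subset_integral => //.
    by apply/measurable_EFinP; exact: measurable_kern.
  by move=> t /inDP t0; rewrite lee_fin kern_ge0.
Qed.

End ScalarKernel.

Section DoubleIntegral.
Context {R : realType}.
Notation mu := (@lebesgue_measure R).
Local Notation RT := (measurableTypeR R).
Local Notation D := (`]0%R, +oo[%classic : set RT).

Variables (c C : R) (g : R -> R) (phi : R -> R -> R).
Hypothesis c01 : 0 < c < 1.
Hypothesis mg : measurable_fun D g.
Hypothesis Ig : mu.-integrable D (EFin \o (fun s => g s / s)).
Hypothesis phiE : forall s t, 0 < s -> 0 < t -> phi s t * (t - s) = g s - g t.
Hypothesis phi_le : forall s t, 0 < s -> 0 < t ->
  `|phi s t| <= C / ((1 + s) * (1 + t)).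

Hypothesis mphi : forall s, 0 < s -> measurable_fun D (phi s).

Let G := g \_ D.
(** The integrand after the substitution [t = s * u]. The factor [phi s (s * u)] is
    expressed through [g], which makes it jointly measurable; on the null set
    [u = 1] the quotient is [0]. *)
Let h (z : RT * RT) : R := \1_D z.1 * \1_D z.2 *
  (z.2 `^ (c - 1) * ((G z.1 - G (z.1 * z.2)) / (z.1 * (z.2 - 1)))).

Let GE t : 0 < t -> G t = g t.
Proof. by move=> t0; rewrite /G /patch mem_set//; apply/inDP. Qed.

Let h_out s u : ~ (0 < s /\ 0 < u) -> h (s, u) = 0.
Proof.
move=> su; rewrite /h /= !indicE.
have [/set_mem/inDP s0|] := boolP (s \in D); last by rewrite !mul0r.
have [/set_mem/inDP u0|] := boolP (u \in D); last by rewrite mulr0 mul0r.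
by exfalso; apply: su.
Qed.

Let hE s u : 0 < s -> 0 < u -> u != 1 -> h (s, u) = u `^ (c - 1) * phi s (s * u).
Proof.
move=> s0 u0 u1; have su0 : 0 < s * u by rewrite mulr_gt0.
have us : s * (u - 1) != 0 by apply: mulf_neq0; [rewrite gt_eqF|rewrite subr_eq0].
rewrite /h /= !indicE !mem_set ?mul1r; try exact/inDP.
congr (_ * _); rewrite !GE// -(phiE s0 su0).
have -> : s * u - s = s * (u - 1) by ring.
by rewrite mulfK.
Qed.

Let h1 s : h (s, 1) = 0.
Proof. by rewrite /h /= subrr !(mulr0, invr0). Qed.

Let h_le s u : 0 < s -> 0 < u ->
  `|h (s, u)| <= C / (1 + s) * (u `^ (c - 1) / (1 + s * u)).
Proof.
move=> s0 u0; have su0 : 0 < s * u by rewrite mulr_gt0.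
have C0 : 0 <= C.
  have := le_trans (normr_ge0 _) (phi_le ltr01 ltr01).
  by rewrite pmulr_lge0// invr_gt0 mulr_gt0// addr_gt0.
have [->|u1] := eqVneq u 1.
  by rewrite h1 normr0 mulr_ge0// ?divr_ge0 ?powR_ge0// addr_ge0// ?mulr1 ltW.
rewrite hE// normrM ger0_norm ?powR_ge0//.
apply: (le_trans (ler_wpM2l (powR_ge0 _ _) (phi_le s0 su0))).
apply: le_of_eq.
by field; rewrite !gt_eqF// addr_gt0.
Qed.

Let mh : measurable_fun setT h.
Proof.
have mD : measurable D by exact: measurable_D.
have mG : measurable_fun setT G by apply/(measurable_restrictT _ mD).
have m1 : measurable_fun setT (fst : RT * RT -> R) by exact: measurable_fst.
have m2 : measurable_fun setT (snd : RT * RT -> R) by exact: measurable_snd.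
apply: measurable_funM.
  by apply: measurable_funM; apply: measurableT_comp => //; exact: measurable_indic.
apply: measurable_funM.
  exact: (measurableT_comp (measurable_powR (c - 1)) m2).
apply: measurable_funM.
  apply: measurable_funB; first exact: measurableT_comp.
  by apply: (measurableT_comp mG); exact: measurable_funM.
have minv : measurable_fun setT (@GRing.inv R).
  rewrite (_ : @GRing.inv R = fun x : R => x * (x ^+ 2) `^ (- 1)); last first.
    apply/funext => x; rewrite powR_inv1 ?sqr_ge0//.
    have [->|x0] := eqVneq x 0; first by rewrite invr0 mul0r.
    by field.
  apply: measurable_funM => //; apply: (measurableT_comp (measurable_powR (- 1))).
  exact: measurable_funX.
apply: (measurableT_comp minv); apply: measurable_funM => //.
by apply: measurable_funB => //; exact: measurable_cst.
Qed.

Let K c := \int[mu]_(t in D) kern c t.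

(** The bound [h_le] integrates in [u] to a kernel in [s] by the substitution
    [t = s * u], and that kernel is integrable again. *)
Let inner_le s : 0 < s ->
  (\int[mu]_u `|(h (s, u))%:E| <= (C * K c * kern (1 - c) s)%:E)%E.
Proof.
move=> s0.
have mD : measurable D by exact: measurable_D.
have -> : (\int[mu]_u `|(h (s, u))%:E| = \int[mu]_(u in D) `|(h (s, u))%:E|)%E.
  rewrite [RHS]integral_mkcond; apply: eq_integral => u _.
  rewrite /patch; case: ifPn => // /negP uD.
  by rewrite h_out ?abse0// => -[_ u0]; apply: uD; apply/mem_set/inDP.
have mhs : measurable_fun setT (fun u : RT => h (s, u)).
  exact: (measurableT_comp mh (pair1_measurable s)).
pose f (t : RT) : \bar R := (kern c t)%:E.
have scale : (\int[mu]_(t in D) f t = s%:E * \int[mu]_(t in D) f (s * t)%R)%E.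
  apply: ge0_integral_scale => //; first by apply/measurable_EFinP; exact: measurable_kern.
  by move=> t t0; rewrite lee_fin kern_ge0.
have C0 : 0 <= C.
  have := le_trans (normr_ge0 _) (phi_le ltr01 ltr01).
  by rewrite pmulr_lge0// invr_gt0 mulr_gt0// addr_gt0.
pose k := C * (s * kern (1 - c) s).
have k0 : 0 <= k by rewrite mulr_ge0// mulr_ge0 ?kern_ge0// ltW.
apply: (@le_trans _ _ (\int[mu]_(t in D) (k%:E * f (s * t)%R))%E).
  apply: ge0_le_integral => //.
  - by apply: measurableT_comp => //; apply/measurable_EFinP; apply: measurable_funTS.
  - apply: measurable_funeM; apply/measurable_EFinP.
    by apply: (measurable_scale s0); exact: measurable_kern.
  - move=> u /inDP u0; rewrite -EFinM lee_fin (le_trans (h_le s0 u0))//.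
    have e : s * (s `^ (1 - c - 1) * s `^ (c - 1)) = 1.
      rewrite -powRD_gt0//.
      rewrite (_ : _ + _ = -1); last by ring.
      by rewrite powR_inv1 ?ltW// mulfV// gt_eqF.
    rewrite /k /kern (powRM _ (ltW s0) (ltW u0)); apply: le_of_eq.
    transitivity (C / (1 + s) * (u `^ (c - 1) / (1 + s * u)) *
      (s * (s `^ (1 - c - 1) * s `^ (c - 1)))); first by rewrite e mulr1.
    by field; rewrite !gt_eqF// addr_gt0// mulr_gt0.
have scale' : (\int[mu]_(t in D) f (s * t)%R = (s^-1 * K c)%:E)%E.
  have fin : (\int[mu]_(t in D) f t)%E = (K c)%:E.
    by rewrite /K /Rintegral fineK//; apply: integrable_fin_num => //; exact: integrable_kern.
  by rewrite EFinM -fin scale muleA -EFinM mulVf ?gt_eqF// mul1e.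
rewrite ge0_integralZl_EFin//; last 2 first.
- by move=> t /inDP t0; rewrite lee_fin kern_ge0// mulr_gt0.
- by apply/measurable_EFinP; apply: (measurable_scale s0); exact: measurable_kern.
rewrite scale' -EFinM lee_fin /k; apply: le_of_eq.
by field; rewrite gt_eqF.
Qed.

Let integrable_h : (mu \x mu)%E.-integrable setT (EFin \o h).
Proof.
have mD : measurable D by exact: measurable_D.
have mEh : measurable_fun setT (EFin \o h) by exact/measurable_EFinP.
apply/(integrable12ltyP mu mu mEh).
pose k (s : RT) : \bar R := ((C * K c * kern (1 - c) s)%:E).
have c01' : 0 < 1 - c < 1 by move: c01 => /andP[? ?]; lra.
have Ik : mu.-integrable D k.
  exact: (integrableZl mD (C * K c) (integrable_kern c01')).
have mF : measurable_fun setT (fun s : RT => \int[mu]_u `|(h (s, u))%:E|)%E.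
  apply: (measurable_fun_fubini_tonelli_F (abse \o (EFin \o h))) => //.
    exact: measurableT_comp.
  by move=> x; exact: abse_ge0.
rewrite [X in (X < _)%E](_ : _ = \int[mu]_(s in D) \int[mu]_u `|(h (s, u))%:E|)%E; last first.
  rewrite [RHS]integral_mkcond; apply: eq_integral => s _.
  rewrite /patch; case: ifPn => // /negP sD.
  rewrite integral0_eq// => u _.
  by rewrite /= h_out ?normr0// => -[s0 _]; apply: sD; apply/mem_set/inDP.
apply: (@le_lt_trans _ _ (\int[mu]_(s in D) k s)%E).
  apply: ge0_le_integral => //.
  - by move=> s _; exact: integral_ge0.
  - exact: measurable_funTS.
  - exact: measurable_int Ik.
  - by move=> s /inDP; exact: inner_le.
by rewrite ltey_eq integrable_fin_num.
Qed.

Let int_s_h u : (\int[mu]_s (h (s, u))%:E = 0)%E.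
Proof.
have mD : measurable D by exact: measurable_D.
have [u0|u0] := boolP (0 < u); last first.
  by apply: integral0_eq => s _; rewrite h_out// => -[_ u0']; rewrite u0' in u0.
have [->|u1] := eqVneq u 1.
  by apply: integral0_eq => s _; rewrite h1.
pose q s := g s / s.
have Iq' := integrable_scale u0 Ig.
have -> : (\int[mu]_s (h (s, u))%:E =
    \int[mu]_(s in D) (u `^ (c - 1) / (u - 1) * (q s - u * q (u * s)))%:E)%E.
  rewrite [RHS]integral_mkcond; apply: eq_integral => s _.
  rewrite /patch; case: ifPn => [/set_mem/inDP s0|/negP sD].
    congr EFin; rewrite hE// /q.
    have us : s * (u - 1) != 0 by apply: mulf_neq0; [rewrite gt_eqF|rewrite subr_eq0].
    have -> : phi s (s * u) = (g s - g (s * u)) / (s * (u - 1)).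
      rewrite -phiE ?mulr_gt0//.
      have -> : s * u - s = s * (u - 1) by ring.
      by rewrite mulfK.
    rewrite (mulrC s u); field.
    by rewrite subr_eq0 u1 !gt_eqF.
  by rewrite h_out// => -[s0 _]; apply: sD; apply/mem_set/inDP.
have I1 : mu.-integrable D (EFin \o (fun s => u * q (u * s))).
  exact: (integrableZl mD u Iq').
have I2 : mu.-integrable D (EFin \o (fun s => q s - u * q (u * s))).
  exact: (integrableB mD Ig I1).
under eq_integral do rewrite EFinM.
rewrite integralZl//.
suff -> : (\int[mu]_(s in D) (q s - u * q (u * s))%:E = 0)%E by rewrite mule0.
rewrite -[LHS]fineK; last exact: integrable_fin_num.
congr EFin; rewrite -[LHS]/(\int[mu]_(s in D) (q s - u * q (u * s))).
rewrite RintegralB// RintegralZl//.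
by rewrite -(Rintegral_scale u0 Ig) subrr.
Qed.

Let int_u_h s : 0 < s ->
  (\int[mu]_u (h (s, u))%:E =
    (s `^ (- c) * \int[mu]_(t in D) (t `^ (c - 1) * phi s t))%:E)%E.
Proof.
move=> s0; have mD : measurable D by exact: measurable_D.
pose f (t : R) := t `^ (c - 1) * phi s t.
have If : mu.-integrable D (EFin \o f).
  apply: (le_integrable mD _ _ (integrableZl mD (C / (1 + s)) (integrable_kern c01))).
    apply/measurable_EFinP; apply: measurable_funM; last exact: mphi.
    exact: measurable_powR_fun.
  move=> t /inDP t0 /=; rewrite lee_fin normrM ger0_norm ?powR_ge0//.
  apply: (le_trans (ler_wpM2l (powR_ge0 _ _) (phi_le s0 t0))).
  apply: le_trans (ler_norm _); rewrite /kern; apply: le_of_eq.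
  by field; rewrite !gt_eqF// addr_gt0.
have If' := integrable_scale s0 If.
have e : s `^ (- c) * (s * s `^ (c - 1)) = 1.
  rewrite mulrCA -powRD_gt0//.
  rewrite (_ : _ + _ = -1); last by ring.
  by rewrite powR_inv1 ?(ltW s0)// mulfV// gt_eqF.
rewrite -[X in (_ * X)%:E]/(\int[mu]_(t in D) f t) (Rintegral_scale s0 If).
have -> : (\int[mu]_u (h (s, u))%:E = \int[mu]_(u in D) (h (s, u))%:E)%E.
  rewrite [RHS]integral_mkcond; apply: eq_integral => u _.
  rewrite /patch; case: ifPn => // /negP uD.
  by rewrite h_out// => -[_ u0]; apply: uD; apply/mem_set/inDP.
have mhs : measurable_fun setT (fun u : RT => h (s, u)).
  exact: (measurableT_comp mh (pair1_measurable s)).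
have -> : (\int[mu]_(u in D) (h (s, u))%:E =
    \int[mu]_(u in D) ((s `^ (c - 1))^-1 * f (s * u))%:E)%E.
  apply: ae_eq_integral => //.
  - by apply/measurable_EFinP; exact: measurable_funTS.
  - exact: (measurable_int mu (integrableZl mD (s `^ (c - 1))^-1 If')).
  - exists [set 1 : RT]; split; [exact: measurable_set1|exact: lebesgue_measure_set1|].
    move=> u /= hu; apply: contrapT => u1; apply: hu => /inDP u0; congr EFin.
    rewrite hE//; last exact/eqP.
    rewrite /f powRM ?(ltW s0) ?(ltW u0)//; field.
    by rewrite gt_eqF// powR_gt0.
have Is := integrableZl mD (s `^ (c - 1))^-1 If'.
rewrite -[LHS]fineK; last by apply: (integrable_fin_num mD); exact: Is.
congr EFin.
rewrite -[LHS]/(\int[mu]_(u in D) ((s `^ (c - 1))^-1 * f (s * u))) RintegralZl//.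
rewrite mulrA; congr (_ * _).
have p0 : s `^ (c - 1) != 0 by rewrite gt_eqF// powR_gt0.
by apply: (mulIf p0); rewrite mulVf// -mulrA e.
Qed.

(** Writing [t = s * u], the inner integral becomes an integral in [u] of
    differences of [q s = g s / s] and of its dilation [u * q (u * s)], and
    Fubini's theorem lets [s] be integrated first: the two terms then cancel,
    because the integral of [q] is invariant under dilations. *)
Lemma double_integral_vanish :
  \int[mu]_(s in D) (s `^ (- c) * \int[mu]_(t in D) (t `^ (c - 1) * phi s t)) = 0.
Proof.
have mD : measurable D by exact: measurable_D.
transitivity (fine (\int[mu]_s \int[mu]_u (h (s, u))%:E)%E).
  rewrite /Rintegral; congr fine; rewrite integral_mkcond; apply: eq_integral => s _.
  rewrite /patch; case: ifPn => [/set_mem/inDP s0|/negP sD]; first by rewrite int_u_h.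
  rewrite integral0_eq// => u _.
  by rewrite h_out// => -[s0 _]; apply: sD; apply/mem_set/inDP.
have := Fubini integrable_h; rewrite /= => ->.
by rewrite integral0_eq// => u _; exact: int_s_h.
Qed.

End DoubleIntegral.

(** * Resolvent families *)

(** What the proof retains of a sectorial operator [L] with bounded inverse:
    its resolvent [J t = (t + L)^-1] on the half-line. *)
Record resolvent_family (R : realType) (X : normedModType R)
    (J : R -> {linear X -> X}) (M : R) : Prop := ResolventFamily {
  resolvent_eq : forall (s t : R) (x : X), 0 <= s -> 0 <= t ->
    J s x - J t x = (t - s) *: J s (J t x) ;
  resolvent_le : forall (t : R) (x : X), 0 <= t -> `|J t x| <= M / (1 + t) * `|x| ;
  resolvent_inj : forall x : X, J 0 x = 0 -> x = 0 ;
  resolvent_bound_ge0 : 0 <= M }.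

Section ResolventFamily.
Context {R : realType} {X : completeNormedModType R}.
Notation mu := (@lebesgue_measure R).
Local Notation D := (`]0%R, +oo[%classic : set (measurableTypeR R)).
Implicit Types (s t : R) (x : X).

Variables (J : R -> {linear X -> X}) (M : R).
Hypothesis HJ : resolvent_family J M.

Let J_eq := resolvent_eq HJ.
Let J_le := resolvent_le HJ.
Let J0_inj := resolvent_inj HJ.
Let M0 := resolvent_bound_ge0 HJ.

(** With [J t = (t + L)^-1], this is [L (t + L)^-1]. *)
Definition Yosida (t : R) (x : X) : X := x - t *: J t x.

Lemma Yosida_linear t : linear (Yosida t).
Proof.
move=> a x y; rewrite /Yosida linearP scalerDr opprD addrACA scalerBr.
by rewrite [t *: (a *: _)]scalerA [a *: (t *: _)]scalerA mulrC.
Qed.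

HB.instance Definition _ t :=
  GRing.isLinear.Build R X X _ (Yosida t) (Yosida_linear t).

Lemma J_le1 t x : 0 <= t -> `|J t x| <= M * `|x|.
Proof.
move=> t0; apply: (le_trans (J_le x t0)); rewrite ler_wpM2r//.
by rewrite ler_pdivrMr ?ler_peMr ?lerDl// ltr_pwDl.
Qed.

Lemma J_le_inv t x : 0 < t -> `|J t x| <= M / t * `|x|.
Proof.
move=> t0; apply: (le_trans (J_le x (ltW t0))); rewrite ler_wpM2r// ler_wpM2l//.
by rewrite lef_pV2 ?posrE ?addr_gt0// lerDr.
Qed.

Lemma J_continuous t : 0 <= t -> continuous (J t).
Proof. by move=> t0; apply: (@linear_bound_continuous _ _ _ (J t) M) => v; exact: J_le1. Qed.

Lemma JC s t x : 0 <= s -> 0 <= t -> J s (J t x) = J t (J s x).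
Proof.
move=> s0 t0; have [->//|st] := eqVneq s t.
have ts : t - s != 0 by rewrite subr_eq0 eq_sym.
apply: (scalerI ts); rewrite -J_eq// -[t - s]opprB scaleNr -J_eq//.
by rewrite opprB.
Qed.

Lemma Yosida_le t x : 0 <= t -> `|Yosida t x| <= (1 + M) * `|x|.
Proof.
move=> t0; apply: (le_trans (ler_normB _ _)); rewrite mulrDl mul1r lerD2l.
rewrite normrZ (ger0_norm t0); apply: (le_trans (ler_wpM2l t0 (J_le x t0))).
have t1 : 0 < 1 + t by rewrite ltr_pwDl.
by rewrite mulrA ler_wpM2r// mulrCA ler_piMr// ler_pdivrMr// mul1r lerDr.
Qed.

Lemma Yosida_continuous t : 0 <= t -> continuous (Yosida t).
Proof.
move=> t0.
by apply: (@linear_bound_continuous _ _ _ (Yosida t : {linear X -> X}) (1 + M)) => v;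
  exact: Yosida_le.
Qed.

Lemma YosidaJ s t x : 0 <= s -> 0 <= t -> Yosida s (J t x) = J t (Yosida s x).
Proof.
have e : J t (x - s *: J s x) = J t x - s *: J t (J s x) by rewrite linearB linearZ.
by move=> s0 t0; rewrite /Yosida e (JC x s0 t0).
Qed.

Lemma YosidaC s t x : 0 <= s -> 0 <= t -> Yosida s (Yosida t x) = Yosida t (Yosida s x).
Proof.
move=> s0 t0; rewrite [LHS](_ : _ = Yosida s x - t *: Yosida s (J t x)).
  by rewrite YosidaJ.
by rewrite {2}/Yosida linearB linearZ.
Qed.

(** Both sides are [L (s + L)^-1 (t + L)^-1]. *)
Lemma J_Yosida s t x : 0 <= s -> 0 <= t -> J s (Yosida t x) = J t (Yosida s x).
Proof.
have e a b : J a (x - b *: J b x) = J a x - b *: J a (J b x).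
  by rewrite linearB linearZ.
move=> s0 t0; rewrite /Yosida !e (JC x t0 s0).
have -> : J s x = J t x + (t - s) *: J s (J t x) by rewrite -J_eq// addrC subrK.
by rewrite scalerBl addrA addrAC addrK.
Qed.

Lemma J0_Yosida t x : 0 <= t -> J 0 (Yosida t x) = J t x.
Proof. by move=> t0; rewrite J_Yosida// /Yosida scale0r subr0. Qed.

Lemma J_lipschitz s t x : 0 <= s -> 0 <= t ->
  `|J s x - J t x| <= M * M * `|x| * `|s - t|.
Proof.
move=> s0 t0; rewrite J_eq// normrZ distrC mulrC ler_wpM2r//.
by rewrite (le_trans (J_le1 _ s0))// -mulrA ler_wpM2l// J_le1.
Qed.

Lemma J_cvg t x : 0 < t -> J s x @[s --> t] --> J t x.
Proof.
move=> t0; apply/cvgrPdist_le => e e0.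
pose K := M * M * `|x| + 1.
have K0 : 0 < K by rewrite ltr_pwDr// !mulr_ge0.
near=> s.
have s0 : 0 <= s by near: s; apply: (@filterS _ _ _ _ _ _ (lt_nbhsr t0)) => s /ltW.
apply: (le_trans (J_lipschitz _ (ltW t0) s0)).
apply: (@le_trans _ _ (K * `|t - s|)); first by rewrite ler_wpM2r// lerDl.
rewrite mulrC -ler_pdivlMr//.
by near: s; apply: (@cvgr_dist_le _ _ _ _ _ id t) => //; rewrite divr_gt0.
Unshelve. all: end_near. Qed.

Lemma Yosida_cvg t x : 0 < t -> Yosida s x @[s --> t] --> Yosida t x.
Proof.
move=> t0; apply: cvgB; first exact: cvg_cst.
by apply: cvgZ; [exact: cvg_id|exact: J_cvg].
Qed.

Lemma norm_measurable_powR_scale (a b : R) (f : R -> X) :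
  (forall t, 0 < t -> f s @[s --> t] --> f t) ->
  norm_measurable D (fun t : measurableTypeR R => (b * t `^ a) *: f t).
Proof.
move=> cf z; apply: open_continuous_measurable_fun; first exact: interval_open.
move=> t /set_mem /inDP t0; apply: cvg_norm; apply: cvgB; last exact: cvg_cst.
apply: cvgZ; last exact: cf.
by apply: cvgMr; exact: continuous_powR_gt0.
Qed.

End ResolventFamily.

(** * Fractional integrals of a resolvent family *)

Section FractionalIntegral.
Context {R : realType} {X : completeNormedModType R}.
Notation mu := (@lebesgue_measure R).
Local Notation D := (`]0%R, +oo[%classic : set (measurableTypeR R)).
Hypothesis sepX : separable X.
Implicit Types (s t c : R) (x y z : X).

Variables (J : R -> {linear X -> X}) (M : R).
Hypothesis HJ : resolvent_family J M.

Let J_eq := resolvent_eq HJ.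
Let J0_inj := resolvent_inj HJ.
Let M0 := resolvent_bound_ge0 HJ.
Let mD : measurable D. Proof. exact: measurable_D. Qed.
Let E := Yosida J.

(** The relation [y = nu * \int_0^oo t^-c (t + L)^-1 x dt]; for
    [nu = sin (pi c) / pi] it says that [y = L^-c x]. *)
Definition frac_integral (nu c : R) (x y : X) : Prop :=
  is_integral D (fun t => (nu * t `^ (- c)) *: J t x) y.

Lemma frac_integral_exists nu c x : 0 <= nu -> 0 < c < 1 ->
  exists2 y, frac_integral nu c x y &
    forall lam, 0 < lam ->
    `|y| <= nu * M * `|x| * (lam `^ (1 - c) / (1 - c)) +
            nu * M * `|x| * (lam `^ (- c) / c).
Proof.
move=> nu0 /andP[c0 c1].
apply: is_integral_power_kernel => //; first by rewrite subr_gt0.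
- by apply: norm_measurable_powR_scale => t t0; exact: (J_cvg HJ).
- move=> t t0; rewrite normrZ ger0_norm ?mulr_ge0 ?powR_ge0//.
  have -> : 1 - c - 1 = - c by ring.
  rewrite -!mulrA ler_wpM2l// mulrA [leRHS]mulrC ler_wpM2l ?powR_ge0//.
  exact: (J_le1 HJ _ (ltW t0)).
- move=> t t0; rewrite normrZ ger0_norm ?mulr_ge0 ?powR_ge0//.
  rewrite powRD_gt0//.
  rewrite powR_inv1 ?(ltW t0)//.
  rewrite [leRHS](_ : _ = nu * t `^ (- c) * (M / t * `|x|)); last by ring.
  by rewrite ler_wpM2l ?mulr_ge0 ?powR_ge0//; exact: (J_le_inv HJ).
Qed.

Lemma frac_integral_linear nu c a x x' y y' :
  frac_integral nu c x y -> frac_integral nu c x' y' ->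
  frac_integral nu c (a *: x + x') (a *: y + y').
Proof.
move=> xy xy'; have := is_integralD mD (is_integralZ a xy) xy'.
apply: (eq_is_integral mD) => t _.
by rewrite linearP scalerDr !scalerA [a * _]mulrC.
Qed.

Lemma frac_integral_apply (T : {linear X -> X}) nu c x y : continuous T ->
  (forall t z, 0 < t -> T (J t z) = J t (T z)) ->
  frac_integral nu c x y -> frac_integral nu c (T x) (T y).
Proof.
move=> cT TJ xy; have := is_integral_linear cT xy.
by apply: (eq_is_integral mD) => t /set_mem /inDP t0; rewrite /= linearZ /= TJ.
Qed.

(** The integrand of [E t y], with variable [s], is dominated by
    [s ^ (- c) * min (1 / t) (1 / s)], because [J s (E t z) = J t (E s z)]. *)
Lemma Yosida_frac_integral nu c x y t : 0 <= nu -> 0 < c < 1 -> 0 < t ->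
  frac_integral nu c x y ->
  `|E t y| <= nu * M * (1 + M) * ((1 - c)^-1 + c^-1) * t `^ (- c) * `|x|.
Proof.
move=> nu0 c01 t0 xy; have /andP[c0 c1] := c01.
have Ey : frac_integral nu c (E t x) (E t y).
  apply: (@frac_integral_apply (Yosida J t : {linear X -> X})) => //.
    exact: (Yosida_continuous HJ (ltW t0)).
  by move=> s z s0; exact: (YosidaJ HJ z (ltW t0) (ltW s0)).
have JE s : 0 < s -> `|J s (E t x)| <= M * (1 + M) * `|x| / t /\
                     `|J s (E t x)| <= M * (1 + M) * `|x| / s.
  move=> s0; split.
    rewrite /E (J_Yosida HJ) ?(ltW t0) ?(ltW s0)//.
    apply: (le_trans (J_le_inv HJ _ t0)).
    rewrite [leRHS](_ : _ = M / t * ((1 + M) * `|x|)); last by ring.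
    rewrite ler_wpM2l ?divr_ge0 ?(ltW t0)//; exact: (Yosida_le HJ _ (ltW s0)).
  apply: (le_trans (J_le_inv HJ _ s0)).
  rewrite [leRHS](_ : _ = M / s * ((1 + M) * `|x|)); last by ring.
  rewrite ler_wpM2l ?divr_ge0 ?(ltW s0)//; exact: (Yosida_le HJ _ (ltW t0)).
pose K := nu * (M * (1 + M) * `|x|).
have [y' Ey'] : exists2 y', frac_integral nu c (E t x) y' &
    forall lam, 0 < lam -> `|y'| <= K / t * (lam `^ (1 - c) / (1 - c)) +
                               K * (lam `^ (- c) / c).
  apply: is_integral_power_kernel => //; first by rewrite subr_gt0.
  - by apply: norm_measurable_powR_scale => s s0; exact: (J_cvg HJ).
  - move=> s s0; rewrite normrZ ger0_norm ?mulr_ge0 ?powR_ge0//.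
    have -> : 1 - c - 1 = - c by ring.
    rewrite [leRHS](_ : _ = nu * s `^ (- c) * (M * (1 + M) * `|x| / t)); last first.
      by rewrite /K; ring.
    by rewrite ler_wpM2l ?mulr_ge0 ?powR_ge0//; exact: (JE s s0).1.
  - move=> s s0; rewrite normrZ ger0_norm ?mulr_ge0 ?powR_ge0//.
    rewrite powRD_gt0//.
    rewrite powR_inv1 ?(ltW s0)//.
    rewrite [leRHS](_ : _ = nu * s `^ (- c) * (M * (1 + M) * `|x| / s)); last first.
      by rewrite /K; ring.
    by rewrite ler_wpM2l ?mulr_ge0 ?powR_ge0//; exact: (JE s s0).2.
move=> /(_ t t0); rewrite (is_integral_unique mD Ey' Ey).
rewrite powRD_gt0//.
rewrite powRr1 ?(ltW t0)// => h; apply: (le_trans h).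
apply: le_of_eq; rewrite /K.
by field; rewrite !gt_eqF// subr_gt0.
Qed.

(** The two integrals of [L^-c] and [L^-(1-c)] compose to a multiple of [L^-1].
    The constant is computed on the scalar resolvent [1 / (1 + t)], which is
    subtracted so that the remainder vanishes at [t = 0]. *)
Lemma frac_integral_complement nu nu' c x y y' : 0 < nu -> 0 < nu' -> 0 < c < 1 ->
  frac_integral nu' (1 - c) x y' -> frac_integral nu c y' y ->
  y = (nu * nu' * (\int[mu]_(t in D) kern (1 - c) t) *
       (\int[mu]_(t in D) kern c t)) *: J 0 x.
Proof.
move=> nu0 nu'0 c01 xy' yy'; have /andP[c0 c1] := c01.
set k := nu * nu' * _ * _.
apply/eqP; rewrite -subr_eq0 -normr_le0.
have [ell [cell <- _]] := norming_functional (y - k *: J 0 x).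
rewrite linearB linearZ /= /GRing.scale /= subr_le0; apply: le_of_eq.
pose ellR (v : X) : R := ell v.
have [Kl Kl0 ellle] := continuous_linear_bound cell.
pose a := ellR (J 0 x).
(* the scalar resolvent is scaled so that [g] vanishes at 0, which makes
   [g s / s] integrable there *)
pose g s := ellR (J s x) - a / (1 + s).
pose phi s t := ellR (J s (J t x)) - a / ((1 + s) * (1 + t)).
have phiE s t : 0 < s -> 0 < t -> phi s t * (t - s) = g s - g t.
  move=> s0 t0; rewrite /phi /g mulrBl.
  have -> : ellR (J s (J t x)) * (t - s) = ellR (J s x) - ellR (J t x).
    by rewrite /ellR -linearB J_eq ?ltW// linearZ mulrC.
  by field; rewrite !gt_eqF// addr_gt0.
have contJ s : 0 <= s -> continuous (fun z => ellR (J s z)).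
  by move=> s0 z; apply: continuous_comp; [exact: (J_continuous HJ s0)|exact: cell].
have mJ (h : X -> R) : continuous h -> measurable_fun D (fun t => h (J t x)).
  move=> ch; apply: open_continuous_measurable_fun; first exact: interval_open.
  move=> t /set_mem /inDP t0.
  exact: (@cvg_comp _ _ _ (fun t => J t x) h _ _ _ (J_cvg HJ (x := x) t0) (ch (J t x))).
have minv : measurable_fun D (fun t : measurableTypeR R => (1 + t)^-1).
  exact: measurable_inv1D.
have mg : measurable_fun D g.
  apply: measurable_funB; first exact: (mJ ellR).
  by apply: measurable_funM => //; exact: measurable_cst.
have mphi s : 0 < s -> measurable_fun D (phi s).
  move=> s0; apply: measurable_funB.
    by apply: (mJ (fun z => ellR (J s z))); apply: contJ; exact: ltW.
  apply: (@eq_measurable_fun _ _ _ _ D (fun t => a / (1 + s) * (1 + t)^-1)).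
    by move=> t _; rewrite invfM mulrA.
  by apply: measurable_funM => //; exact: measurable_cst.
pose C := Kl * M * M * `|x| + `|a|.
have phi_le s t : 0 < s -> 0 < t -> `|phi s t| <= C / ((1 + s) * (1 + t)).
  move=> s0 t0; rewrite /phi /C [leRHS]mulrDl; apply: (le_trans (ler_normB _ _)).
  have s1 : 0 < 1 + s by rewrite addr_gt0.
  have t1 : 0 < 1 + t by rewrite addr_gt0.
  apply: lerD; last by rewrite normrM normfV (ger0_norm (ltW (mulr_gt0 s1 t1))).
  rewrite [leRHS](_ : _ = Kl * (M / (1 + s) * (M / (1 + t) * `|x|))); last first.
    by field; rewrite !gt_eqF.
  apply: (le_trans (ellle _)); rewrite ler_wpM2l//.
  apply: (le_trans (resolvent_le HJ _ (ltW s0))).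
  rewrite ler_wpM2l ?divr_ge0 ?(ltW s1)//; exact: (resolvent_le HJ _ (ltW t0)).
have g0_le s : 0 < s -> `|g s / s| <= (Kl * (M * M * `|x|) + `|a|) * s `^ (1 - 1).
  move=> s0; have s1 : 0 < 1 + s by rewrite addr_gt0.
  rewrite subrr powRr0 mulr1 normrM normfV (gtr0_norm s0) ler_pdivrMr//.
  have -> : g s = (ellR (J s x) - ellR (J 0 x)) + a * (s / (1 + s)).
    by rewrite /g /a; field; rewrite gt_eqF.
  apply: (le_trans (ler_normD _ _)); rewrite mulrDl; apply: lerD.
    rewrite -linearB; apply: (le_trans (ellle _)).
    rewrite -[leRHS]mulrA ler_wpM2l//.
    have := J_lipschitz HJ x (ltW s0) (lexx 0).
    by rewrite subr0 (gtr0_norm s0).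
  rewrite normrM ler_wpM2l// ger0_norm ?divr_ge0 ?(ltW s0) ?(ltW s1)//.
  by rewrite ler_pdivrMr// mulrDr mulr1 lerDl mulr_ge0// ltW.
have goo_le s : 0 < s -> `|g s / s| <= (Kl * (M * `|x|) + `|a|) * s `^ (- 1 - 1).
  move=> s0; have s1 : 0 < 1 + s by rewrite addr_gt0.
  rewrite powRD_gt0//.
  rewrite powR_inv1 ?(ltW s0)// mulrA normrM normfV (gtr0_norm s0).
  rewrite ler_wpM2r ?invr_ge0 ?(ltW s0)// mulrDl.
  apply: (le_trans (ler_normB _ _)); apply: lerD.
    apply: (le_trans (ellle _)); rewrite -[leRHS]mulrA ler_wpM2l// [leRHS]mulrAC.
    exact: (J_le_inv HJ _ s0).
  rewrite normrM normfV (gtr0_norm s1) ler_wpM2l// lef_pV2 ?posrE//.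
  by rewrite lerDr.
have Ig : mu.-integrable D (EFin \o (fun s => g s / s)).
  apply: (integrable_power_kernel ltr01 ltr01 _ g0_le goo_le).
  apply: measurable_funM => //; apply: open_continuous_measurable_fun.
    exact: interval_open.
  move=> t /set_mem /inDP t0; apply: (@cvgV _ _ _ _ id t); last exact: cvg_id.
  by rewrite gt_eqF.
have c01' : 0 < 1 - c < 1 by lra.
have vanish := double_integral_vanish c01 mg Ig phiE phi_le mphi.
pose Kc := \int[mu]_(t in D) kern c t; pose Kc' := \int[mu]_(t in D) kern (1 - c) t.
have inner s : 0 < s ->
    \int[mu]_(t in D) (t `^ (c - 1) * phi s t) = nu'^-1 * ellR (J s y') - a / (1 + s) * Kc.
  move=> s0; have cT := contJ s (ltW s0).
  have [I1 e1] := xy' (ell \o J s : {linear X -> R^o}) cT.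
  have e2 : ellR (J s y') = \int[mu]_(t in D) (nu' * (t `^ (c - 1) * ellR (J s (J t x)))).
    rewrite [LHS]e1; apply: eq_Rintegral => t _.
    have -> : c - 1 = - (1 - c) by rewrite opprB.
    by rewrite /= linearZ /= linearZ /= /GRing.scale /= mulrA.
  have I2 : mu.-integrable D (EFin \o (fun t => t `^ (c - 1) * ellR (J s (J t x)))).
    apply: (eq_integrable mD _ _ _ (integrableZl mD nu'^-1 I1)) => t _ /=.
    rewrite -EFinM; congr EFin; have -> : c - 1 = - (1 - c) by rewrite opprB.
    rewrite linearZ /= linearZ /= /GRing.scale /= !mulrA mulVf ?mul1r// gt_eqF//.
  have I3 : mu.-integrable D (EFin \o (fun t => a / (1 + s) * kern c t)).
    exact: (integrableZl mD _ (integrable_kern c01)).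
  rewrite e2 RintegralZl// mulrA mulVf ?gt_eqF// mul1r /Kc.
  rewrite -RintegralZl//; last exact: integrable_kern.
  rewrite -RintegralB//; apply: eq_Rintegral => t /set_mem /inDP t0.
  by rewrite /phi /kern; field; rewrite !gt_eqF// addr_gt0.
have [I1 e1] := yy' ell cell.
have I2 : mu.-integrable D (EFin \o (fun s => (nu * nu')^-1 * ellR ((nu * s `^ (- c)) *: J s y'))).
  exact: (integrableZl mD _ I1).
have I3 : mu.-integrable D (EFin \o (fun s => a * Kc * kern (1 - c) s)).
  exact: (integrableZl mD _ (integrable_kern c01')).
have : (nu * nu')^-1 * ellR y - a * Kc * Kc' = 0.
  rewrite -vanish /ellR e1 -RintegralZl// /Kc' -RintegralZl//; last exact: integrable_kern.
  rewrite -RintegralB//; apply: eq_Rintegral => s /set_mem /inDP s0.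
  rewrite inner// /kern /ellR linearZ /= /GRing.scale /=.
  have -> : 1 - c - 1 = - c by ring.
  by field; rewrite !gt_eqF// addr_gt0.
move=> /eqP; rewrite subr_eq0 => /eqP h; rewrite -[LHS]/(ellR y) -[ell _]/a.
have -> : ellR y = nu * nu' * ((nu * nu')^-1 * ellR y).
  by rewrite mulrA mulfV ?mul1r// mulf_neq0// gt_eqF.
by rewrite h /k -/Kc -/Kc'; ring.
Qed.

End FractionalIntegral.

Section FractionalRange.
Context {R : realType} {X : completeNormedModType R}.
Notation mu := (@lebesgue_measure R).
Local Notation D := (`]0%R, +oo[%classic : set (measurableTypeR R)).
Hypothesis sepX : separable X.
Implicit Types (s t c : R) (x y z : X).

Variables (J : R -> {linear X -> X}) (M : R).
Hypothesis HJ : resolvent_family J M.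

Let mD : measurable D. Proof. exact: measurable_D. Qed.

Definition complement_cst (nu nu' c : R) : R := nu * nu' *
  (\int[mu]_(t in D) kern (1 - c) t) * (\int[mu]_(t in D) kern c t).

Lemma complement_cst_gt0 nu nu' c : 0 < nu -> 0 < nu' -> 0 < c < 1 ->
  0 < complement_cst nu nu' c.
Proof.
move=> nu0 nu'0 c01; have c01' : 0 < 1 - c < 1 by lra.
by rewrite /complement_cst !mulr_gt0// Rintegral_kern_gt0.
Qed.

Lemma frac_integral0 nu c : frac_integral J nu c 0 0.
Proof.
have : is_integral D (fun=> 0 : X) 0 by exact: is_integral0.
apply: (eq_is_integral mD) => t _.
by rewrite linear0 scaler0.
Qed.

(** If the integral vanishes, then so does [L^-1 x], by the complement law. *)
Lemma frac_integral_inj nu c x : 0 < nu -> 0 < c < 1 ->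
  frac_integral J nu c x 0 -> x = 0.
Proof.
move=> nu0 c01 x0; have c01' : 0 < 1 - c < 1 by lra.
have cE : 1 - (1 - c) = c by ring.
have x0' : frac_integral J nu (1 - (1 - c)) x 0 by rewrite cE.
have := frac_integral_complement HJ ltr01 nu0 c01' x0' (frac_integral0 1 (1 - c)).
move=> /esym /eqP; rewrite scaler_eq0 gt_eqF/=; last exact: complement_cst_gt0.
by move=> /eqP; exact: resolvent_inj HJ _.
Qed.

(** The preimage of [y] under [L^-c] is a multiple of the integral of
    [t ^ (c - 1) L (t + L)^-1 y], as applying [L^-1] to both sides shows. *)
Lemma frac_integral_range nu c a b : 0 < nu -> 0 < c < 1 -> a < c -> c < b ->
  exists2 K, 0 <= K & forall y m1 m2,
    (forall t, 0 < t -> `|Yosida J t y| <= m1 * t `^ (- a)) ->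
    (forall t, 0 < t -> `|Yosida J t y| <= m2 * t `^ (- b)) ->
    exists2 w, frac_integral J nu c w y &
      forall lam, 0 < lam -> `|w| <= K * (m1 * lam `^ (c - a) + m2 * lam `^ (c - b)).
Proof.
move=> nu0 c01 ac cb; have ca0 : 0 < c - a by rewrite subr_gt0.
have bc0 : 0 < b - c by rewrite subr_gt0.
pose k := complement_cst nu 1 c.
have k0 : 0 < k by exact: complement_cst_gt0.
pose K := k^-1 * ((c - a)^-1 + (b - c)^-1).
exists K; first by rewrite mulr_ge0 ?addr_ge0 ?invr_ge0 ?ltW.
move=> y m1 m2 hm1 hm2.
have m10 : 0 <= m1.
  by have := le_trans (normr_ge0 _) (hm1 1 ltr01); rewrite powR1 mulr1.
have m20 : 0 <= m2.
  by have := le_trans (normr_ge0 _) (hm2 1 ltr01); rewrite powR1 mulr1.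
have addp t u v : 0 < t -> t `^ (u + v) = t `^ u * t `^ v.
  by move=> t0; exact: powRD_gt0.
have [w0 hw0 w0le] : exists2 w0,
    is_integral D (fun t => (1 * t `^ (- (1 - c))) *: Yosida J t y) w0 &
    forall lam, 0 < lam -> `|w0| <= m1 * (lam `^ (c - a) / (c - a)) +
                                    m2 * (lam `^ (- (b - c)) / (b - c)).
  apply: is_integral_power_kernel => //.
  - by apply: norm_measurable_powR_scale => t t0; exact: (Yosida_cvg HJ).
  - move=> t t0; rewrite normrZ mul1r ger0_norm ?powR_ge0//.
    rewrite (_ : c - a - 1 = - (1 - c) + (- a)); last by ring.
    by rewrite addp// mulrCA ler_wpM2l ?powR_ge0// hm1.
  - move=> t t0; rewrite normrZ mul1r ger0_norm ?powR_ge0//.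
    rewrite (_ : - (b - c) - 1 = - (1 - c) + (- b)); last by ring.
    by rewrite addp// mulrCA ler_wpM2l ?powR_ge0// hm2.
have hJ : frac_integral J 1 (1 - c) y (J 0 w0).
  have := is_integral_linear (J_continuous HJ (lexx 0)) hw0.
  apply: (eq_is_integral mD) => t /set_mem /inDP t0.
  by rewrite /= linearZ /= (J0_Yosida HJ)// ltW.
have [v hv _] := frac_integral_exists sepX HJ w0 (ltW nu0) c01.
have hJv : frac_integral J nu c (J 0 w0) (J 0 v).
  apply: (frac_integral_apply (J_continuous HJ (lexx 0)) _ hv) => t z t0.
  by rewrite (JC HJ)// ltW.
have vE : v = k *: y.
  apply/eqP; rewrite -subr_eq0; apply/eqP; apply: (resolvent_inj HJ).
  rewrite linearB linearZ /=.
  rewrite (frac_integral_complement HJ nu0 ltr01 c01 hJ hJv).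
  by rewrite subrr.
exists (k^-1 *: w0).
  have := frac_integral_linear k^-1 hv (frac_integral0 nu c).
  by rewrite !addr0 vE scalerA mulVf ?gt_eqF// scale1r.
move=> lam l0; rewrite normrZ gtr0_norm ?invr_gt0// /K -mulrA.
rewrite ler_wpM2l ?invr_ge0 ?(ltW k0)//.
apply: (le_trans (w0le lam l0)); rewrite opprB.
have h1 : 0 <= m1 * lam `^ (c - a) by rewrite mulr_ge0// powR_ge0.
have h2 : 0 <= m2 * lam `^ (c - b) by rewrite mulr_ge0// powR_ge0.
rewrite mulrDl !mulrDr !mulrA; rewrite -subr_ge0.
rewrite (_ : _ - _ = (c - a)^-1 * (m2 * lam `^ (c - b)) +
                     (b - c)^-1 * (m1 * lam `^ (c - a))); last by ring.
by rewrite addr_ge0// mulr_ge0// invr_ge0 ltW.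
Qed.

End FractionalRange.

(** * The resolvent of a sectorial operator on the half-line *)

Section Sectorial.
Context {R : realType} {X : normedModType R}.
Implicit Types (L : operator X) (x y : X) (t : R).

Lemma opfun0 L : L 0 = 0.
Proof.
have := opfunP (-1) (opdom0 L) (opdom0 L); rewrite scaleN1r addNr => ->.
by rewrite scaleN1r addNr.
Qed.

Lemma cnorm_real x : cnorm (x, 0) = `|x|.
Proof.
apply/eqP; rewrite eq_le; apply/andP; split.
  apply: ge_sup; first by exists `|cos 0 *: x + sin 0 *: 0|, 0.
  move=> _ [t _ <-] /=; rewrite scaler0 addr0 normrZ -[leRHS]mul1r ler_wpM2r//.
  by rewrite ler_norml cos_geN1 cos_le1.
apply: ub_le_sup.
  exists `|x| => _ [t _ <-] /=; rewrite scaler0 addr0 normrZ -[leRHS]mul1r ler_wpM2r//.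
  by rewrite ler_norml cos_geN1 cos_le1.
by exists 0 => //=; rewrite cos0 sin0 scale1r scaler0 addr0.
Qed.

Lemma norm_le_cnorm (z : X * X) : `|z.1| <= cnorm z.
Proof.
apply: ub_le_sup; last by exists 0 => //=; rewrite cos0 sin0 scale1r scale0r addr0.
exists (`|z.1| + `|z.2|) => _ [t _ <-] /=.
apply: (le_trans (ler_normD _ _)); rewrite !normrZ; apply: lerD.
  by rewrite -[leRHS]mul1r ler_wpM2r// ler_norml cos_geN1 cos_le1.
by rewrite -[leRHS]mul1r ler_wpM2r// ler_norml sin_geN1 sin_le1.
Qed.

(** The resolvent of the complexification at a real point acts on the real
    parts alone. *)
Lemma real_resolvent L t T : is_resolvent L (Complex (- t) 0) T -> forall x,
  [/\ opdom L (inv_shift L t x),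
      t *: inv_shift L t x + L (inv_shift L t x) = x,
      forall u, opdom L u -> t *: u + L u = x -> u = inv_shift L t x &
      `|inv_shift L t x| <= cnorm (T (- x, 0))].
Proof.
move=> [Tr Tl] x.
have uniq u : opdom L u -> t *: u + L u = x -> T (- x, 0) = (u, 0).
  move=> Du ux; rewrite -[RHS]Tl; last by split=> //; exact: opdom0.
  congr T; rewrite /cshift /= !scaler0 !scale0r opfun0 !subr0 addr0.
  by rewrite scaleNr -opprD ux.
have [[D1 D2] T1] := Tr (- x, 0).
have hx : t *: (T (- x, 0)).1 + L (T (- x, 0)).1 = x.
  move: T1; rewrite /cshift /= => -[e _]; apply: oppr_inj; rewrite -[RHS]e.
  by rewrite scale0r subr0 scaleNr opprD.
have [Di ix] : [set u | opdom L u /\ t *: u + L u = x] (inv_shift L t x).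
  by apply: xgetPex; exists (T (- x, 0)).1.
split => //.
  by move=> u Du ux; have := uniq _ Du ux; rewrite (uniq _ Di ix) => -[].
by rewrite (uniq _ Di ix); have := norm_le_cnorm (inv_shift L t x, 0).
Qed.

Lemma sector_neg (phi t : R) : 0 < phi < pi / 2 -> 0 < t ->
  sector phi (Complex (- t) 0).
Proof.
move=> /andP[p0 p2] t0; exists t, pi; split=> //.
  rewrite ger0_norm ?pi_ge0// lexx andbT.
  have := pi_gt0 R; lra.
by rewrite cospi sinpi mulrN1 mulr0.
Qed.

Lemma normc_neg t : 0 < t -> ComplexField.Normc.normc (Complex (- t) 0) = t.
Proof. by move=> t0; rewrite /= expr0n addr0 sqrtr_sqr normrN gtr0_norm. Qed.

(** The negative half-line lies in every sector, so that the sectorial bound holds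
    for [(t + L)^-1], [t > 0]; the value at [t = 0] has a bound of its own. *)
Lemma sectorial_resolvent L : sectorial L -> resolvent_set L 0 ->
  exists (J : R -> {linear X -> X}) (M : R), resolvent_family J M /\
    (forall t x, 0 <= t -> J t x = inv_shift L t x).
Proof.
move=> [phi [C [phi01 C1 subphi bphi]]] [T0 [M0 [T0r T0b]]].
have T0r' : is_resolvent L (Complex (- 0) 0) T0 by rewrite oppr0.
pose M := C + `|M0|.
have Mge0 : 0 <= M by rewrite addr_ge0// (le_trans ler01).
have inv t : 0 <= t -> forall x,
    [/\ opdom L (inv_shift L t x),
      t *: inv_shift L t x + L (inv_shift L t x) = x,
      forall u, opdom L u -> t *: u + L u = x -> u = inv_shift L t x &
      `|inv_shift L t x| <= M / (1 + t) * `|x|].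
  rewrite le_eqVlt => /predU1P[<- x|t0 x].
    have [? ? ? b] := real_resolvent T0r' x; split=> //.
    apply: (le_trans b); apply: (le_trans (T0b _)).
    rewrite cnorm_real normrN addr0 divr1 ler_wpM2r//.
    by rewrite (le_trans (ler_norm _))// lerDr (le_trans ler01).
  have st := sector_neg phi01 t0.
  have [T [_ [Tr _]]] := subphi _ st.
  have [? ? ? b] := real_resolvent Tr x; split=> //.
  apply: (le_trans b); apply: (le_trans (bphi _ st _ Tr _)).
  rewrite cnorm_real normrN normc_neg// ler_wpM2r// ler_wpM2r ?lerDl//.
  by rewrite invr_ge0 addr_ge0// ltW.
have lin t : 0 <= t -> linear (inv_shift L t).
  move=> t0 a x y; have [Dx ex _ _] := inv t t0 x; have [Dy ey _ _] := inv t t0 y.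
  have [_ _ u _] := inv t t0 (a *: x + y); apply/esym/u; first exact: opdomP.
  rewrite opfunP// -[in RHS]ex -[in RHS]ey !scalerDr !scalerA (mulrC t a).
  by rewrite addrACA.
pose zero : {linear X -> X} := \0.
pose J t : {linear X -> X} := if pselect (0 <= t) is left t0 then
  HB.pack (inv_shift L t) (GRing.isLinear.Build _ _ _ _ (inv_shift L t) (lin t t0))
  else zero.
have JE t x : 0 <= t -> J t x = inv_shift L t x.
  by move=> t0; rewrite /J; case: pselect.
exists J, M; split=> //; split=> //.
- move=> s t x s0 t0; rewrite !JE//.
  have [D1 e1 _ _] := inv s s0 x; have [D2 e2 _ _] := inv t t0 x.
  (* both sides are sent to [(t - s) *: inv_shift L t x] by [s + L] *)
  have [_ _ u _] := inv s s0 ((t - s) *: inv_shift L t x).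
  have -> : (t - s) *: inv_shift L s (inv_shift L t x) =
            inv_shift L s ((t - s) *: inv_shift L t x).
    by rewrite -!JE// linearZ.
  have e : inv_shift L s x - inv_shift L t x =
           -1 *: inv_shift L t x + inv_shift L s x.
    by rewrite scaleN1r addrC.
  rewrite e; apply: u; first exact: opdomP.
  rewrite opfunP// scalerDr addrACA e1; move: e2; set v := inv_shift L t x => <-.
  by rewrite !scaleN1r scalerN addrACA addNr addr0 scalerBl addrC.
- by move=> t x t0; rewrite JE//; have [] := inv t t0 x.
- move=> x; rewrite JE// => x0; have [_ + _ _] := inv 0 (lexx 0) x.
  by rewrite x0 opfun0 scaler0 addr0.
Qed.

End Sectorial.

(** * The scale of the negative powers *)

(** The properties of the negative powers [P a = L^-a], [0 <= a <= 1], on which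
    the interpolation argument rests. In terms of the spaces [X_a = D(L^a)], they
    are the embedding of [X_b] into [X_a], the moment inequality between [X_a],
    [X_c] and [X_b] in its additive form, and the approximation of an element of
    [X_c] by elements [A lam] of [X_b], for which [A lam = lam (lam + L)^-1] will
    be taken. *)
Record fractional_scale (R : realType) (X : normedModType R)
    (P : R -> X -> X) : Prop := FractionalScale {
  scale0 : forall x, P 0 x = x ;
  scale_linear : forall a, 0 <= a <= 1 -> linear (P a) ;
  scale_inj : forall a x, 0 <= a <= 1 -> P a x = 0 -> x = 0 ;
  scale_embed : forall a b, 0 <= a -> a < b -> b <= 1 ->
    exists2 K, 0 <= K & forall v, exists2 u, P a u = P b v & `|u| <= K * `|v| ;
  scale_interpolate : forall a c b, 0 <= a -> a < c -> c < b -> b <= 1 ->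
    exists2 K, 0 <= K & forall u v, P a u = P b v ->
      exists2 w, P c w = P a u & forall lam, 0 < lam ->
        `|w| <= K * (lam `^ (c - a) * `|u| + lam `^ (c - b) * `|v|) ;
  scale_approx : exists A : R -> X -> X, forall a c b,
    0 <= a -> a < c -> c < b -> b <= 1 ->
    exists2 K, 0 <= K & forall z lam, 0 < lam ->
      (exists2 u, P a u = P c z - A lam (P c z) & `|u| <= K * lam `^ (a - c) * `|z|) /\
      (exists2 v, P b v = A lam (P c z) & `|v| <= K * lam `^ (b - c) * `|z|) }.

Section FractionalScale.
Context {R : realType} {X : completeNormedModType R}.
Hypothesis sepX : separable X.
Implicit Types (s t a b c : R) (x y z : X).

Variables (L : operator X) (J : R -> {linear X -> X}) (M : R).
Hypothesis HJ : resolvent_family J M.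
Hypothesis JL : forall t x, 0 <= t -> J t x = inv_shift L t x.

Let M0 := resolvent_bound_ge0 HJ.
Let mD := @measurable_D R.
Let P := neg_power L.
Let E := Yosida J.

Definition power_cst a : R := sin (pi * a) / pi.

Lemma power_cst_gt0 a : 0 < a < 1 -> 0 < power_cst a.
Proof.
move=> /andP[a0 a1]; rewrite divr_gt0 ?pi_gt0// sin_gt0_pi// mulr_gt0 ?pi_gt0//=.
by rewrite gtr_pMr ?pi_gt0.
Qed.

Lemma powers_cases a : 0 <= a <= 1 -> [\/ a = 0, 0 < a < 1 | a = 1].
Proof.
move=> /andP[]; rewrite le_eqVlt => /predU1P[<- _|a0]; first exact: Or31.
by rewrite le_eqVlt => /predU1P[->|a1]; [exact: Or33|apply: Or32; rewrite a0].
Qed.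

Lemma neg_power0 x : P 0 x = x.
Proof.
by rewrite /P /neg_power (_ : Num.truncn 0 = 0%N) ?truncn0//= /neg_power_lt1 subrr eqxx.
Qed.

Lemma neg_power1 x : P 1 x = J 0 x.
Proof.
rewrite /P /neg_power (_ : Num.truncn 1 = 1%N) ?truncn1//= /neg_power_lt1 subrr eqxx.
by rewrite JL.
Qed.

(** The definition of [L^-a] chooses a value of the weak integral, which exists and
    is unique. *)
Lemma neg_powerP a x y : 0 < a < 1 ->
  P a x = y <-> frac_integral J (power_cst a) a x y.
Proof.
move=> a01; have /andP[a0 a1] := a01.
have cE z : frac_integral J (power_cst a) a x z <-> is_integral `]0, +oo[
    (fun t => (sin (pi * a) / pi * t `^ (- a)) *: inv_shift L t x) z.
  by split; apply: (eq_is_integral mD) => t /set_mem /inDP t0; rewrite JL// ltW.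
have [w hw _] := frac_integral_exists sepX HJ x (ltW (power_cst_gt0 a01)) a01.
have : frac_integral J (power_cst a) a x (P a x).
  have tr : Num.truncn a = 0%N by apply/eqP; rewrite truncn_eq ?(ltW a0)//= a1 ltW.
  rewrite /P /neg_power tr /= subr0 /neg_power_lt1 gt_eqF//.
  by apply/cE; apply: xgetPex; exists w; exact/cE.
move=> h; split=> [<-//|h'].
exact: (is_integral_unique mD h h').
Qed.

Lemma neg_power_linear a : 0 <= a <= 1 -> linear (P a).
Proof.
move=> /powers_cases[->|a01|->] k x y; rewrite ?neg_power0 ?neg_power1 ?linearP//.
apply/neg_powerP => //; apply: (frac_integral_linear _ _ _ ) => //; exact/neg_powerP.
Qed.

Lemma neg_power_inj a x : 0 <= a <= 1 -> P a x = 0 -> x = 0.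
Proof.
move=> /powers_cases[->|a01|->]; rewrite ?neg_power0 ?neg_power1//.
  by move/neg_powerP => /(_ a01); apply: (frac_integral_inj HJ (power_cst_gt0 a01) a01).
exact: resolvent_inj HJ _.
Qed.

Lemma neg_power_bounded a : 0 <= a <= 1 ->
  exists2 K, 0 <= K & forall z, `|P a z| <= K * `|z|.
Proof.
move=> /powers_cases[->|a01|->].
- by exists 1 => // z; rewrite neg_power0 mul1r.
- have nu0 := ltW (power_cst_gt0 a01); have /andP[a0 a1] := a01.
  exists (power_cst a * M * ((1 - a)^-1 + a^-1)).
    apply: mulr_ge0; first exact: mulr_ge0.
    by rewrite addr_ge0 ?invr_ge0 ?subr_ge0 ?(ltW a0) ?(ltW a1).
  move=> z; have [y yz yle] := frac_integral_exists sepX HJ z nu0 a01.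
  have /neg_powerP -> // := yz.
  by have := yle 1 ltr01; rewrite powR1; lra.
- by exists M => // z; rewrite neg_power1; exact: (J_le1 HJ).
Qed.

(** The smoothness of an element is measured by the decay of [L (t + L)^-1] on it;
    the converse is [neg_power_range]. *)
Lemma Yosida_neg_power a : 0 <= a <= 1 -> exists2 C, 0 <= C &
  forall z t, 0 < t -> `|E t (P a z)| <= C * `|z| * t `^ (- a).
Proof.
move=> /powers_cases[->|a01|->].
- exists (1 + M); first by rewrite addr_ge0.
  move=> z t t0; rewrite neg_power0 oppr0 powRr0 mulr1; exact: (Yosida_le HJ _ (ltW t0)).
- have nu0 := power_cst_gt0 a01; have /andP[a0 a1] := a01.
  exists (power_cst a * M * (1 + M) * ((1 - a)^-1 + a^-1)).
    apply: mulr_ge0.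
      by apply: mulr_ge0; [exact: mulr_ge0 (ltW nu0) M0|rewrite addr_ge0].
    by rewrite addr_ge0 ?invr_ge0 ?subr_ge0 ?(ltW a0) ?(ltW a1).
  move=> z t t0; have /(neg_powerP _ _ a01) h : P a z = P a z by [].
  by rewrite [leRHS]mulrAC; exact: (Yosida_frac_integral sepX HJ (ltW nu0) a01 t0 h).
- exists M => // z t t0; rewrite neg_power1 /E (YosidaJ HJ) ?(ltW t0)//.
  rewrite (J0_Yosida HJ) ?(ltW t0)// powR_inv1 ?(ltW t0)// mulrAC.
  exact: (J_le_inv HJ).
Qed.

Lemma neg_power_range a c b : 0 < c < 1 -> a < c -> c < b ->
  exists2 K, 0 <= K & forall y m1 m2,
    (forall t, 0 < t -> `|E t y| <= m1 * t `^ (- a)) ->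
    (forall t, 0 < t -> `|E t y| <= m2 * t `^ (- b)) ->
    exists2 w, P c w = y &
      forall lam, 0 < lam -> `|w| <= K * (m1 * lam `^ (c - a) + m2 * lam `^ (c - b)).
Proof.
move=> c01 ac cb.
have [K K0 hK] := frac_integral_range sepX HJ (power_cst_gt0 c01) c01 ac cb.
exists K => // y m1 m2 h1 h2; have [w wy wle] := hK y m1 m2 h1 h2.
by exists w => //; exact/neg_powerP.
Qed.

(** The element [L^-b v] has the decay rates [0] and [b], which enclose [a]. *)
Lemma neg_power_embed a b : 0 <= a -> a < b -> b <= 1 ->
  exists2 K, 0 <= K & forall v, exists2 u, P a u = P b v & `|u| <= K * `|v|.
Proof.
move=> a0 ab b1; have b0 := le_lt_trans a0 ab.
have b01 : 0 <= b <= 1 by rewrite (ltW b0).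
have [Kb Kb0 hKb] := neg_power_bounded b01.
move: a0; rewrite le_eqVlt => /predU1P[<-|a0].
  by exists Kb => // v; exists (P b v); rewrite ?neg_power0.
have a01 : 0 < a < 1 by rewrite a0 (lt_le_trans ab).
have [C C0 hC] := Yosida_neg_power b01.
have [K K0 hK] := neg_power_range a01 a0 ab.
exists (K * ((1 + M) * Kb + C)).
  by rewrite mulr_ge0// addr_ge0// mulr_ge0// addr_ge0.
move=> v; have [||w wE wle] := hK (P b v) ((1 + M) * Kb * `|v|) (C * `|v|).
- move=> t t0; rewrite oppr0 powRr0 mulr1.
  apply: (le_trans (Yosida_le HJ _ (ltW t0))).
  by rewrite -mulrA ler_wpM2l ?addr_ge0.
- by move=> t t0; exact: hC.
exists w => //; have := wle 1 ltr01; rewrite !powR1 !mulr1.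
by rewrite -mulrDl mulrA.
Qed.

(** The common element has the decay rates [a] and [b]; the free parameter of
    [neg_power_range] becomes that of the moment inequality. *)
Lemma neg_power_interpolate a c b : 0 <= a -> a < c -> c < b -> b <= 1 ->
  exists2 K, 0 <= K & forall u v, P a u = P b v ->
    exists2 w, P c w = P a u & forall lam, 0 < lam ->
      `|w| <= K * (lam `^ (c - a) * `|u| + lam `^ (c - b) * `|v|).
Proof.
move=> a0 ac cb b1.
have [Ca Ca0 hCa] : exists2 C, 0 <= C &
    forall z t, 0 < t -> `|E t (P a z)| <= C * `|z| * t `^ (- a).
  by apply: Yosida_neg_power; lra.
have [Cb Cb0 hCb] : exists2 C, 0 <= C &
    forall z t, 0 < t -> `|E t (P b z)| <= C * `|z| * t `^ (- b).
  by apply: Yosida_neg_power; lra.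
have c01 : 0 < c < 1 by lra.
have [K K0 hK] := neg_power_range c01 ac cb.
exists (K * (Ca + Cb)); first by rewrite mulr_ge0// addr_ge0.
move=> u v uv.
have [t t0|t t0|w wE wle] := hK (P a u) (Ca * `|u|) (Cb * `|v|).
- exact: hCa.
- by rewrite uv; exact: hCb.
exists w => // lam l0; apply: (le_trans (wle lam l0)); rewrite -mulrA ler_wpM2l//.
have h1 : 0 <= `|u| * lam `^ (c - a) by rewrite mulr_ge0// powR_ge0.
have h2 : 0 <= `|v| * lam `^ (c - b) by rewrite mulr_ge0// powR_ge0.
have h3 := mulr_ge0 Ca0 h2; have h4 := mulr_ge0 Cb0 h1.
rewrite -subr_ge0 (_ : _ - _ = Ca * (`|v| * lam `^ (c - b)) + Cb * (`|u| * lam `^ (c - a))).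
  by rewrite addr_ge0.
by ring.
Qed.

(** Both the error [L (lam + L)^-1 L^-c z] and the approximation
    [lam (lam + L)^-1 L^-c z] have two decay rates in [t]: one with constants
    independent of [lam], and one that gains or loses a power of [lam]. *)
Lemma neg_power_approx a c b : 0 <= a -> a < c -> c < b -> b <= 1 ->
  exists2 K, 0 <= K & forall z lam, 0 < lam ->
    (exists2 u, P a u = P c z - lam *: J lam (P c z) &
      `|u| <= K * lam `^ (a - c) * `|z|) /\
    (exists2 v, P b v = lam *: J lam (P c z) &
      `|v| <= K * lam `^ (b - c) * `|z|).
Proof.
move=> a0 ac cb b1.
have addp (lam p q : R) : 0 < lam -> lam `^ (p + q) = lam `^ p * lam `^ q.
  by move=> l0; exact: powRD_gt0.
have [C C0 hC] : exists2 C, 0 <= C &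
    forall z t, 0 < t -> `|E t (P c z)| <= C * `|z| * t `^ (- c).
  by apply: Yosida_neg_power; lra.
have [K1 K10 h1] : exists2 K, 0 <= K & forall z lam, 0 < lam ->
    exists2 u, P a u = E lam (P c z) & `|u| <= K * lam `^ (a - c) * `|z|.
  move: a0; rewrite le_eqVlt => /predU1P[<-|a0].
    exists C => // z lam l0; exists (E lam (P c z)); first by rewrite neg_power0.
    by rewrite sub0r mulrAC hC.
  have a01 : 0 < a < 1 by lra.
  have [K K0 hK] := neg_power_range a01 a0 ac.
  exists (K * (2 * ((1 + M) * C))); first by rewrite !mulr_ge0// addr_ge0.
  move=> z lam l0.
  have [t t0|t t0|w wE wle] := hK (E lam (P c z))
      ((1 + M) * (C * `|z| * lam `^ (- c))) ((1 + M) * (C * `|z|)).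
  - rewrite oppr0 powRr0 mulr1; apply: (le_trans (Yosida_le HJ _ (ltW t0))).
    by rewrite ler_wpM2l ?addr_ge0//; exact: hC.
  - have -> : E t (E lam (P c z)) = E lam (E t (P c z)).
      exact: (YosidaC HJ _ (ltW t0) (ltW l0)).
    apply: (le_trans (Yosida_le HJ _ (ltW l0))).
    by rewrite -mulrA ler_wpM2l ?addr_ge0//; exact: hC.
  exists w => //; apply: (le_trans (wle lam l0)).
  apply: le_of_eq.
  by rewrite subr0 addrC (addp _ _ _ l0); ring.
have [K2 K20 h2] : exists2 K, 0 <= K & forall z lam, 0 < lam ->
    exists2 v, P b v = lam *: J lam (P c z) & `|v| <= K * lam `^ (b - c) * `|z|.
  move: b1; rewrite le_eqVlt => /predU1P[->|b1].
    exists C => // z lam l0; exists (lam *: E lam (P c z)).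
      by rewrite neg_power1 linearZ /= (J0_Yosida HJ)// ltW.
    rewrite normrZ gtr0_norm// (addp _ _ _ l0) powRr1 ?(ltW l0)//.
    rewrite [leRHS](_ : _ = lam * (C * `|z| * lam `^ (- c))); last by ring.
    by rewrite ler_wpM2l ?(ltW l0)//; exact: hC.
  have b01 : 0 < b < 1 by lra.
  have [K K0 hK] := neg_power_range b01 cb b1.
  exists (K * (2 * (M * C))); first by rewrite !mulr_ge0.
  move=> z lam l0.
  have [t t0|t t0|w wE wle] := hK (lam *: J lam (P c z))
      (M * (C * `|z|)) (M * (C * `|z| * lam `^ (1 - c))).
  - have -> : E t (lam *: J lam (P c z)) = lam *: J lam (E t (P c z)).
      rewrite -[E t _]/(Yosida J t _) linearZ /=; congr (_ *: _).
      exact: (YosidaJ HJ _ (ltW t0) (ltW l0)).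
    rewrite normrZ gtr0_norm// -mulrA.
    apply: (@le_trans _ _ (M * `|E t (P c z)|)); last by rewrite ler_wpM2l//; exact: hC.
    apply: (le_trans (ler_wpM2l (ltW l0) (J_le_inv HJ _ l0))).
    by rewrite !mulrA [lam * M]mulrC mulfK// gt_eqF.
  - have -> : E t (lam *: J lam (P c z)) = lam *: J t (E lam (P c z)).
      rewrite -[E t _]/(Yosida J t _) linearZ /=; congr (_ *: _).
      rewrite (YosidaJ HJ _ (ltW t0) (ltW l0)).
      exact: (J_Yosida HJ _ (ltW l0) (ltW t0)).
    rewrite normrZ gtr0_norm// powR_inv1 ?(ltW t0)// (addp _ _ _ l0) powRr1 ?(ltW l0)//.
    apply: (le_trans (ler_wpM2l (ltW l0) (J_le_inv HJ _ t0))).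
    rewrite [leRHS](_ : _ = lam * (M / t * (C * `|z| * lam `^ (- c)))); last by ring.
    rewrite ler_wpM2l ?(ltW l0)// ler_wpM2l ?divr_ge0 ?(ltW t0)//; exact: hC.
  exists w => //; apply: (le_trans (wle lam l0)).
  apply: le_of_eq.
  have -> : lam `^ (b - c) = lam `^ (1 - c) * lam `^ (b - 1).
    by rewrite -(addp _ _ _ l0); congr (_ `^ _); ring.
  by ring.
exists (K1 + K2); first by rewrite addr_ge0.
move=> z lam l0; have [u uE ule] := h1 z lam l0; have [v vE vle] := h2 z lam l0.
split; [exists u => //; apply: (le_trans ule)|exists v => //; apply: (le_trans vle)].
  by rewrite !ler_wpM2r ?powR_ge0// lerDl.
by rewrite !ler_wpM2r ?powR_ge0// lerDr.
Qed.

Theorem neg_power_scale : fractional_scale (neg_power L).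
Proof.
split.
- exact: neg_power0.
- exact: neg_power_linear.
- exact: neg_power_inj.
- exact: neg_power_embed.
- exact: neg_power_interpolate.
- exists (fun lam x => lam *: J lam x); exact: neg_power_approx.
Qed.

End FractionalScale.

(** * Gaussian sequences *)

Section NormalLaw.
Context {R : realType}.
Notation mu := (@lebesgue_measure R).
Local Notation RT := (measurableTypeR R).
Local Notation nu := (normal_prob (0 : R) 1).

Lemma normal_pdf01E (x : R) : normal_pdf 0 1 x = normal_peak 1 * expR (- (x ^+ 2) / 2).
Proof.
by rewrite normal_pdfE ?oner_neq0// /normal_fun subr0 expr1n mulr2n.
Qed.

Lemma normal_prob_opp (B : set RT) : measurable B -> nu (-%R @^-1` B) = nu B.
Proof.
move=> mB; pose op : RT -> RT := -%R.
have mo : measurable_fun setT op by exact: oppr_measurable.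
pose f (x : RT) := (normal_pdf 0 1 x)%:E.
have mf A : measurable_fun A f.
  by apply/measurable_EFinP; apply: measurable_funTS; exact: measurable_normal_pdf.
rewrite /normal_prob -/f.
transitivity (\int[mu]_(x in op @^-1` B) (f \o op) x)%E.
  by apply: eq_integral => x _; rewrite /f /= !normal_pdf01E sqrrN.
have [m mE] : exists m : {measure set RT -> \bar R}, m = pushforward mu op :> (set _ -> _).
  by unshelve (eexists; reflexivity).
transitivity (\int[m]_(x in B) f x)%E.
  apply/esym; rewrite (eq_measure_integral (pushforward mu op)); last by move=> A _ _; rewrite mE.
  by rewrite ge0_integral_pushforward// => x _; rewrite lee_fin normal_pdf_ge0.
apply: eq_measure_integral => A mA _.
exact: (etrans (congr1 (@^~ A) mE) (lebesgue_measureN mA)).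
Qed.

(** The square is at most [2 x ^ 2 + 2] on [n <= |x| < n + 1], and multiplying
    the Gaussian density by this quadratic factor only costs a constant and a
    wider Gaussian. *)
Lemma normal_prob_sqr : (\int[nu]_x (x ^+ 2)%:E < +oo)%E.
Proof.
pose F n : set RT := [set x | Num.truncn `|x| = n].
have FE n : F n = [set x | n%:R <= `|x| < n.+1%:R].
  apply/seteqP; split=> x; rewrite /F /=.
    by move=> <-; apply: truncn_itv.
  by move=> h; apply/eqP; rewrite truncn_eq.
have mF n : measurable (F n).
  rewrite FE [X in measurable X](_ : _ =
      setT `&` (fun x : RT => `|x|) @^-1` `[n%:R, n.+1%:R[%classic).
    by apply: normr_measurable.
  by rewrite setTI; apply/seteqP; split=> x; rewrite /= in_itv.
have tF : trivIset setT F by move=> i j _ _ [x [<- <-]].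
have UF : \bigcup_n F n = setT.
  by apply/seteqP; split=> // x _; exists (Num.truncn `|x|).
have p1 := normal_peak_ge0 (1 : R).
pose K : R := normal_peak 1 / normal_peak 2 * 6.
have p2 : 0 < normal_peak (2 : R) by apply: normal_peak_gt0.
have K0 : 0 <= K by rewrite mulr_ge0// divr_ge0// ltW.
have dens (x : R) n : F n x -> n.+1%:R ^+ 2 * normal_pdf 0 1 x <= K * normal_pdf 0 2 x.
  rewrite FE /= => /andP[nx _]; rewrite normal_pdf01E normal_pdfE// /normal_fun subr0.
  have h1 : n.+1%:R ^+ 2 <= 2 * x ^+ 2 + 2 :> R.
    have : n%:R ^+ 2 <= x ^+ 2.
      by rewrite -(real_normK (num_real x)) ler_sqr ?nnegrE.
    rewrite -natr1; have := sqr_ge0 (n%:R - 1 : R); nra.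
  have h2 : 2 * x ^+ 2 + 2 <= 6 * expR (3 * x ^+ 2 / 8) :> R.
    have := expR_ge1Dx (3 * x ^+ 2 / 8); have := sqr_ge0 x; lra.
  have -> : K * (normal_peak 2 * expR (- x ^+ 2 / (2 ^+ 2 *+ 2))) =
      normal_peak 1 * (6 * expR (- x ^+ 2 / (2 ^+ 2 *+ 2))).
    by rewrite /K; field; rewrite gt_eqF.
  rewrite mulrCA ler_wpM2l//.
  have -> : expR (- x ^+ 2 / (2 ^+ 2 *+ 2)) = expR (3 * x ^+ 2 / 8) * expR (- x ^+ 2 / 2) :> R.
    by rewrite -expRD; congr expR; field.
  by rewrite mulrA ler_wpM2r ?expR_ge0// (le_trans h1 h2).
have msq A : measurable_fun A (fun x : RT => (x ^+ 2)%:E).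
  by apply/measurable_EFinP; apply: measurable_funTS; exact: exprn_measurable.
have mpdf (A : set RT) s : measurable_fun A (fun x : RT => (K * normal_pdf 0 s x)%:E).
  apply/measurable_EFinP; apply: measurable_funM; first exact: measurable_cst.
  by apply: measurable_funTS; exact: measurable_normal_pdf.
apply: (@le_lt_trans _ _ (\int[mu]_x (K * normal_pdf 0 2 x)%:E)%E); last first.
  under eq_integral do rewrite EFinM.
  rewrite ge0_integralZl_EFin//.
  - by rewrite integral_normal_pdf mule1 ltry.
  - by move=> x _; rewrite lee_fin normal_pdf_ge0.
  - by apply/measurable_EFinP; exact: measurable_normal_pdf.
rewrite -UF ge0_integral_bigcup//; last first.
  by move=> x _; rewrite lee_fin sqr_ge0.
rewrite ge0_integral_bigcup//; last first.
  by move=> x _; rewrite lee_fin mulr_ge0// normal_pdf_ge0.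
apply: lee_nneseries => [n _ _|n _].
  by apply: integral_ge0 => x _; rewrite lee_fin sqr_ge0.
apply: (@le_trans _ _ (\int[nu]_(x in F n) (n.+1%:R ^+ 2)%:E)%E).
  apply: ge0_le_integral => //.
  - by move=> x _; rewrite lee_fin sqr_ge0.
  - move=> x; rewrite FE /= => /andP[_ /ltW xn]; rewrite lee_fin.
    by rewrite -(real_normK (num_real x)) ler_sqr ?nnegrE.
rewrite integral_cst//= {1}/normal_prob -ge0_integralZl_EFin//; last 2 first.
- by move=> x _; rewrite lee_fin normal_pdf_ge0.
- by apply/measurable_EFinP; apply: measurable_funTS; exact: measurable_normal_pdf.
apply: ge0_le_integral => //.
- by move=> x _; rewrite -EFinM lee_fin mulr_ge0 ?sqr_ge0// normal_pdf_ge0.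
- apply: measurable_funeM; apply/measurable_EFinP.
  by apply: measurable_funTS; exact: measurable_normal_pdf.
- by move=> x Fx; rewrite -EFinM lee_fin; exact: dens.
Qed.

(** Otherwise the normal law would be carried by [0], which is a null set for it. *)
Lemma normal_prob_sqr_gt0 : (0 < \int[nu]_x (x ^+ 2)%:E)%E.
Proof.
rewrite lt0e; apply/andP; split; last first.
  by apply: integral_ge0 => x _; rewrite lee_fin sqr_ge0.
apply/eqP => h.
have msq : measurable_fun setT (fun x : RT => (x ^+ 2)%:E).
  by apply/measurable_EFinP; exact: exprn_measurable.
have h' : (\int[nu]_x `|(x ^+ 2)%:E| = 0)%E.
  by rewrite -[RHS]h; apply: eq_integral => x _; rewrite gee0_abs// lee_fin sqr_ge0.
have [N [mN N0 hN]] := (ae_eq_integral_abs nu measurableT msq).1 h'.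
pose Z : set RT := [set 0].
have mZ : measurable Z by exact: measurable_set1.
have nu0 : nu Z = 0%E.
  have := (null_content_dominatesP nu mu).1 (normal_prob_dominates 0 1).
  by move=> /(_ Z mZ); apply; exact: lebesgue_measure_set1.
have : (nu setT <= nu (N `|` Z))%E.
  apply: le_measure; rewrite ?inE//; first exact: measurableU.
  move=> x _ /=; have [->|x0] := eqVneq x 0; [by right|left; apply: hN => /= h0].
  by have := h0 I => -[] /eqP; rewrite sqrf_eq0 (negbTE x0).
move=> le1; have le2 : (nu setT <= nu N + nu Z)%E.
  exact: (le_trans le1 (measureU2 _ mN mZ)).
have nu1 : nu setT = 1%E by exact: probability_setT.
by move: le2; rewrite nu1 N0 nu0 adde0 lee_fin ler10.
Qed.

End NormalLaw.

(** Independent standard normal variables, with independence in the form of the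
    product rule, such as the values at time 1 of independent Brownian motions. *)
Record gaussian_sequence (R : realType) d (Omega : measurableType d)
    (P : probability Omega R) (xi : nat -> Omega -> R) : Prop := GaussianSequence {
  gauss_measurable : forall k, measurable_fun setT (xi k : Omega -> measurableTypeR R) ;
  gauss_law : forall k (B : set (measurableTypeR R)), measurable B ->
    P (xi k @^-1` B) = normal_prob 0 1 B ;
  gauss_indep : forall (I : seq nat) (B : nat -> set (measurableTypeR R)), uniq I ->
    (forall k, measurable (B k)) ->
    P (\big[setI/setT]_(k <- I) (xi k @^-1` B k)) =
      (\prod_(k <- I) P (xi k @^-1` B k))%E }.

Section Brownian.
Context {R : realType} {d : measure_display} {Omega : measurableType d}.
Variable P : probability Omega R.

Lemma brownian_gaussian (W : nat -> R -> Omega -> R) :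
  independent_brownian_motions P W -> gaussian_sequence P (fun k => W k 1).
Proof.
move=> [bm ind]; split.
- by move=> k; have [mW _ _ _] := bm k; exact: (mW 1 ler01).
- move=> k B mB; have [mW [W0 _] law _] := bm k.
  have := law 0 1; rewrite lexx ltr01 => /(_ isT B mB).
  rewrite subr0 sqrtr1 => <-.
  have m1 := mW 1 ler01; have m0 := mW 0 (lexx 0).
  have mA : measurable (W k 1 @^-1` B) by rewrite -[X in measurable X]setTI; exact: m1.
  have mD : measurable_fun setT (fun w => W k 1 w - W k 0 w) by exact: measurable_funB.
  have mA' : measurable ((fun w => W k 1 w - W k 0 w) @^-1` B).
    by rewrite -[X in measurable X]setTI; exact: mD.
  have [N [mN N0 hN]] := W0.
  have W0E w : ~ N w -> W k 0 w = 0.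
    by move=> Nw; apply: contrapT => h; apply: Nw; apply: hN.
  have addN A : measurable A -> (P (A `|` N) <= P A)%E.
    move=> mA1; have : (P (A `|` N) <= P A + P N)%E by exact: measureU2.
    by rewrite [X in (_ + X)%E](N0 : P N = 0%E) adde0.
  apply/eqP; rewrite eq_le; apply/andP; split.
    apply: (@le_trans _ _ (P (((fun w => W k 1 w - W k 0 w) @^-1` B) `|` N))).
      apply: le_measure; rewrite ?inE//; first exact: measurableU.
      move=> w /= Bw; have [Nw|Nw] := pselect (N w); [by right|left].
      by rewrite W0E// subr0.
    exact: addN.
  apply: (@le_trans _ _ (P ((W k 1 @^-1` B) `|` N))).
    apply: le_measure; rewrite ?inE//; first exact: measurableU.
    move=> w /= Bw; have [Nw|Nw] := pselect (N w); [by right|left].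
    by move: Bw; rewrite W0E// subr0.
  exact: addN.
- move=> I B uI mB; apply: ind => // k _.
  apply: sub_sigma_algebra; exists 1; first by rewrite /= in_itv /= ler01.
  by exists (B k) => //; exact: mB.
Qed.

End Brownian.

Section IndependentIntegral.
Context {R : realType} {d : measure_display} {Omega : measurableType d}.
Variable P : probability Omega R.
Local Notation RT := (measurableTypeR R).
Local Notation nu := (normal_prob (0 : R) 1).

Variables (x : Omega -> RT) (E : set Omega).
Hypothesis mx : measurable_fun setT x.
Hypothesis mE : measurable E.
Hypothesis Ex : forall B : set RT, measurable B -> P (E `&` x @^-1` B) = (P E * nu B)%E.

Lemma ge0_integral_indep (f : RT -> \bar R) : measurable_fun setT f ->
  (forall t, (0 <= f t)%E) ->
  (\int[P]_(w in E) f (x w) = P E * \int[nu]_t f t)%E.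
Proof.
move=> mf f0; pose Q : {measure set Omega -> \bar R} := mrestr P mE.
have mfx : measurable_fun setT (f \o x) by exact: measurableT_comp.
have -> : (\int[P]_(w in E) f (x w) = \int[Q]_w f (x w))%E.
  rewrite -(setvU E) setUC ge0_integral_setU//.
  - rewrite [X in (_ + X)%E](_ : _ = 0%E) ?adde0.
      apply: eq_measure_integral => A mA AE.
      by rewrite /Q /= /mrestr setIidl.
    apply: null_set_integral => //.
    + exact: measurableC.
    + by apply: measurable_funTS.
    + by rewrite /Q /= /mrestr setICl measure0.
  - exact: measurableC.
  - by rewrite setUv.
  - by rewrite disj_set2E setICr.
have [m mE'] : exists m : {measure set RT -> \bar R}, m = pushforward Q x :> (set _ -> _).
  by unshelve (eexists; reflexivity).
transitivity (\int[m]_t f t)%E.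
  apply/esym; rewrite (eq_measure_integral (pushforward Q x)); last first.
    by move=> A _ _; rewrite mE'.
  by rewrite ge0_integral_pushforward.
have pe : 0 <= fine (P E) by rewrite fine_ge0.
have PE : ((fine (P E))%:E = P E)%E by rewrite fineK// fin_num_measure.
rewrite (eq_measure_integral (mscale (NngNum pe) nu)).
  by rewrite ge0_integral_mscale//= PE.
move=> A mA _; apply: (etrans (congr1 (@^~ A) mE')).
transitivity (P (E `&` x @^-1` A)); first by rewrite setIC.
by rewrite (Ex mA); congr (_ * _)%E; exact: esym PE.
Qed.

Hypothesis Ix : P.-integrable setT (EFin \o x).

Let pos (t : RT) : \bar R := Order.max t%:E 0%E.
Let neg (t : RT) : \bar R := Order.max (- t)%:E 0%E.

Let mpos : measurable_fun setT pos.
Proof. by apply: measurable_maxe => //; exact: EFin_measurable. Qed.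

Let mneg : measurable_fun setT neg.
Proof.
apply: measurable_maxe => //; apply/measurable_EFinP; exact: oppr_measurable.
Qed.

Let pos_ge0 t : (0 <= pos t)%E. Proof. by rewrite /pos le_max lexx orbT. Qed.
Let neg_ge0 t : (0 <= neg t)%E. Proof. by rewrite /neg le_max lexx orbT. Qed.

Let normal_posneg : (\int[nu]_t pos t = \int[nu]_t neg t)%E.
Proof.
pose op : RT -> RT := -%R.
have mo : measurable_fun setT op by exact: oppr_measurable.
have [m mE'] : exists m : {measure set RT -> \bar R}, m = pushforward nu op :> (set _ -> _).
  by unshelve (eexists; reflexivity).
transitivity (\int[m]_t pos t)%E.
  apply: eq_measure_integral => A mA _.
  exact: (etrans (esym (normal_prob_opp mA)) (congr1 (@^~ A) (esym mE'))).
rewrite (eq_measure_integral (pushforward nu op)); last first.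
  by move=> A _ _; rewrite mE'.
by rewrite ge0_integral_pushforward.
Qed.

(** The integral over [E] is the product of [P E] and of the mean of the normal law,
    which is zero by symmetry. *)
Lemma integral_indep0 : (\int[P]_(w in E) (x w)%:E = 0)%E.
Proof.
have IE : P.-integrable E (EFin \o x) by exact: integrableS Ix.
have fn := integrable_neg_fin_num mE IE.
rewrite -[LHS]/(\int[P]_(w in E) (EFin \o x) w)%E integralE.
have eqn : (\int[P]_(w in E) (EFin \o x)^\- w = \int[P]_(w in E) neg (x w))%E.
  by apply: eq_integral => w _; rewrite funenegE.
have -> : (\int[P]_(w in E) (EFin \o x)^\+ w = \int[P]_(w in E) pos (x w))%E.
  by apply: eq_integral => w _; rewrite funeposE.
rewrite (ge0_integral_indep mpos)// normal_posneg -(ge0_integral_indep mneg)// -eqn.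
by rewrite subee.
Qed.

End IndependentIntegral.

(** * Partial sums of Gaussian series *)

Lemma separable_real (R : realType) : separable (R^o : normedModType R).
Proof.
exists (range (@ratr R)); last exact: dense_rat.
by apply: (sub_countable (card_image_le _ _)); exact: countableP.
Qed.

Definition gauss_var (R : realType) : R :=
  fine (\int[normal_prob (0 : R) 1]_x (x ^+ 2)%:E)%E.

Section Moments.
Context {R : realType} {d : measure_display} {Omega : measurableType d}.
Variable P : probability Omega R.
Local Notation RT := (measurableTypeR R).
Local Notation nu := (normal_prob (0 : R) 1).
Variable xi : nat -> Omega -> R.
Hypothesis G : gaussian_sequence P xi.

Let mxi k : measurable_fun setT (xi k : Omega -> RT) := gauss_measurable G k.

Lemma gauss_var_gt0 : 0 < gauss_var R.
Proof. by rewrite fine_gt0// normal_prob_sqr_gt0 normal_prob_sqr. Qed.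

Lemma gauss_sqr k : (\int[P]_w (xi k w ^+ 2)%:E = (gauss_var R)%:E)%E.
Proof.
have law (B : set RT) : measurable B ->
    P (setT `&` xi k @^-1` B) = (P setT * nu B)%E.
  by move=> mB; rewrite setTI probability_setT mul1e (gauss_law G).
rewrite (ge0_integral_indep (mxi k) measurableT law (f := fun t : RT => (t ^+ 2)%:E)).
- rewrite [X in (X * _)%E](probability_setT P) mul1e /gauss_var fineK//.
  by rewrite ge0_fin_numE ?normal_prob_sqr//; apply: integral_ge0 => x _; rewrite lee_fin sqr_ge0.
- by apply/measurable_EFinP; exact: exprn_measurable.
- by move=> t; rewrite lee_fin sqr_ge0.
Qed.

Lemma gauss_sqr_integrable k : P.-integrable setT (fun w => (xi k w ^+ 2)%:E).
Proof.
apply/integrableP; split.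
  by apply/measurable_EFinP; apply: measurable_funX; exact: mxi.
have -> : (\int[P]_w `|(xi k w ^+ 2)%:E| = (gauss_var R)%:E)%E; last by rewrite ltry.
by rewrite -(gauss_sqr k); apply: eq_integral => w _; rewrite gee0_abs// lee_fin sqr_ge0.
Qed.

Lemma gauss_integrable k : P.-integrable setT (EFin \o xi k).
Proof.
have I1 : P.-integrable setT (fun=> 1%:E : \bar R).
  exact: finite_measure_integrable_cst.
apply: (le_integrable measurableT _ _ (integrableD measurableT I1 (gauss_sqr_integrable k))).
  by apply/measurable_EFinP; exact: mxi.
move=> w _ /=; rewrite lee_fin [leRHS]ger0_norm ?addr_ge0 ?sqr_ge0//.
rewrite -(real_normK (num_real (xi k w))).
by have := sqr_ge0 (`|xi k w| - 1); have := normr_ge0 (xi k w); nra.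
Qed.

Lemma gauss_rectangle (I : seq nat) (B : nat -> set RT) k (C : set RT) :
  uniq I -> k \notin I -> (forall i, measurable (B i)) -> measurable C ->
  P ((\big[setI/setT]_(i <- I) (xi i @^-1` B i)) `&` xi k @^-1` C) =
  (P (\big[setI/setT]_(i <- I) (xi i @^-1` B i)) * nu C)%E.
Proof.
move=> uI kI mB mC; pose B' i := if i == k then C else B i.
have mB' i : measurable (B' i) by rewrite /B'; case: ifP.
have BE i : i \in I -> B' i = B i.
  by rewrite /B'; case: eqP => // -> iI; rewrite iI in kI.
have e : \big[setI/setT]_(i <- k :: I) (xi i @^-1` B' i) =
    (\big[setI/setT]_(i <- I) (xi i @^-1` B i)) `&` xi k @^-1` C.
  rewrite big_cons {1}/B' eqxx setIC; congr (_ `&` _).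
  by rewrite big_seq [RHS]big_seq; apply: eq_bigr => i iI; rewrite BE.
have u : uniq (k :: I) by rewrite /= kI.
rewrite -e (gauss_indep G u mB').
rewrite big_cons {1}/B' eqxx (gauss_law G)// muleC; congr (_ * _)%E.
rewrite (gauss_indep G uI mB) big_seq [RHS]big_seq.
by apply: eq_bigr => i iI; rewrite BE.
Qed.

Variables (ys : nat -> R^o) (m : nat).

Let level (j : nat) : set RT := [set t | nearest_idx ys m t = j].

Let mlevel j : measurable (level j).
Proof.
have mid : norm_measurable setT (id : RT -> R^o).
  move=> z; apply: continuous_measurable_fun => t.
  by apply: cvg_norm; apply: cvgB; [exact: cvg_id|exact: cvg_cst].
have := (measurable_nearest measurableT ys m mid).2 j; rewrite setTI.
by congr measurable.
Qed.

(** The indices of the points of a dense sequence by which the first [k] variables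
    are discretized. *)
Definition disc_index k (w : Omega) : {ffun 'I_k -> 'I_m.+1} :=
  [ffun i : 'I_k => inord (nearest_idx ys m (xi i w))].

Let coord k (j : {ffun 'I_k -> 'I_m.+1}) (i : nat) : nat :=
  if (insub i : option 'I_k) is Some i' then j i' : nat else 0%N.

Let disc_rect k (j : {ffun 'I_k -> 'I_m.+1}) :
  [set w | disc_index k w = j] =
  \big[setI/setT]_(i <- iota 0 k)
    (xi i @^-1` level (coord j i)).
Proof.
rewrite -bigcap_seq; apply/seteqP; split=> w /=.
  move=> <- i /=; rewrite mem_iota add0n => ik; rewrite /level /coord /=.
  by rewrite insubT /= ffunE inordK// ltnS nearest_idx_le.
move=> h; apply/ffunP => i; rewrite ffunE; apply: val_inj.
have := h i; rewrite /= mem_iota add0n ltn_ord => /(_ isT).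
rewrite /level /coord /= valK => e.
by rewrite /= inordK ?e// ltnS -e nearest_idx_le.
Qed.

Let measurable_rect k (j : {ffun 'I_k -> 'I_m.+1}) :
  measurable [set w | disc_index k w = j].
Proof.
rewrite disc_rect; apply: big_ind => //; first exact: measurableI.
by move=> i _; rewrite -[X in measurable X]setTI; apply: mxi => //; exact: mlevel.
Qed.

(** The finitely many events on which the discretized [xi 0, .., xi (k - 1)] take
    given values are rectangles in these variables, hence independent of [xi k],
    whose integral over each of them vanishes. *)
Lemma integral_disc k (c : {ffun 'I_k -> 'I_m.+1} -> R) :
  P.-integrable setT (EFin \o (fun w => c (disc_index k w) * xi k w)) /\
  (\int[P]_w (c (disc_index k w) * xi k w)%:E = 0)%E.
Proof.
pose E j := [set w | disc_index k w = j].
pose f j w := (c j * (\1_(E j) w * xi k w)).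
have cE w : c (disc_index k w) * xi k w = \sum_j f j w.
  rewrite (bigD1 (disc_index k w))//= /f indicE mem_set// mul1r big1 ?addr0//.
  by move=> j /eqP jw; rewrite indicE memNset ?mul0r ?mulr0// => e; exact: jw.
have I1 j : P.-integrable setT (EFin \o (fun w => \1_(E j) w * xi k w)).
  apply: (le_integrable measurableT _ _ (gauss_integrable k)).
    apply/measurable_EFinP; apply: measurable_funM; last exact: mxi.
    exact/measurable_indic/measurable_rect.
  move=> w _ /=; rewrite lee_fin normrM ler_piMl//.
  by rewrite indicE; case: (_ \in _); rewrite ?normr1 ?normr0.
have If j : P.-integrable setT (EFin \o f j).
  exact: (integrableZl measurableT (c j) (I1 j)).
split.
  apply: (eq_integrable measurableT (fun w => \sum_j (EFin \o f j) w)%E).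
    by move=> w _; rewrite /= cE sumEFin.
  exact: integrable_sum.
transitivity (\int[P]_w \sum_j (f j w)%:E)%E.
  by apply: eq_integral => w _; rewrite cE sumEFin.
rewrite (integral_sum measurableT (f := fun j => EFin \o f j))//; apply: big1 => j _.
under eq_integral do rewrite /= /f EFinM.
rewrite (integralZl measurableT (I1 j)).
suff -> : (\int[P]_w (\1_(E j) w * xi k w)%:E = 0)%E by rewrite mule0.
transitivity (\int[P]_(w in E j) (xi k w)%:E)%E.
  rewrite [RHS]integral_mkcond; apply: eq_integral => w _.
  by rewrite /patch indicE; case: ifPn => _; rewrite ?mul1r ?mul0r.
apply: integral_indep0.
- exact: mxi.
- exact: measurable_rect.
- move=> B mB; rewrite /E disc_rect.
  apply: (gauss_rectangle (B := fun i => level (coord j i))) => //.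
  + exact: iota_uniq.
  + by rewrite mem_iota add0n ltnn.
- exact (gauss_integrable k).
Qed.

Lemma measurable_disc k (f : {ffun 'I_k -> 'I_m.+1} -> R) :
  measurable_fun setT (fun w => f (disc_index k w)).
Proof.
move=> _ B mB; rewrite setTI.
have -> : (fun w => f (disc_index k w)) @^-1` B =
    \bigcup_(j in [set j | B (f j)]) [set w | disc_index k w = j].
  by apply/seteqP; split=> w /=; [exists (disc_index k w)|case=> j /= Bj ->].
by apply: fin_bigcup_measurable => // j _; exact: measurable_rect.
Qed.

End Moments.

Lemma cvg_norm_sqr (R : realType) (X : normedModType R) (f : nat -> X) (l : X) :
  f m @[m --> \oo] --> l ->
  (`|f m| ^+ 2)%:E @[m --> \oo] --> (`|l| ^+ 2)%:E.
Proof.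
move=> fl; apply: cvg_EFin; first exact: nearW.
apply: (@cvg_comp _ _ _ (fun m => `|f m|) (fun r : R => r ^+ 2)).
  exact: cvg_norm fl.
exact: exprn_continuous.
Qed.

Section PartialSums.
Context {R : realType} {d : measure_display} {Omega : measurableType d}.
Variable P : probability Omega R.
Local Notation RT := (measurableTypeR R).
Variable xi : nat -> Omega -> R.
Hypothesis G : gaussian_sequence P xi.
Context {X : normedModType R}.
Hypothesis sepX : separable X.

Let mxi k : measurable_fun setT (xi k : Omega -> RT) := gauss_measurable G k.

Definition gauss_partial (u : nat -> X) n w : X := \sum_(i < n) xi i w *: u i.

Lemma gauss_partialS u n w :
  gauss_partial u n.+1 w = gauss_partial u n w + xi n w *: u n.
Proof. exact: big_ord_recr. Qed.

Lemma norm_measurable_partial u n : norm_measurable setT (gauss_partial u n).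
Proof.
elim: n => [|n IH].
  have -> : gauss_partial u 0 = fun=> 0 by apply/funext => w; exact: big_ord0.
  exact: norm_measurable_cst.
have -> : gauss_partial u n.+1 = gauss_partial u n \+ (fun w => xi n w *: u n).
  by apply/funext => w; exact: gauss_partialS.
by apply: norm_measurableD => //; apply: norm_measurable_scale => //; exact: mxi.
Qed.

Let dom (u : nat -> X) n w : R := \sum_(i < n) 2 * (`|xi i w| * `|u i|).

Let dom_ge0 u n w : 0 <= dom u n w.
Proof. by apply: sumr_ge0 => i _; rewrite !mulr_ge0. Qed.

Let integrable_dom u n : P.-integrable setT (fun w => (dom u n w ^+ 2)%:E).
Proof.
elim: n => [|n IH].
  apply: (eq_integrable measurableT (cst 0%E)); last exact: integrable0.
  by move=> w _; rewrite /dom big_ord0 expr0n.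
pose a w : \bar R := (2%:E * (dom u n w ^+ 2)%:E)%E.
pose b w : \bar R := ((8 * `|u n| ^+ 2)%:E * (xi n w ^+ 2)%:E)%E.
have Iab : P.-integrable setT (a \+ b)%E.
  apply: integrableD => //; first exact: (integrableZl measurableT 2 IH).
  exact: (integrableZl measurableT _ (gauss_sqr_integrable G n)).
apply: (le_integrable measurableT _ _ Iab).
  apply/measurable_EFinP; apply: measurable_funX.
  apply: measurable_sum => i; apply: measurable_funM => //.
  apply: measurable_funM => //.
  exact: (measurableT_comp _ (mxi i)).
move=> w _; rewrite /a /b -!EFinM -EFinD !gee0_abs ?lee_fin ?sqr_ge0//; last first.
  by have := sqr_ge0 (dom u n w); have := mulr_ge0 (sqr_ge0 `|u n|) (sqr_ge0 (xi n w)); lra.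
rewrite /dom big_ord_recr /= -/(dom u n w) -(real_normK (num_real (xi n w))).
by have := sqr_ge0 (dom u n w - 2 * (`|xi n w| * `|u n|)); nra.
Qed.

Let partial_le u n w : `|gauss_partial u n w| <= dom u n w.
Proof.
apply: (le_trans (ler_norm_sum _ _ _)); apply: ler_sum => i _.
by rewrite normrZ ler_peMl ?mulr_ge0// ler1n.
Qed.

Lemma integrable_partial u n :
  P.-integrable setT (fun w => (`|gauss_partial u n w| ^+ 2)%:E).
Proof.
apply: (le_integrable measurableT _ _ (integrable_dom u n)).
  apply/measurable_EFinP; apply: measurable_funX.
  exact/norm_measurable_norm/norm_measurable_partial.
move=> w _; rewrite !gee0_abs ?lee_fin ?sqr_ge0//.
by rewrite lerXn2r ?nnegrE// ?dom_ge0 ?partial_le.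
Qed.

(** Adding an independent centred term cannot decrease the mean square, and
    increases it at least by the quadratic term of a lower bound of the squared
    norm that is otherwise affine along the line. In such a bound the affine
    term is a function of the previous variables; when these are discretized, it
    integrates to zero against the new one. *)
Lemma gauss_step u n (c : X -> R) kappa : 0 <= kappa ->
  (forall a s, `|a| ^+ 2 + c a * s + kappa * s ^+ 2 <= `|a + s *: u n| ^+ 2) ->
  (\int[P]_w (`|gauss_partial u n w| ^+ 2)%:E + (kappa * gauss_var R)%:E <=
   \int[P]_w (`|gauss_partial u n.+1 w| ^+ 2)%:E)%E.
Proof.
move=> k0 cP; (* [A m] is the partial sum with discretized variables *)
have [ys [ys0 ysd]] := separable_seq (@separable_real R).
pose F m (j : {ffun 'I_n -> 'I_m.+1}) : X := \sum_(i < n) ys (j i) *: u i.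
pose A m w := F m (disc_index xi ys m n w).
have AE m w : A m w = \sum_(i < n) nearest ys m (xi i w) *: u i.
  by apply: eq_bigr => i _; rewrite ffunE inordK// ltnS nearest_idx_le.
have Acvg w : A m w @[m --> \oo] --> gauss_partial u n w.
  under eq_fun do rewrite AE.
  apply: cvg_big => //; first exact: add_continuous.
  by move=> i _; apply: cvgZl; exact: nearest_cvg.
have mA m : norm_measurable setT (A m).
  by move=> z; exact: (measurable_disc G ys (fun j => `|F m j - z|)).
have mA' m : norm_measurable setT (fun w => A m w + xi n w *: u n).
  by apply: norm_measurableD => //; apply: norm_measurable_scale => //; exact: mxi.
have Ale m w : `|A m w| <= dom u n w.
  rewrite AE; apply: (le_trans (ler_norm_sum _ _ _)); apply: ler_sum => i _.
  by rewrite normrZ mulrA ler_wpM2r// nearest_norm.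
have A'le m w : `|A m w + xi n w *: u n| <= dom u n.+1 w.
  rewrite /dom big_ord_recr /= -/(dom u n w); apply: (le_trans (ler_normD _ _)).
  by apply: lerD; [exact: Ale|rewrite normrZ ler_peMl ?mulr_ge0// ler1n].
have Alt m w : `|A m w| <= dom u n.+1 w.
  rewrite /dom big_ord_recr /= -/(dom u n w); apply: (le_trans (Ale m w)).
  by rewrite lerDl !mulr_ge0.
pose f m w := (`|A m w| ^+ 2)%:E.
pose h m w := (`|A m w + xi n w *: u n| ^+ 2)%:E.
have mf m : measurable_fun setT (f m).
  by apply/measurable_EFinP; apply: measurable_funX; exact: norm_measurable_norm.
have mh m : measurable_fun setT (h m).
  by apply/measurable_EFinP; apply: measurable_funX; exact: norm_measurable_norm.
have fle m w : (`|f m w| <= (dom u n.+1 w ^+ 2)%:E)%E.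
  by rewrite gee0_abs ?lee_fin ?sqr_ge0// lerXn2r ?nnegrE// ?dom_ge0 ?Alt.
have hle m w : (`|h m w| <= (dom u n.+1 w ^+ 2)%:E)%E.
  by rewrite gee0_abs ?lee_fin ?sqr_ge0// lerXn2r ?nnegrE// ?dom_ge0 ?A'le.
have Idom := integrable_dom u n.+1.
have If m : P.-integrable setT (f m).
  apply: (le_integrable measurableT _ _ Idom) => // w _.
  exact: (le_trans (fle m w) (lee_abs _)).
have Ih m : P.-integrable setT (h m).
  apply: (le_integrable measurableT _ _ Idom) => // w _.
  exact: (le_trans (hle m w) (lee_abs _)).
have step m : (\int[P]_w f m w + (kappa * gauss_var R)%:E <= \int[P]_w h m w)%E.
  have [I1 E1] := integral_disc G ys (m := m) (k := n) (fun j => c (F m j)).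
  have I2 := integrableZl measurableT kappa (gauss_sqr_integrable G n).
  have -> : (\int[P]_w f m w + (kappa * gauss_var R)%:E =
      \int[P]_w (f m w + (c (A m w) * xi n w)%:E + kappa%:E * (xi n w ^+ 2)%:E))%E.
    rewrite integralD//; last exact: integrableD.
    rewrite integralD// E1 adde0 (integralZl measurableT (gauss_sqr_integrable G n)).
    by rewrite (gauss_sqr G) EFinM.
  apply: le_integral => //.
    by apply: integrableD => //; exact: integrableD.
  by move=> w _; rewrite -EFinM -!EFinD lee_fin; exact: cP.
have [_ _ cf] : [/\ P.-integrable setT (fun w => (`|gauss_partial u n w| ^+ 2)%:E),
    [sequence \int[P]_w `|f m w - (`|gauss_partial u n w| ^+ 2)%:E|]_m @ \oo --> 0 &
    [sequence \int[P]_w f m w]_m @ \oo --> \int[P]_w (`|gauss_partial u n w| ^+ 2)%:E]%E.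
  apply: (dominated_convergence measurableT _ _ _ Idom) => //.
  - apply/measurable_EFinP; apply: measurable_funX.
    exact/norm_measurable_norm/norm_measurable_partial.
  - by apply: aeW => w _; apply: cvg_norm_sqr; exact: Acvg.
  - by apply: aeW => w m _; exact: fle.
have [_ _ ch] : [/\ P.-integrable setT (fun w => (`|gauss_partial u n.+1 w| ^+ 2)%:E),
    [sequence \int[P]_w `|h m w - (`|gauss_partial u n.+1 w| ^+ 2)%:E|]_m @ \oo --> 0 &
    [sequence \int[P]_w h m w]_m @ \oo --> \int[P]_w (`|gauss_partial u n.+1 w| ^+ 2)%:E]%E.
  apply: (dominated_convergence measurableT _ _ _ Idom) => //.
  - apply/measurable_EFinP; apply: measurable_funX.
    exact/norm_measurable_norm/norm_measurable_partial.
  - apply: aeW => w _; apply: cvg_norm_sqr; rewrite gauss_partialS.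
    by apply: cvgD; [exact: Acvg|exact: cvg_cst].
  - by apply: aeW => w m _; exact: hle.
apply: (lee_cvg_to (cvgeD _ cf (cvg_cst (kappa * gauss_var R)%:E)) ch) => //.
  by rewrite fin_num_adde_defl.
by apply: nearW => m; exact: step.
Qed.

End PartialSums.

Lemma cauchy_schwarz_sum (R : realFieldType) n (a b : 'I_n -> R) :
  (\sum_i a i * b i) ^+ 2 <= (\sum_i a i ^+ 2) * (\sum_i b i ^+ 2).
Proof.
set S := \sum_i a i * b i; set A := \sum_i a i ^+ 2; set B := \sum_i b i ^+ 2.
have B0 : 0 <= B by apply: sumr_ge0 => i _; exact: sqr_ge0.
have : 0 <= \sum_i (B * a i - S * b i) ^+ 2 by apply: sumr_ge0 => i _; exact: sqr_ge0.
have key p q : \sum_i (p * a i - q * b i) ^+ 2 = p ^+ 2 * A - 2 * p * q * S + q ^+ 2 * B.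
  rewrite /A /S /B !mulr_sumr -sumrB -big_split /=.
  by apply: eq_bigr => i _; ring.
rewrite key (_ : _ + _ = B * (A * B - S ^+ 2)); last by ring.
move: B0; rewrite le_eqVlt => /predU1P[B0 _|B0]; last by rewrite pmulr_rge0// subr_ge0.
suff -> : S = 0 by rewrite expr0n -B0 mulr0.
apply: big1 => i _; suff -> : b i = 0 by rewrite mulr0.
have /eqP := esym B0; rewrite psumr_eq0; last by move=> j _; exact: sqr_ge0.
by move=> /allP /(_ i (mem_index_enum i)); rewrite sqrf_eq0 => /eqP.
Qed.

Section PartialSumBounds.
Context {R : realType} {d : measure_display} {Omega : measurableType d}.
Variable P : probability Omega R.
Variable xi : nat -> Omega -> R.
Hypothesis G : gaussian_sequence P xi.

(** The lower bound required by [gauss_step] is [(|a| + s ell_a (u_m))^2] without its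
    quadratic term, where [ell_a] norms [a]. *)
Lemma gauss_partial_le (X : normedModType R) (u : nat -> X) n m : separable X ->
  (n <= m)%N ->
  (\int[P]_w (`|gauss_partial xi u n w| ^+ 2)%:E <=
   \int[P]_w (`|gauss_partial xi u m w| ^+ 2)%:E)%E.
Proof.
move=> sepX; elim: m => [|m IH]; first by rewrite leqn0 => /eqP ->.
rewrite leq_eqVlt => /predU1P[->//|]; rewrite ltnS => /IH; move/le_trans; apply.
have [ell ellP] := choice (@norming_functional R X).
have := gauss_step G sepX (u := u) (n := m)
  (c := fun a => 2 * `|a| * (ell a (u m) : R)) (lexx 0).
rewrite mul0r adde0; apply=> a s; have [_ ella elle] := ellP a.
rewrite mul0r addr0.
have h : `|(`|a| + s * ell a (u m))| <= `|a + s *: u m|.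
  by rewrite -{1}ella; apply: le_trans (elle _); rewrite linearD linearZ.
apply: (@le_trans _ _ (`|(`|a| + s * ell a (u m))| ^+ 2)).
  by rewrite real_normK ?num_real//; have := sqr_ge0 (s * ell a (u m)); lra.
by rewrite lerXn2r ?nnegrE.
Qed.

(** For real coefficients the square of a sum is quadratic, and [gauss_step] applies
    with its full quadratic term. *)
Lemma gauss_partial_real (c : nat -> R^o) n :
  ((gauss_var R * \sum_(i < n) (c i : R) ^+ 2)%:E <=
   \int[P]_w (`|gauss_partial xi c n w| ^+ 2)%:E)%E.
Proof.
elim: n => [|n IH].
  by rewrite big_ord0 mulr0; apply: integral_ge0 => w _; rewrite lee_fin sqr_ge0.
have := gauss_step G (@separable_real R) (u := c) (n := n)
  (c := fun a => 2 * (a : R) * c n) (sqr_ge0 (c n : R)).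
move=> h; apply: (le_trans _ (h _)).
  by rewrite big_ord_recr /= mulrDr EFinD leeD// lee_fin mulrC.
move=> a s; rewrite !real_normK ?num_real//.
by rewrite -[s *: c n]/(s * c n); lra.
Qed.

(** Testing the sum with a norming functional reduces the bound to the
    orthogonality of real Gaussian sums and to the Cauchy-Schwarz inequality. *)
Lemma gauss_partial_coord (X : normedModType R) (u : nat -> X) n e (h : nat -> R) :
  separable X -> 0 <= e ->
  (\int[P]_w (`|gauss_partial xi u n w| ^+ 2)%:E <= (e ^+ 2)%:E)%E ->
  `|\sum_(i < n) h i *: u i| <=
    e / Num.sqrt (gauss_var R) * Num.sqrt (\sum_(i < n) h i ^+ 2).
Proof.
move=> sepX e0 ue; set x := \sum_(i < n) _.
have [ell [_ ellx elle]] := norming_functional x.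
pose c i : R^o := ell (u i).
have v0 := @gauss_var_gt0 R.
have cE w : gauss_partial xi c n w = ell (gauss_partial xi u n w).
  by rewrite /gauss_partial linear_sum; apply: eq_bigr => i _; rewrite linearZ.
have ce : gauss_var R * \sum_(i < n) (c i : R) ^+ 2 <= e ^+ 2.
  rewrite -lee_fin; apply: le_trans (gauss_partial_real c n) _.
  apply: (le_trans _ ue); apply: ge0_le_integral => //.
  - apply/measurable_EFinP; apply: measurable_funX; apply: norm_measurable_norm.
    exact: (norm_measurable_partial G (@separable_real R)).
  - apply/measurable_EFinP; apply: measurable_funX; apply: norm_measurable_norm.
    exact: (norm_measurable_partial G sepX).
  - by move=> w _; rewrite lee_fin lerXn2r ?nnegrE// cE.
have xE : `|x| = \sum_(i < n) h i * c i.
  by rewrite -ellx /x linear_sum; apply: eq_bigr => i _; rewrite linearZ.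
have c0 : 0 <= e / Num.sqrt (gauss_var R) by rewrite divr_ge0 ?sqrtr_ge0.
have s0 : 0 <= \sum_(i < n) h i ^+ 2 by apply: sumr_ge0 => i _; exact: sqr_ge0.
rewrite -ler_sqr ?nnegrE ?mulr_ge0 ?sqrtr_ge0// xE.
apply: le_trans (cauchy_schwarz_sum _ _) _.
rewrite !exprMn exprVn !sqr_sqrtr ?(ltW v0)// mulrC ler_wpM2r//.
by rewrite ler_pdivlMr// mulrC.
Qed.

End PartialSumBounds.

(** * Mean square bounds *)

Section GeometricIncrements.
Context {R : realType}.
Variables (C rho : R).
Hypotheses (C0 : 0 <= C) (rho0 : 0 < rho) (rho1 : rho < 1).

(** The sum of [C rho^i] over [i >= n]. *)
Definition geom_tail n : R := C * rho ^+ n / (1 - rho).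

Lemma geom_tail_ge0 n : 0 <= geom_tail n.
Proof. by rewrite divr_ge0 ?subr_ge0 ?(ltW rho1)// mulr_ge0// exprn_ge0// ltW. Qed.

Lemma geom_tailS n : C * rho ^+ n + geom_tail n.+1 = geom_tail n.
Proof. by rewrite /geom_tail exprS; field; rewrite subr_eq0 gt_eqF. Qed.

Lemma geom_tail_cvg : geom_tail n @[n --> \oo] --> 0.
Proof.
rewrite -[X in _ --> X](mul0r (1 - rho)^-1); apply: cvgMl.
rewrite -[X in _ --> X](mulr0 C); apply: cvgMr.
by apply: cvg_expr; rewrite ger0_norm// ltW.
Qed.

Lemma geometric_dist (X : normedModType R) (u : nat -> X) :
  (forall n, `|u n.+1 - u n| <= C * rho ^+ n) ->
  forall n m, (n <= m)%N -> `|u m - u n| <= geom_tail n.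
Proof.
move=> du n m /subnK <-; move: (m - n)%N => k; elim: k n => [|k IH] n.
  by rewrite subrr normr0 geom_tail_ge0.
rewrite addSnnS; apply: (le_trans (ler_distD (u n.+1) _ _)).
by rewrite -geom_tailS addrC lerD.
Qed.

Lemma geometric_cvg (X : completeNormedModType R) (u : nat -> X) :
  (forall n, `|u n.+1 - u n| <= C * rho ^+ n) ->
  cvgn u /\ forall n, `|limn u - u n| <= geom_tail n.
Proof.
move=> du; have dd := geometric_dist du.
have cu : cvgn u.
  apply: (cvg_of_dist geom_tail_cvg) => n m.
  have [nm|/ltnW nm] := leqP n m; rewrite ?[`|u n - u m|]distrC.
    by rewrite (le_trans (dd _ _ nm))// lerDl geom_tail_ge0.
  by rewrite distrC (le_trans (dd _ _ nm))// lerDr geom_tail_ge0.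
split=> // n; have h : `|u m - u n| @[m --> \oo] --> `|limn u - u n|.
  by apply: cvg_norm; apply: cvgB => //; exact: cvg_cst.
rewrite -(cvg_lim _ h)//; apply: limr_le; first by apply/cvg_ex; eexists; exact: h.
by exists n => // m /= nm; exact: dd.
Qed.

End GeometricIncrements.

Section MeanSquare.
Context {R : realType} {d : measure_display} {Omega : measurableType d}.
Variable P : probability Omega R.
Context {X : normedModType R}.
Hypothesis sepX : separable X.
Implicit Types (Z : Omega -> X) (e : R).

(** The L^2 norm is bounded by a real number rather than computed: such bounds
    add and pass to limits without any discussion of finiteness. *)
Definition l2_le Z e : Prop :=
  [/\ norm_measurable setT Z, 0 <= e &
      (\int[P]_w (`|Z w| ^+ 2)%:E <= (e ^+ 2)%:E)%E].

Lemma measurable_norm_sqr Z : norm_measurable setT Z ->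
  measurable_fun setT (fun w => (`|Z w| ^+ 2)%:E).
Proof.
move=> mZ; apply/measurable_EFinP; apply: measurable_funX.
exact: norm_measurable_norm.
Qed.

Lemma l2_le_fin Z : norm_measurable setT Z ->
  (\int[P]_w (`|Z w| ^+ 2)%:E < +oo)%E -> exists e, l2_le Z e.
Proof.
move=> mZ; set I := (\int[P]_w _)%E => Ioo.
have I0 : (0 <= I)%E by apply: integral_ge0 => w _; rewrite lee_fin sqr_ge0.
exists (Num.sqrt (fine I)); split=> //.
by rewrite -/I sqr_sqrtr ?fine_ge0// fineK// ge0_fin_numE.
Qed.

Lemma l2_le_lim Z e : norm_measurable setT Z -> 0 <= e ->
  (forall t, 0 < t -> l2_le Z (e + t)) -> l2_le Z e.
Proof.
move=> mZ e0 h; split=> //; set I := (\int[P]_w _)%E.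
have I0 : (0 <= I)%E by apply: integral_ge0 => w _; rewrite lee_fin sqr_ge0.
have IE : ((fine I)%:E = I)%E.
  have [_ _ h1] := h 1 ltr01.
  by rewrite fineK// ge0_fin_numE// (le_lt_trans h1)// ltry.
rewrite -IE lee_fin -[fine I]sqr_sqrtr ?fine_ge0//.
rewrite lerXn2r ?nnegrE ?sqrtr_ge0//; apply/ler_addgt0Pr => t t0.
have [_ _ ht] := h t t0.
by rewrite -[e + t]ger0_norm ?addr_ge0 ?(ltW t0)// -sqrtr_sqr ler_wsqrtr// -lee_fin IE.
Qed.

(** Minkowski's inequality, in the elementary form
    [(x + y)^2 <= (1 + F / E) x^2 + (1 + E / F) y^2] where [E] and [F] are the
    bounds to be added. *)
Lemma l2_le_comb Z U V s t e f : norm_measurable setT Z -> 0 <= s -> 0 <= t ->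
  (forall w, `|Z w| <= s * `|U w| + t * `|V w|) ->
  l2_le U e -> l2_le V f -> l2_le Z (s * e + t * f).
Proof.
move=> mZ s0 t0 ZUV [mU e0 Ue] [mV f0 Vf].
apply: l2_le_lim => //; first by rewrite addr_ge0 ?mulr_ge0.
move=> r r0; pose E := s * e + r / 2; pose F := t * f + r / 2.
have E0 : 0 < E by rewrite ltr_wpDl ?mulr_ge0 ?divr_gt0.
have F0 : 0 < F by rewrite ltr_wpDl ?mulr_ge0 ?divr_gt0.
have -> : s * e + t * f + r = E + F by rewrite /E /F; field.
split=> //; first by rewrite addr_ge0 ?ltW.
pose a : R := (1 + F / E) * s ^+ 2; pose b : R := (1 + E / F) * t ^+ 2.
have p0 : 0 <= 1 + F / E by rewrite addr_ge0// divr_ge0 ?ltW.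
have q0 : 0 <= 1 + E / F by rewrite addr_ge0// divr_ge0 ?ltW.
have a0 : 0 <= a by rewrite mulr_ge0// sqr_ge0.
have b0 : 0 <= b by rewrite mulr_ge0// sqr_ge0.
have ptw w : `|Z w| ^+ 2 <= a * `|U w| ^+ 2 + b * `|V w| ^+ 2.
  apply: (@le_trans _ _ ((s * `|U w| + t * `|V w|) ^+ 2)).
    by rewrite lerXn2r ?nnegrE// ?addr_ge0 ?mulr_ge0.
  rewrite /a /b; set x := s * `|U w|; set y := t * `|V w|.
  rewrite -[_ * s ^+ 2 * _]mulrA -[_ * t ^+ 2 * _]mulrA -!exprMn -/x -/y -subr_ge0.
  rewrite (_ : _ - _ = (F * x - E * y) ^+ 2 / (E * F)); last by field; rewrite !gt_eqF.
  by rewrite divr_ge0 ?sqr_ge0// mulr_ge0// ltW.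
have mU2 := measurable_norm_sqr mU; have mV2 := measurable_norm_sqr mV.
apply: (@le_trans _ _ (\int[P]_w (a%:E * (`|U w| ^+ 2)%:E + b%:E * (`|V w| ^+ 2)%:E))%E).
  apply: ge0_le_integral => //; first exact: measurable_norm_sqr.
    by apply: emeasurable_funD; exact: measurable_funeM.
  move=> w _; rewrite -!EFinM -EFinD lee_fin; exact: ptw.
rewrite ge0_integralD//; last 4 first.
- by move=> w _; rewrite -EFinM lee_fin mulr_ge0// sqr_ge0.
- exact: measurable_funeM.
- by move=> w _; rewrite -EFinM lee_fin mulr_ge0// sqr_ge0.
- exact: measurable_funeM.
have U0 w : setT w -> (0 <= (`|U w| ^+ 2)%:E)%E by rewrite lee_fin sqr_ge0.
have V0 w : setT w -> (0 <= (`|V w| ^+ 2)%:E)%E by rewrite lee_fin sqr_ge0.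
rewrite !ge0_integralZl_EFin//.
apply: (@le_trans _ _ (a * e ^+ 2 + b * f ^+ 2)%:E).
  by rewrite EFinD !EFinM leeD// lee_wpmul2l.
rewrite lee_fin /a /b -[_ * _ * e ^+ 2]mulrA -[_ * _ * f ^+ 2]mulrA -!exprMn.
have h1 : (s * e) ^+ 2 <= E ^+ 2.
  by rewrite lerXn2r ?nnegrE ?mulr_ge0 ?(ltW E0)// /E lerDl divr_ge0 ?ltW.
have h2 : (t * f) ^+ 2 <= F ^+ 2.
  by rewrite lerXn2r ?nnegrE ?mulr_ge0 ?(ltW F0)// /F lerDl divr_ge0 ?ltW.
apply: le_trans (lerD (ler_wpM2l p0 h1) (ler_wpM2l q0 h2)) _.
by apply: le_of_eq; field; rewrite !gt_eqF.
Qed.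

Lemma l2_le_add U V e f : l2_le U e -> l2_le V f -> l2_le (U \+ V) (e + f).
Proof.
move=> hU hV; have [mU _ _] := hU; have [mV _ _] := hV.
rewrite -(mul1r e) -(mul1r f); apply: (l2_le_comb _ _ _ _ hU hV) => //.
  exact: norm_measurableD.
by move=> w; rewrite !mul1r ler_normD.
Qed.

Lemma l2_le_sub U V e f : l2_le U e -> l2_le V f -> l2_le (U \- V) (e + f).
Proof.
move=> hU hV; have [mU _ _] := hU; have [mV _ _] := hV.
rewrite -(mul1r e) -(mul1r f); apply: (l2_le_comb _ _ _ _ hU hV) => //.
  exact: norm_measurableB.
by move=> w; rewrite !mul1r ler_normB.
Qed.

Lemma l2_le_scale Z U s e : norm_measurable setT Z -> 0 <= s ->
  (forall w, `|Z w| <= s * `|U w|) -> l2_le U e -> l2_le Z (s * e).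
Proof.
move=> mZ s0 ZU hU; rewrite -[X in l2_le _ X]addr0 -(mul0r e).
by apply: (l2_le_comb _ _ _ _ hU hU) => // w; rewrite mul0r addr0.
Qed.

Lemma l2_le_weaken Z e f : e <= f -> l2_le Z e -> l2_le Z f.
Proof.
move=> ef [mZ e0 Ze]; have f0 := le_trans e0 ef; split=> //.
by apply: le_trans Ze _; rewrite lee_fin lerXn2r ?nnegrE.
Qed.

(** Fatou's lemma for the squared norms. *)
Lemma l2_le_fatou (Z_ : nat -> Omega -> X) Z e : norm_measurable setT Z ->
  (forall n, l2_le (Z_ n) e) -> {ae P, forall w, Z_ n w @[n --> \oo] --> Z w} ->
  l2_le Z e.
Proof.
move=> mZ Ze Zae; have [_ e0 _] := Ze 0%N; split=> //.
pose f n w := (`|Z_ n w| ^+ 2)%:E.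
have mf n : measurable_fun setT (f n).
  by apply: measurable_norm_sqr; have [] := Ze n.
have f0 n w : setT w -> (0 <= f n w)%E by rewrite lee_fin sqr_ge0.
have -> : (\int[P]_w (`|Z w| ^+ 2)%:E = \int[P]_w limn_einf (f^~ w))%E.
  apply: ae_eq_integral => //; first exact: measurable_norm_sqr.
    rewrite (_ : (fun w => _) = \- (fun w => limn_esup (\- (f^~ w))))%E.
      by apply: measurableT_comp => //; apply: measurable_fun_limn_esup => n;
        exact: measurableT_comp.
    by apply/funext => w; rewrite limn_esupN oppeK.
  apply: filterS Zae => w Zw _; apply/esym.
  by have [] := cvg_limn_einf_sup (cvg_norm_sqr Zw).
apply: le_trans (fatou P measurableT mf f0) _.
rewrite limn_einf_lim; apply: lime_le; first exact: is_cvg_einfs.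
apply: nearW => n; apply: (@le_trans _ _ (\int[P]_w f n w)%E).
  by apply: ereal_inf_lbound; exists n => /=.
by have [] := Ze n.
Qed.

End MeanSquare.

Section Completeness.
Context {R : realType} {d : measure_display} {Omega : measurableType d}.
Variable P : probability Omega R.
Context {X : completeNormedModType R}.
Hypothesis sepX : separable X.
Variables (C rho : R).
Hypotheses (C0 : 0 <= C) (rho0 : 0 < rho) (rho1 : rho < 1).

Lemma geom_sum_le (f : nat -> R) (K : R) n : 0 <= K ->
  (forall i, f i <= K * rho ^+ i) -> \sum_(0 <= i < n) f i <= geom_tail K rho 0.
Proof.
move=> K0 fK; suff : \sum_(0 <= i < n) f i + geom_tail K rho n <= geom_tail K rho 0.
  by apply: le_trans; rewrite lerDl geom_tail_ge0.
elim: n => [|n IH]; first by rewrite big_nil add0r.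
rewrite big_nat_recr//= -addrA; apply: le_trans IH.
by rewrite lerD2l -(geom_tailS K rho1 n) lerD2r.
Qed.

Variable Z_ : nat -> Omega -> X.
Hypothesis mZ : forall n, norm_measurable setT (Z_ n).
Hypothesis dZ : forall n, l2_le P (Z_ n.+1 \- Z_ n) (C * rho ^+ n).

Lemma geometric_l2_le n m : (n <= m)%N -> l2_le P (Z_ m \- Z_ n) (geom_tail C rho n).
Proof.
move=> /subnK <-; move: (m - n)%N => k; elim: k n => [|k IH] n.
  have t0 := geom_tail_ge0 C0 rho0 rho1 n.
  split=> //; first exact: norm_measurableB.
  rewrite integral0_eq ?lee_fin ?sqr_ge0// => w _.
  by rewrite /= subrr normr0 expr0n.
rewrite -(geom_tailS C rho1 n).
have -> : Z_ (k.+1 + n) \- Z_ n = (Z_ n.+1 \- Z_ n) \+ (Z_ (k + n.+1) \- Z_ n.+1).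
  by apply/funext => w; rewrite /= addSnnS [RHS]addrC subrKA.
exact: l2_le_add.
Qed.

(** The weighted series [\sum_n rho^-n |Z_{n+1} - Z_n|^2] has a finite mean, so
    that almost surely the increments decrease geometrically. *)
Lemma geometric_increments_ae :
  {ae P, forall w, exists K, 0 <= K /\
    forall n, `|Z_ n.+1 w - Z_ n w| <= K * Num.sqrt rho ^+ n}.
Proof.
(* the weight [rho^-n] leaves room on both sides: the means of the terms are at
   most [C^2 rho^n], and a bounded term gives the rate [sqrt rho^n] *)
pose f n w := ((rho ^+ n)^-1%:E * (`|Z_ n.+1 w - Z_ n w| ^+ 2)%:E)%E.
have rn n : 0 < rho ^+ n by rewrite exprn_gt0.
have rn' n : 0 <= (rho ^+ n)^-1 by rewrite invr_ge0 ltW.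
have mD n : measurable_fun setT (fun w => (`|Z_ n.+1 w - Z_ n w| ^+ 2)%:E).
  by apply: measurable_norm_sqr; exact: norm_measurableB.
have f0 n w : setT w -> (0 <= f n w)%E.
  by rewrite /f -EFinM lee_fin mulr_ge0// sqr_ge0.
have mf n : measurable_fun setT (f n) by exact: measurable_funeM.
have fle n : (\int[P]_w f n w <= (C ^+ 2 * rho ^+ n)%:E)%E.
  rewrite ge0_integralZl_EFin//.
  have [_ _ h] := dZ n; apply: (@le_trans _ _ ((rho ^+ n)^-1%:E * ((C * rho ^+ n) ^+ 2)%:E)%E).
    by apply: lee_wpmul2l; rewrite ?lee_fin.
  rewrite -EFinM lee_fin; apply: le_of_eq.
  by field; rewrite gt_eqF.
have If : P.-integrable setT (fun w => \sum_(0 <= n <oo) f n w)%E.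
  apply/integrableP; split.
    by apply: (ge0_emeasurable_sum (P := xpredT)) => // k w Dw _; exact: f0.
  rewrite (_ : (\int[P]_w _)%E = (\int[P]_w (\sum_(0 <= n <oo) f n w))%E); last first.
    apply: eq_integral => w _; rewrite gee0_abs//.
    by apply: nneseries_ge0 => n _ _; exact: f0.
  rewrite integral_nneseries//.
  apply: (@le_lt_trans _ _ (geom_tail (C ^+ 2) rho 0)%:E); last exact: ltry.
  apply: lime_le.
    by apply: is_cvg_nneseries => n _ _; apply: integral_ge0 => w _; exact: f0.
  apply: nearW => n; apply: (@le_trans _ _ (\sum_(0 <= i < n) (C ^+ 2 * rho ^+ i)%:E)%E).
    by apply: lee_sum => i _; exact: fle.
  by rewrite sumEFin lee_fin; apply: geom_sum_le => //; exact: sqr_ge0.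
apply: filterS (integrable_ae measurableT If) => w /(_ I) fw.
set g := (\sum_(0 <= n <oo) f n w)%E in fw.
exists (Num.sqrt (fine g)); split; first exact: sqrtr_ge0.
move=> n.
have g0 : (0 <= g)%E by apply: nneseries_ge0 => k _ _; exact: f0.
have fg : (f n w <= g)%E.
  apply: le_trans (nneseries_lim_ge n.+1 (fun k _ _ => f0 k w I)).
  rewrite big_nat_recr//= leeDr//; apply: sume_ge0 => k _; exact: f0.
rewrite -ler_sqr ?nnegrE ?mulr_ge0 ?exprn_ge0 ?sqrtr_ge0//.
rewrite exprMn sqr_sqrtr ?fine_ge0// exprAC sqr_sqrtr ?(ltW rho0)//.
move: fg; rewrite -[g]fineK// /f -EFinM lee_fin mulrC ler_pdivrMr//.
Qed.

(** Off a null set the sequence converges pointwise, and its bounds pass to the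
    limit by Fatou's lemma. *)
Lemma l2_complete : exists Z, forall n, l2_le P (Z \- Z_ n) (geom_tail C rho n).
Proof.
have [N [mN N0 hN]] := geometric_increments_ae.
have s0 : 0 < Num.sqrt rho by rewrite sqrtr_gt0.
have s1 : Num.sqrt rho < 1 by rewrite -[ltRHS]sqrtr1 ltr_sqrt.
have cZ w : ~ N w -> cvgn (Z_ ^~ w).
  move=> Nw; have [K [K0 ZK]] := contrapT (fun h => Nw (hN w h)).
  by have [] := geometric_cvg K0 s0 s1 ZK.
pose V_ n w : X := if w \in N then 0 else Z_ n w.
pose Z w : X := if w \in N then 0 else limn (Z_ ^~ w).
have mV n : norm_measurable setT (V_ n).
  move=> z; have -> : (fun w => `|V_ n w - z|) =
      (fun w => \1_N w * `|0 - z| + (1 - \1_N w) * `|Z_ n w - z|).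
    apply/funext => w; rewrite /V_ indicE; case: ifP => _ /=.
      by rewrite mul1r subrr mul0r addr0.
    by rewrite mul0r add0r subr0 mul1r.
  apply: measurable_funD; first by apply: measurable_funM => //; exact: measurable_indic.
  by apply: measurable_funM; [apply: measurable_funB => //; exact: measurable_indic|exact: mZ].
have VZ w : V_ n w @[n --> \oo] --> Z w.
  rewrite /V_ /Z; case: ifPn => [_|/negP Nw]; first exact: cvg_cst.
  by apply: cZ => h; apply: Nw; rewrite inE.
have mZ' : norm_measurable setT Z by apply: (norm_measurable_cvg mV) => w _; exact: VZ.
exists Z => n; apply: (l2_le_fatou (Z_ := fun m => Z_ (m + n)%N \- Z_ n)) => //.
- exact: norm_measurableB.
- by move=> m; apply: geometric_l2_le; exact: leq_addl.
- exists N; split=> // w /= nh; apply: contrapT => Nw; apply: nh.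
  apply: cvgB; last exact: cvg_cst.
  rewrite (cvg_shiftn n (Z_ ^~ w)) /Z memNset//; exact: cZ.
Qed.

End Completeness.

(** * Radonifying operators with values in the ambient space *)

Section L2Truncation.
Context {R : realType}.
Implicit Types (h : l2 R) (n : nat).

(** The first [n] terms of [h], built up one basis vector at a time so that linear
    maps can be evaluated on it. *)
Fixpoint l2_trunc h n : l2 R :=
  if n is m.+1 then l2_trunc h m + (h m : R) *: l2_basis R m else 0.

Lemma l2_addE (a b : l2 R) j : (a + b) j = (a j : R) + b j.
Proof. by []. Qed.

Lemma l2_scaleE (c : R) (a : l2 R) j : (c *: a) j = c * (a j : R).
Proof. by []. Qed.

Lemma l2_truncE h n j : l2_trunc h n j = if (j < n)%N then (h j : R) else 0.
Proof.
elim: n => [//|n IH].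
rewrite l2_addE l2_scaleE IH /= ltnS (leq_eqVlt j n).
by case: eqVneq => [->|_] /=; rewrite ?ltnn ?add0r ?mulr1// mulr0 addr0.
Qed.

Lemma l2_series_cvg h : cvgn (series (fun k => (h k : R) ^+ 2)).
Proof. by case: h => a /= /asboolP. Qed.
Arguments l2_series_cvg : clear implicits.

Lemma l2_series_nd h :
  {homo series (fun k => (h k : R) ^+ 2) : n m / (n <= m)%N >-> n <= m}.
Proof.
apply/nondecreasing_seqP => n; rewrite /series /= big_nat_recr//= lerDl.
exact: sqr_ge0.
Qed.

Lemma l2norm_ge0 h : 0 <= l2norm h. Proof. exact: sqrtr_ge0. Qed.

Lemma l2norm_partial h n : Num.sqrt (\sum_(i < n) (h i : R) ^+ 2) <= l2norm h.
Proof.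
apply: ler_wsqrtr; rewrite -(big_mkord xpredT (fun i => (h i : R) ^+ 2)).
have := nondecreasing_cvgn_le (l2_series_nd h) (l2_series_cvg h) n.
by [].
Qed.

Lemma l2_trunc_cvg h : l2norm (h - l2_trunc h n) @[n --> \oo] --> 0.
Proof.
pose s := series (fun k => (h k : R) ^+ 2); pose A := limn s.
have sE n : l2norm (h - l2_trunc h n) = Num.sqrt (A - s n).
  rewrite /l2norm; congr Num.sqrt; apply: cvg_lim => //.
  apply: cvg_trans (cvgB (l2_series_cvg h) (cvg_cst (s n))).
  apply: near_eq_cvg; exists n => // m /= nm.
  transitivity (s m - s n); first by [].
  rewrite /s /series /= (big_nat_widen _ _ _ _ _ nm) [X in _ - X]big_mkcond -sumrB.
  apply: eq_bigr => j _.
  rewrite [X in _ = X ^+ 2](_ : _ = (h j : R) - l2_trunc h n j)// l2_truncE /=.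
  by case: ifP => _; rewrite ?subrr ?subr0 ?expr0n//= expr0n.
under eq_fun do rewrite sE.
have h0 : Num.sqrt (A - s n) @[n --> \oo] --> Num.sqrt (A - A).
  apply: (@cvg_comp _ _ _ (fun n => A - s n) Num.sqrt); last exact: sqrt_continuous.
  by apply: cvgB; [exact: cvg_cst|exact: (l2_series_cvg h)].
by rewrite subrr sqrtr0 in h0.
Qed.

Lemma linear_l2_trunc (X : lmodType R) (B : {linear l2 R -> X}) h n :
  B (l2_trunc h n) = \sum_(i < n) (h i : R) *: B (l2_basis R i).
Proof.
elim: n => [|n IH]; first by rewrite big_ord0 linear0.
by rewrite big_ord_recr /= -IH linearD linearZ.
Qed.

End L2Truncation.

Lemma linear_pack (R : pzRingType) (U V : lmodType R) (f : U -> V) : linear f ->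
  exists F : {linear U -> V}, f = F.
Proof.
move=> lf.
by pose F : {linear U -> V} := HB.pack f (GRing.isLinear.Build _ _ _ _ f lf); exists F.
Qed.

Section GaussianOperators.
Context {R : realType} {d : measure_display} {Omega : measurableType d}.
Variable P : probability Omega R.
Variable xi : nat -> Omega -> R.
Hypothesis G : gaussian_sequence P xi.
Context {X : completeNormedModType R}.
Hypothesis sepX : separable X.
Implicit Types (B : l2 R -> X) (Z : Omega -> X) (e : R) (u : nat -> X).

Definition gauss_sum u Z : Prop := forall e, 0 < e -> exists N, forall n, (N <= n)%N ->
  l2_le P (Z \- gauss_partial xi u n) e.

Lemma gauss_partialB u v n :
  gauss_partial xi (u \- v) n = gauss_partial xi u n \- gauss_partial xi v n.
Proof.
by apply/funext => w; rewrite /= /gauss_partial -sumrB; apply: eq_bigr => i _; rewrite -scalerBr.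
Qed.

Lemma gauss_partial_linear (T : {linear X -> X}) u n w :
  gauss_partial xi (T \o u) n w = T (gauss_partial xi u n w).
Proof. by rewrite /gauss_partial linear_sum; apply: eq_bigr => i _; rewrite linearZ. Qed.

(** A partial sum is bounded by the longer ones, and these approach the sum. *)
Lemma gauss_sum_partial_le u Z e n : gauss_sum u Z -> l2_le P Z e ->
  l2_le P (gauss_partial xi u n) e.
Proof.
move=> uZ Ze; have [mZ e0 _] := Ze.
apply: l2_le_lim => //; first exact: (norm_measurable_partial G sepX).
move=> t t0; have [N hN] := uZ t t0.
have h : l2_le P (gauss_partial xi u (maxn n N)) (e + t).
  have -> : gauss_partial xi u (maxn n N) = Z \- (Z \- gauss_partial xi u (maxn n N)).
    by apply/funext => w; rewrite /= subKr.
  by apply: l2_le_sub => //; apply: hN; exact: leq_maxr.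
have [_ et0 het] := h; split=> //; first exact: (norm_measurable_partial G sepX).
by apply: le_trans het; apply: (gauss_partial_le G) => //; exact: leq_maxl.
Qed.

Lemma gauss_sum_le u Z e : norm_measurable setT Z -> 0 <= e -> gauss_sum u Z ->
  (forall n, l2_le P (gauss_partial xi u n) e) -> l2_le P Z e.
Proof.
move=> mZ e0 uZ ue; apply: l2_le_lim => // t t0; have [N hN] := uZ t t0.
have -> : Z = gauss_partial xi u N \+ (Z \- gauss_partial xi u N).
  by apply/funext => w; rewrite /= addrC subrK.
by apply: l2_le_add => //; exact: hN.
Qed.

Lemma gauss_sum_measurable u Z : gauss_sum u Z -> norm_measurable setT Z.
Proof.
move=> /(_ 1 ltr01)[N /(_ N (leqnn N))[mD _ _]].
have -> : Z = gauss_partial xi u N \+ (Z \- gauss_partial xi u N).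
  by apply/funext => w; rewrite /= addrC subrK.
by apply: norm_measurableD => //; exact: (norm_measurable_partial G sepX).
Qed.

Lemma gauss_sum_l2_le u Z : gauss_sum u Z -> exists e, l2_le P Z e.
Proof.
move=> /(_ 1 ltr01)[N /(_ N (leqnn N)) h].
have [e ue] : exists e, l2_le P (gauss_partial xi u N) e.
  apply: l2_le_fin; first exact: (norm_measurable_partial G sepX).
  have /integrableP[_] := integrable_partial G sepX u N.
  by under eq_integral do rewrite gee0_abs ?lee_fin ?sqr_ge0//.
exists (e + 1).
have -> : Z = gauss_partial xi u N \+ (Z \- gauss_partial xi u N).
  by apply/funext => w; rewrite /= addrC subrK.
exact: l2_le_add.
Qed.

Lemma gauss_sumB u v Y Z : gauss_sum u Y -> gauss_sum v Z ->
  gauss_sum (u \- v) (Y \- Z).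
Proof.
move=> uY vZ e e0; have e2 : 0 < e / 2 by rewrite divr_gt0.
have [N hN] := uY _ e2; have [M hM] := vZ _ e2.
exists (maxn N M) => n; rewrite geq_max => /andP[Nn Mn].
rewrite (splitr e) gauss_partialB.
have -> : (Y \- Z) \- (gauss_partial xi u n \- gauss_partial xi v n) =
    (Y \- gauss_partial xi u n) \- (Z \- gauss_partial xi v n).
  by apply/funext => w /=; rewrite !opprB addrACA [RHS]addrACA [in RHS](addrC (- _)).
by apply: l2_le_sub; [|exact: hN|exact: hM].
Qed.

Lemma gauss_sum_unique u Y Z e : gauss_sum u Y -> gauss_sum u Z ->
  l2_le P Y e -> l2_le P Z e.
Proof.
move=> uY uZ Ye; have [_ e0 _] := Ye.
apply: (gauss_sum_le _ _ uZ) => //; first exact: gauss_sum_measurable uZ.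
by move=> n; exact: gauss_sum_partial_le uY Ye.
Qed.

(** A bounded operator with its Gaussian sum. Thus the radonifying operators are
    handled with values in the ambient space; those with values in the domain of
    a power [L^a] are composites with the negative power [L^-a]. *)
Record gauss_operator B Z : Prop := GaussOperator {
  gauss_linear : linear B ;
  gauss_bounded : exists M, forall h, `|B h| <= M * l2norm h ;
  gauss_operator_sum : gauss_sum (fun k => B (l2_basis R k)) Z }.

Lemma gauss_operatorB B B' Z Z' : gauss_operator B Z -> gauss_operator B' Z' ->
  gauss_operator (B \- B') (Z \- Z').
Proof.
move=> [lB [M BM] BZ] [lB' [M' BM'] BZ']; split.
- by move=> a x y /=; rewrite lB lB' scalerBr opprD addrACA.
- exists (M + M') => h /=; rewrite mulrDl; apply: (le_trans (ler_normB _ _)).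
  exact: lerD.
- exact: gauss_sumB.
Qed.

Lemma gauss_operator_comp (T : {linear X -> X}) K B Z : 0 <= K ->
  (forall x, `|T x| <= K * `|x|) -> gauss_operator B Z ->
  gauss_operator (T \o B) (T \o Z).
Proof.
move=> K0 TK [lB [M BM] BZ]; have cT := linear_bound_continuous TK; split.
- by move=> a x y /=; rewrite lB linearP.
- exists (K * M) => h /=; rewrite -mulrA; apply: (le_trans (TK _)).
  exact: ler_wpM2l.
- move=> e e0; have e1 : 0 < e / (K + 1) by rewrite divr_gt0// ltr_wpDl.
  have [N hN] := BZ _ e1; exists N => n Nn.
  apply: (@l2_le_weaken _ _ _ _ _ _ (K * (e / (K + 1)))).
    by rewrite mulrCA ger_pMr// ler_pdivrMr ?ltr_wpDl// mul1r lerDl.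
  apply: l2_le_scale (hN n Nn) => //.
    apply: norm_measurableB => //; last exact: (norm_measurable_partial G sepX).
    by apply: norm_measurable_continuous => //; exact: gauss_sum_measurable BZ.
  move=> w /=; rewrite (gauss_partial_linear T (fun k => B (l2_basis R k))) -linearB.
  exact: TK.
Qed.

(** By continuity it is enough to bound the images of the truncations of [h], which
    are the sums that [gauss_partial_coord] bounds. *)
Lemma gauss_operator_bound B Z e h : gauss_operator B Z -> l2_le P Z e ->
  `|B h| <= e / Num.sqrt (gauss_var R) * l2norm h.
Proof.
move=> [lB [M BM] BZ] Ze; have [_ e0 _] := Ze; have [F FE] := linear_pack lB.
set c := e / _.
have c0 : 0 <= c by rewrite divr_ge0 ?sqrtr_ge0.
have le n : `|B h| <= M * l2norm (h - l2_trunc h n) + c * l2norm h.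
  have -> : B h = B (h - l2_trunc h n) + B (l2_trunc h n) by rewrite FE -linearD subrK.
  apply: (le_trans (ler_normD _ _)); apply: lerD; first exact: BM.
  have [_ _ pe] := gauss_sum_partial_le n BZ Ze.
  rewrite FE linear_l2_trunc -FE.
  apply: (le_trans (gauss_partial_coord G (fun i => h i : R) sepX e0 pe)).
  by rewrite ler_wpM2l// l2norm_partial.
have cv : M * l2norm (h - l2_trunc h n) + c * l2norm h @[n --> \oo] --> M * 0 + c * l2norm h.
  by apply: cvgD; [apply: cvgMr; exact: l2_trunc_cvg|exact: cvg_cst].
rewrite mulr0 add0r in cv; rewrite -(cvg_lim _ cv)//.
by apply: limr_ge; [apply/cvg_ex; eexists; exact: cv|exact: nearW].
Qed.

End GaussianOperators.

Section Limit.
Context {R : realType} {d : measure_display} {Omega : measurableType d}.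
Variable P : probability Omega R.
Variable xi : nat -> Omega -> R.
Hypothesis G : gaussian_sequence P xi.
Context {X : completeNormedModType R}.
Hypothesis sepX : separable X.
Variables (C rho : R).
Hypotheses (C0 : 0 <= C) (rho0 : 0 < rho) (rho1 : rho < 1).
Variables (B_ : nat -> l2 R -> X) (Z_ : nat -> Omega -> X).
Hypothesis BZ : forall n, gauss_operator P xi (B_ n) (Z_ n).
Hypothesis dZ : forall n, l2_le P (Z_ n.+1 \- Z_ n) (C * rho ^+ n).

Let v : R := Num.sqrt (gauss_var R).

Let B_geometric h n : `|B_ n.+1 h - B_ n h| <= C / v * l2norm h * rho ^+ n.
Proof.
have := gauss_operator_bound G sepX h (gauss_operatorB sepX (BZ n.+1) (BZ n)) (dZ n).
by rewrite /= -/v; congr (_ <= _); ring.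
Qed.

Let Cv0 h : 0 <= C / v * l2norm h.
Proof. by rewrite mulr_ge0 ?l2norm_ge0// divr_ge0// sqrtr_ge0. Qed.

Let B h := limn (B_ ^~ h).

Let B_cvg h : B_ n h @[n --> \oo] --> B h.
Proof. by have [] := geometric_cvg (Cv0 h) rho0 rho1 (B_geometric h). Qed.

(** The increments are summable as operators and, uniformly in the number of terms,
    in the mean squares of their partial Gaussian sums; so the limit of the
    Gaussian sums is the Gaussian sum of the limit. *)
Lemma gauss_operator_limit : exists B Z, [/\ gauss_operator P xi B Z,
  forall h, B_ n h @[n --> \oo] --> B h &
  forall n, l2_le P (Z \- Z_ n) (geom_tail C rho n)].
Proof.
have mZ n : norm_measurable setT (Z_ n).
  exact: (gauss_sum_measurable G sepX (gauss_operator_sum (BZ n))).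
have [Z ZP] := l2_complete sepX C0 rho0 rho1 mZ dZ.
exists B, Z; split=> //; split.
- move=> a x y; apply: (cvg_lim (@norm_hausdorff _ X)).
  have h : a *: B_ n x + B_ n y @[n --> \oo] --> a *: B x + B y.
    by apply: cvgD; [apply: cvgZr; exact: B_cvg|exact: B_cvg].
  apply: cvg_trans h; apply: near_eq_cvg; apply: nearW => n.
  by rewrite (gauss_linear (BZ n)).
- have [M BM] := gauss_bounded (BZ 0%N).
  exists (C / v / (1 - rho) + M) => h.
  have [_ /(_ 0%N) h0] := geometric_cvg (Cv0 h) rho0 rho1 (B_geometric h).
  rewrite -(subrK (B_ 0%N h) (B h)); apply: (le_trans (ler_normD _ _)).
  rewrite mulrDl; apply: lerD => //; apply: (le_trans h0).
  by rewrite /geom_tail expr0 mulr1 mulrAC.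
- move=> e e0; have e4 : 0 < e / 4 by rewrite divr_gt0.
  have e2 : 0 < e / 2 by rewrite divr_gt0.
  have /cvgrPdist_lt/(_ _ e4)[n _ /(_ n (leqnn n))] := geom_tail_cvg C rho0 rho1.
  rewrite /= sub0r normrN => /(le_lt_trans (ler_norm _))/ltW tn.
  have [N hN] := gauss_operator_sum (BZ n) e2.
  exists N => k Nk.
  pose u m i := B_ m (l2_basis R i); pose u' i := B (l2_basis R i).
  have p1 : l2_le P (gauss_partial xi (u' \- u n) k) (geom_tail C rho n).
    apply: (l2_le_fatou (Z_ := fun m => gauss_partial xi (u (m + n)%N \- u n) k)).
    + exact: (norm_measurable_partial G sepX).
    + move=> m; have nm : (n <= m + n)%N by exact: leq_addl.
      apply: (gauss_sum_partial_le G sepX k _ (geometric_l2_le sepX C0 rho0 rho1 mZ dZ nm)).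
      exact: gauss_operator_sum (gauss_operatorB sepX (BZ _) (BZ _)).
    + apply: aeW => w; rewrite /gauss_partial.
      apply: cvg_big => //; first exact: add_continuous.
      move=> i _; apply: cvgZr; apply: cvgB; last exact: cvg_cst.
      by rewrite (cvg_shiftn n (fun m => u m i)); exact: B_cvg.
  have -> : Z \- gauss_partial xi u' k = ((Z \- Z_ n) \+ (Z_ n \- gauss_partial xi (u n) k))
      \- gauss_partial xi (u' \- u n) k.
    apply/funext => w; rewrite /= gauss_partialB /= opprB.
    by rewrite subrKA addrA subrK.
  have -> : e = e / 4 + e / 2 + e / 4 by field.
  apply: l2_le_sub => //; last exact: l2_le_weaken p1.
  by apply: l2_le_add => //; [exact: l2_le_weaken (ZP n)|exact: hN].
Qed.

End Limit.

(** * Interpolation of radonifying operators *)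

Section ScaleOperators.
Context {R : realType} {X : normedModType R}.
Variable N : R -> X -> X.
Hypothesis HN : fractional_scale N.

Lemma scale_eq a x y : 0 <= a <= 1 -> N a x = N a y -> x = y.
Proof.
move=> a01 e; apply/eqP; rewrite -subr_eq0; apply/eqP.
apply: (scale_inj HN a01); have [F FE] := linear_pack (scale_linear HN a01).
by move: e; rewrite FE linearB => ->; rewrite subrr.
Qed.

Lemma scale_bound a : 0 <= a <= 1 -> exists2 K, 0 <= K & forall v, `|N a v| <= K * `|v|.
Proof.
move=> /andP[]; rewrite le_eqVlt => /predU1P[<- _|a0 a1].
  by exists 1 => // v; rewrite (scale0 HN) mul1r.
have [K K0 hK] := scale_embed HN (lexx 0) a0 a1; exists K => // v.
by have [u] := hK v; rewrite (scale0 HN) => ->.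
Qed.

(** The embedding of the domain of [L^b] into that of [L^a], seen in the ambient
    space; it is linear because [L^-a] is injective. *)
Lemma scale_transfer a b : 0 <= a -> a < b -> b <= 1 ->
  exists (T : {linear X -> X}) K, [/\ 0 <= K, forall v, N a (T v) = N b v &
    forall v, `|T v| <= K * `|v|].
Proof.
move=> a0 ab b1; have [K K0 hK] := scale_embed HN a0 ab b1.
have a01 : 0 <= a <= 1 by rewrite a0 (le_trans (ltW ab)).
have b01 : 0 <= b <= 1 by rewrite b1 (le_trans a0 (ltW ab)).
have hT v : exists u, N a u = N b v /\ `|u| <= K * `|v|.
  by have [u] := hK v; exists u.
have [T TP] := choice hT.
have lT : linear T.
  move=> k u v; apply: (scale_eq a01); have [Ta _] := TP (k *: u + v).
  rewrite Ta (scale_linear HN b01) (scale_linear HN a01).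
  by have [-> _] := TP u; have [-> _] := TP v.
have [F FE] := linear_pack lT; exists F, K; split=> // v; rewrite -FE; by have [] := TP v.
Qed.

End ScaleOperators.

Section Interpolation.
Context {R : realType} {d : measure_display} {Omega : measurableType d}.
Variable P : probability Omega R.
Variable xi : nat -> Omega -> R.
Hypothesis G : gaussian_sequence P xi.
Context {X : completeNormedModType R}.
Hypothesis sepX : separable X.
Variable N : R -> X -> X.
Hypothesis HN : fractional_scale N.

(** The moment inequality passes to L^2(Omega): the Gaussian sums with values in
    three spaces of the scale are the same finite sums, to which the inequality
    applies pointwise. *)
Lemma gauss_interpolate a c b : 0 <= a -> a < c -> c < b -> b <= 1 ->
  exists2 K, 0 <= K & forall (T : {linear X -> X}) M U V Y Z e f lam,
    gauss_operator P xi U Y -> gauss_operator P xi V Z ->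
    (forall h, N a (U h) = N b (V h)) ->
    (forall v, N c (T v) = N b v) -> 0 <= M -> (forall v, `|T v| <= M * `|v|) ->
    l2_le P Y e -> l2_le P Z f -> 0 < lam ->
    l2_le P (T \o Z) (K * lam `^ (c - a) * e + K * lam `^ (c - b) * f).
Proof.
move=> a0 ac cb b1; have [K K0 hK] := scale_interpolate HN a0 ac cb b1.
exists K => // T M U V Y Z e f lam UY VZ UV TN M0 TM Ye Zf lam0.
have p0 : 0 <= K * lam `^ (c - a) by rewrite mulr_ge0// powR_ge0.
have q0 : 0 <= K * lam `^ (c - b) by rewrite mulr_ge0// powR_ge0.
have [_ e0 _] := Ye; have [_ f0 _] := Zf.
have TVZ := gauss_operator_comp G sepX M0 TM VZ.
have mTZ : norm_measurable setT (T \o Z).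
  exact: (gauss_sum_measurable G sepX (gauss_operator_sum TVZ)).
apply: (gauss_sum_le sepX mTZ _ (gauss_operator_sum TVZ)).
  by rewrite addr_ge0// mulr_ge0.
move=> n; pose u i := U (l2_basis R i); pose v i := V (l2_basis R i).
apply: (l2_le_comb (U := gauss_partial xi u n) (V := gauss_partial xi v n)) => //.
- exact: (norm_measurable_partial G sepX).
- move=> w; set x := gauss_partial xi u n w; set y := gauss_partial xi v n w.
  rewrite (gauss_partial_linear xi T v) -/y.
  have a01 : 0 <= a <= 1 by rewrite a0 (le_trans (ltW ac))// (le_trans (ltW cb)).
  have c01 : 0 <= c <= 1 by rewrite (le_trans a0 (ltW ac)) (le_trans (ltW cb)).
  have b01 : 0 <= b <= 1 by rewrite b1 (le_trans _ (ltW cb))// (le_trans a0 (ltW ac)).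
  have xy : N a x = N b y.
    have [A AE] := linear_pack (scale_linear HN a01).
    have [B BE] := linear_pack (scale_linear HN b01).
    rewrite AE BE /x /y -!gauss_partial_linear /gauss_partial.
    by apply: eq_bigr => i _; congr (_ *: _); rewrite /= -AE -BE; exact: UV.
  have [z zE hz] := hK x y xy.
  have -> : T y = z by apply: (scale_eq HN c01); rewrite zE TN xy.
  by apply: le_trans (hz lam lam0) _; rewrite mulrDr !mulrA.
- exact: (gauss_sum_partial_le G sepX n (gauss_operator_sum UY) Ye).
- exact: (gauss_sum_partial_le G sepX n (gauss_operator_sum VZ) Zf).
Qed.

Lemma powR2Xn (x : R) n : (2 `^ x) ^+ n = 2 `^ (x * n%:R).
Proof. by rewrite powRrM powR_mulrn ?powR_ge0. Qed.

(** If the increments decrease in the lower space as [2^(-theta n delta)] while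
    the terms grow in the higher space as [2^((1 - theta) n delta)], then in the
    intermediate space of index [t < theta] the moment inequality with
    [lam = 2^(n delta / (b - a))] makes the increments decrease as
    [2^((t - theta) n delta)]. *)
Lemma gauss_telescope a b t theta delta E F : 0 <= a -> a < b -> b <= 1 ->
  0 < t -> t < theta -> theta < 1 -> 0 < delta -> 0 <= E -> 0 <= F ->
  exists C, forall (U V : nat -> l2 R -> X) (Y Z : nat -> Omega -> X) (S : l2 R -> X),
    (forall n, gauss_operator P xi (U n) (Y n)) ->
    (forall n, gauss_operator P xi (V n) (Z n)) ->
    (forall n h, N a (U n h) = N b (V n h)) ->
    (forall n, l2_le P (Y n.+1 \- Y n) (E * (2 `^ (- (theta * delta))) ^+ n)) ->
    (forall n, l2_le P (Z n) (F * (2 `^ ((1 - theta) * delta)) ^+ n)) ->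
    (forall h, N a (U n h) @[n --> \oo] --> S h) ->
    exists B Q, [/\ S = N (a + t * (b - a)) \o B, gauss_operator P xi B Q & l2_le P Q C].
Proof.
move=> a0 ab b1 t0 tth th1 d0 E0 F0; set c := a + _.
have t1 : t < 1 by exact: lt_trans th1.
have ba0 : 0 < b - a by rewrite subr_gt0.
have ac : a < c by rewrite ltrDl mulr_gt0.
have cb : c < b by rewrite -ltrBrDl gtr_pMl.
have c0 : 0 <= c by rewrite (le_trans a0 (ltW ac)).
have c1 : c <= 1 by rewrite (le_trans (ltW cb)).
have c01 : 0 <= c <= 1 by rewrite c0.
have [K K0 hK] := gauss_interpolate a0 ac cb b1.
have [T [M [M0 TN TM]]] := scale_transfer HN c0 cb b1.
pose rho : R := 2 `^ ((t - theta) * delta).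
have rho0 : 0 < rho by rewrite powR_gt0.
have rho1 : rho < 1.
  rewrite /rho /powR pnatr_eq0 /= expR_lt1 pmulr_llt0 ?ln_gt0 ?ltr1n//.
  by rewrite pmulr_llt0// subr_lt0.
pose tau : R := 2 `^ ((1 - theta) * delta).
have tau0 : 0 <= tau by exact: powR_ge0.
pose C := K * (E + F * (tau + 1)).
have C0 : 0 <= C by rewrite mulr_ge0// addr_ge0// mulr_ge0// addr_ge0.
exists (M * F + geom_tail C rho 0) => U V Y Z S UY VZ UV dY Zle US.
have TVZ n : gauss_operator P xi (T \o V n) (T \o Z n).
  exact: (gauss_operator_comp G sepX M0 TM (VZ n)).
have dTZ n : l2_le P ((T \o Z n.+1) \- (T \o Z n)) (C * rho ^+ n).
  have -> : (T \o Z n.+1) \- (T \o Z n) = T \o (Z n.+1 \- Z n).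
    by apply/funext => w; rewrite /= linearB.
  (* this parameter balances the decay in the lower space and the growth in the
     higher one *)
  pose lam : R := 2 `^ (n%:R * delta / (b - a)).
  have lam0 : 0 < lam by rewrite powR_gt0.
  have dZ := l2_le_sub sepX (Zle n.+1) (Zle n).
  have UVd h : N a ((U n.+1 \- U n) h) = N b ((V n.+1 \- V n) h).
    have [A AE] : exists A : {linear X -> X}, N a = A.
      by apply: linear_pack; apply: (scale_linear HN); rewrite a0 (le_trans (ltW ac)).
    have [B BE] : exists B : {linear X -> X}, N b = B.
      by apply: linear_pack; apply: (scale_linear HN); rewrite b1 (le_trans c0 (ltW cb)).
    by rewrite /= AE BE !linearB -AE -BE !UV.
  have := hK T M _ _ _ _ _ _ lam (gauss_operatorB sepX (UY n.+1) (UY n))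
    (gauss_operatorB sepX (VZ n.+1) (VZ n)) UVd TN M0 TM (dY n) dZ lam0.
  have e1 : lam `^ (c - a) * (2 `^ (- (theta * delta))) ^+ n = rho ^+ n.
    rewrite /lam /rho !powR2Xn -powRrM -powRD ?pnatr_eq0 ?implybT//.
    by congr (2 `^ _); rewrite /c; field; rewrite gt_eqF.
  have e2 : lam `^ (c - b) * tau ^+ n = rho ^+ n.
    rewrite /lam /rho /tau !powR2Xn -powRrM -powRD ?pnatr_eq0 ?implybT//.
    by congr (2 `^ _); rewrite /c; field; rewrite gt_eqF.
  congr (l2_le _ _ _); rewrite -/tau exprS.
  transitivity (K * E * (lam `^ (c - a) * (2 `^ (- (theta * delta))) ^+ n) +
    K * F * (tau + 1) * (lam `^ (c - b) * tau ^+ n)); first by ring.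
  by rewrite e1 e2 /C; ring.
have [B [Q [BQ BL QL]]] := gauss_operator_limit G sepX C0 rho0 rho1 TVZ dTZ.
exists B, Q; split=> //.
- apply/funext => h /=.
  have [A AE] := linear_pack (scale_linear HN c01).
  have [KA _ hA] := scale_bound HN c01.
  have cA : continuous A by apply: (linear_bound_continuous (K := KA)) => v; rewrite -AE.
  have l1 : N a (U n h) @[n --> \oo] --> N c (B h).
    under eq_fun do rewrite UV -TN AE.
    by rewrite AE; apply: continuous_cvg; [exact: cA|exact: BL].
  exact: (cvg_unique (@norm_hausdorff _ X) (US h) l1).
- have -> : Q = (T \o Z 0%N) \+ (Q \- (T \o Z 0%N)).
    by apply/funext => w; rewrite /= addrC subrK.
  apply: l2_le_add => //; have := Zle 0%N; rewrite expr0 mulr1.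
  apply: l2_le_scale => //; last by move=> w; exact: TM.
  exact: (gauss_sum_measurable G sepX (gauss_operator_sum (TVZ 0%N))).
Qed.

End Interpolation.

(** * Radonifying operators with values in the domain of a power *)

Section Radonifying.
Context {R : realType} {d : measure_display} {Omega : measurableType d}.
Variable P : probability Omega R.
Variable W : nat -> R -> Omega -> R.
Local Notation xi := (fun k => W k 1).
Hypothesis G : gaussian_sequence P xi.
Context {X : completeNormedModType R}.
Hypothesis sepX : separable X.
Variable L : operator X.
Local Notation N := (neg_power L).
Hypothesis HN : fractional_scale N.
Variable a : R.
Hypothesis a01 : 0 <= a <= 1.
Local Notation Y := (Xpow L a).

Lemma power_negK z : power L a (N a z) = z.
Proof. by apply: xget_unique => // y /= h; exact: (scale_eq HN a01). Qed.

Lemma nnorm_negB x y : nnorm Y (N a x - N a y) = `|x - y|.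
Proof.
have [A AE] := linear_pack (scale_linear HN a01).
by rewrite /= AE -linearB -AE power_negK.
Qed.

Lemma nnorm_neg x : nnorm Y (N a x) = `|x|.
Proof. by rewrite /= power_negK. Qed.

Let partialE (B : l2 R -> X) n w :
  \sum_(k < n) W k 1 w *: (N a \o B) (l2_basis R k) =
  N a (gauss_partial xi (fun k => B (l2_basis R k)) n w).
Proof.
have [A AE] := linear_pack (scale_linear HN a01).
by rewrite AE -gauss_partial_linear.
Qed.

(** [L^-a] is an isometry from the ambient space onto the domain of [L^a]. *)
Lemma is_gauss_sumP (B : l2 R -> X) (Z : Omega -> X) :
  is_gauss_sum P W Y (N a \o B) (N a \o Z) <->
  gauss_sum P xi (fun k => B (l2_basis R k)) Z.
Proof.
pose u k := B (l2_basis R k); rewrite -/u.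
have sqE n w : (nnorm Y ((\sum_(k < n) W k 1 w *: (N a \o B) (l2_basis R k)) -
    (N a \o Z) w) ^+ 2)%:E = (`|(Z \- gauss_partial xi u n) w| ^+ 2)%:E.
  by rewrite partialE nnorm_negB distrC.
have IE n : (\int[P]_w (nnorm Y ((\sum_(k < n) W k 1 w *: (N a \o B) (l2_basis R k)) -
    (N a \o Z) w) ^+ 2)%:E = \int[P]_w (`|(Z \- gauss_partial xi u n) w| ^+ 2)%:E)%E.
  by apply: eq_integral => w _; exact: sqE.
have I0 n : (0 <= \int[P]_w (`|(Z \- gauss_partial xi u n) w| ^+ 2)%:E)%E.
  by apply: integral_ge0 => w _; rewrite lee_fin sqr_ge0.
have Ifin n e : l2_le P (Z \- gauss_partial xi u n) e ->
    (\int[P]_w (`|(Z \- gauss_partial xi u n) w| ^+ 2)%:E)%E \is a fin_num.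
  by move=> [_ _ h]; rewrite ge0_fin_numE// (le_lt_trans h)// ltry.
split.
- move=> [[[_ mZ] _]]; rewrite /cvg_L2 => cZ e e0.
  have NZ : norm_measurable setT Z.
    move=> z; have := mZ (N a z) (ex_intro2 _ _ z I erefl).
    by under eq_fun do rewrite [_ - _]/(N a (Z _) - N a z) nnorm_negB.
  have /fine_cvgP[fZ] := cZ.
  move=> /cvgrPdist_lt/(_ (e ^+ 2)); rewrite exprn_gt0// => /(_ isT) lZ.
  have [M _ hM] := filterI fZ lZ; exists M => n /hM[/= fn ln].
  split; [|exact: ltW|].
    by apply: norm_measurableB => //; exact: (norm_measurable_partial G sepX).
  rewrite -IE -(fineK fn) lee_fin; apply: ltW; apply: le_lt_trans ln.
  by rewrite sub0r normrN ler_norm.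
- move=> uZ; have NZ := gauss_sum_measurable G sepX uZ.
  have [e [_ e0 Ze]] := gauss_sum_l2_le G sepX uZ.
  split; first split; first split.
  + by move=> w; exists (Z w).
  + by move=> _ [z _ <-]; under eq_fun do rewrite nnorm_negB; exact: NZ.
  + apply: (@le_lt_trans _ _ (e ^+ 2)%:E); last exact: ltry.
    by under eq_integral do rewrite nnorm_neg.
  + rewrite /cvg_L2; under eq_fun do rewrite IE.
    apply/fine_cvgP; split.
      have [M hM] := uZ 1 ltr01; exists M => // n /hM; exact: Ifin.
    apply/cvgrPdist_le => r r0; have s0 : 0 < Num.sqrt r by rewrite sqrtr_gt0.
    have [M hM] := uZ _ s0; exists M => // n /hM h; have fn := Ifin _ _ h.
    have [_ _] := h; rewrite sqr_sqrtr ?(ltW r0)// => {}h.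
    by rewrite sub0r normrN ger0_norm ?fine_ge0// -lee_fin fineK.
Qed.

(** Applying [L^a] to the operator and to its Gaussian sum brings both to the
    ambient space without changing any norm. The last two clauses express that the
    radonifying norm is the L^2 norm of the sum. *)
Lemma radonifying_gauss B : radonifying P W Y B ->
  exists B' Z, [/\ B = N a \o B', gauss_operator P xi B' Z,
    l2_le P Z (rad_norm P W Y B) &
    forall e, l2_le P Z e -> rad_norm P W Y B <= e].
Proof.
move=> [[lB cB [M BM]] exS].
pose S := xget (cst 0) (is_gauss_sum P W Y B).
have SB : is_gauss_sum P W Y B S := xgetPex _ exS.
pose B' h := power L a (B h); pose Z w := power L a (S w).
have BE : B = N a \o B'.
  by apply/funext => h; have [y _ yh] := cB h; rewrite /= /B' -yh power_negK.
have SE : S = N a \o Z.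
  have [[[cS _] _] _] := SB.
  by apply/funext => w; have [y _ yh] := cS w; rewrite /= /Z -yh power_negK.
have uZ : gauss_sum P xi (fun k => B' (l2_basis R k)) Z.
  by apply/is_gauss_sumP; rewrite -BE -SE.
have normE : ((rad_norm P W Y B ^+ 2)%:E = \int[P]_w (`|Z w| ^+ 2)%:E)%E.
  have [e [_ _ Ze]] := gauss_sum_l2_le G sepX uZ.
  rewrite /rad_norm -/S sqr_sqrtr; last first.
    by apply/fine_ge0/integral_ge0 => w _; rewrite lee_fin sqr_ge0.
  rewrite fineK// ge0_fin_numE; last first.
    by apply: integral_ge0 => w _; rewrite lee_fin sqr_ge0.
  exact: (le_lt_trans Ze (ltry _)).
exists B', Z; split=> //.
- split=> //; last by exists M => h; exact: BM.
  move=> k x y; apply: (scale_eq HN a01).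
  rewrite (scale_linear HN a01) -[N a (B' _)]/((N a \o B') _) -BE lB BE //.
- have [e [NZ _ Ze]] := gauss_sum_l2_le G sepX uZ.
  split=> //; first exact: sqrtr_ge0.
  by rewrite normE.
- move=> e [_ e0 Ze]; rewrite -ler_sqr ?nnegrE ?sqrtr_ge0// -lee_fin.
  by apply: le_trans Ze; rewrite normE.
Qed.

Lemma gauss_radonifying B Z e : gauss_operator P xi B Z -> l2_le P Z e ->
  radonifying P W Y (N a \o B) /\ rad_norm P W Y (N a \o B) <= e.
Proof.
move=> BZ Ze; have [lB [M BM] uZ] := BZ; have [_ e0 _] := Ze.
have rad : radonifying P W Y (N a \o B).
  split; last by exists (N a \o Z); exact/is_gauss_sumP.
  split.
  - by move=> k x y /=; rewrite lB (scale_linear HN a01).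
  - by move=> h; exists (B h).
  - by exists M => h; rewrite /= power_negK.
split=> //; have [B' [Z' [BE B'Z' _]]] := radonifying_gauss rad; apply.
have BB' : B' = B.
  by apply/funext => h; apply: (scale_eq HN a01); exact: (congr1 (@^~ h) (esym BE)).
rewrite BB' in B'Z'; exact: (gauss_sum_unique G sepX uZ (gauss_operator_sum B'Z') Ze).
Qed.

Lemma gauss_rad_norm B Z : gauss_operator P xi B Z ->
  l2_le P Z (rad_norm P W Y (N a \o B)).
Proof.
move=> BZ; have [e Ze] := gauss_sum_l2_le G sepX (gauss_operator_sum BZ).
have [rad _] := gauss_radonifying BZ Ze.
have [B' [Z' [BE B'Z' Z'le _]]] := radonifying_gauss rad.
have BB' : B' = B.
  by apply/funext => h; apply: (scale_eq HN a01); exact: (congr1 (@^~ h) (esym BE)).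
rewrite BB' in B'Z'.
exact: (gauss_sum_unique G sepX (gauss_operator_sum B'Z') (gauss_operator_sum BZ) Z'le).
Qed.

End Radonifying.

(** * Interpolation of the map *)

Theorem lemma2p13 (R : realType) (X : completeNormedModType R)
  (X_separable : separable X) (X_smooth : two_smooth X)
  (L : operator X) (L_dense : densely_defined L) (L_closed : closed_operator L)
  (L_sectorial : sectorial L) (L_0 : resolvent_set L 0)
  (d : measure_display) (Omega : measurableType d) (P : probability Omega R)
  (W : nat -> R -> Omega -> R) (W_bm : independent_brownian_motions P W)
  (alpha0 alpha1 alpha2 alpha3 : R)
  (a01 : 0 <= alpha0 < alpha1) (a1 : alpha1 <= 1)
  (a23 : 0 <= alpha2 < alpha3) (a3 : alpha3 <= 1)
  (Psi : X -> l2 R -> X)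
  (Psi_rad : forall x, carrier (Xpow L alpha0) x ->
     radonifying P W (Xpow L alpha2) (Psi x))
  (Psi_lip : forall r : R, 0 < r -> exists K : R, forall x y,
     carrier (Xpow L alpha0) x -> nnorm (Xpow L alpha0) x <= r ->
     carrier (Xpow L alpha0) y -> nnorm (Xpow L alpha0) y <= r ->
     rad_norm P W (Xpow L alpha2) (fun h => Psi x h - Psi y h)
       <= K * nnorm (Xpow L alpha0) (x - y))
  (Psi_growth : forall r : R, 0 < r -> exists C : R, forall x,
     carrier (Xpow L alpha1) x -> nnorm (Xpow L alpha0) x <= r ->
     radonifying P W (Xpow L alpha3) (Psi x) /\
     rad_norm P W (Xpow L alpha3) (Psi x) <= C * (1 + nnorm (Xpow L alpha1) x)) :
  forall theta' theta r : R, 0 < theta' -> theta' < theta -> theta < 1 -> 0 < r ->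
    exists C' : R, forall x,
      carrier (Xpow L (alpha0 + theta * (alpha1 - alpha0))) x ->
      nnorm (Xpow L (alpha0 + theta * (alpha1 - alpha0))) x <= r ->
      radonifying P W (Xpow L (alpha2 + theta' * (alpha3 - alpha2))) (Psi x) /\
      rad_norm P W (Xpow L (alpha2 + theta' * (alpha3 - alpha2))) (Psi x) <= C'.
Proof.
move=> t th r t0 tth th1 r0.
have G := brownian_gaussian W_bm.
have [J [M [HJ JL]]] := sectorial_resolvent L_sectorial L_0.
have HN := neg_power_scale X_separable HJ JL.
have th0 := lt_trans t0 tth.
have /andP[h0 h01] := a01; have /andP[h2 h23] := a23.
pose delta := alpha1 - alpha0; have d0 : 0 < delta by rewrite subr_gt0.
rewrite -/delta; set gam := alpha0 + th * delta.
have g0 : alpha0 < gam by rewrite ltrDl mulr_gt0.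
have g1 : gam < alpha1 by rewrite -ltrBrDl gtr_pMl.
have p0 : 0 <= alpha0 <= 1 by rewrite h0 (le_trans (ltW h01)).
have p1 : 0 <= alpha1 <= 1 by rewrite (le_trans h0 (ltW h01)).
have p2 : 0 <= alpha2 <= 1 by rewrite h2 (le_trans (ltW h23)).
have p3 : 0 <= alpha3 <= 1 by rewrite (le_trans h2 (ltW h23)).
have pg : 0 <= gam <= 1 by rewrite (le_trans h0 (ltW g0)) (le_trans (ltW g1)).
have pc : 0 <= alpha2 + t * (alpha3 - alpha2) <= 1.
  have : 0 < t * (alpha3 - alpha2) by rewrite mulr_gt0// subr_gt0.
  have : t * (alpha3 - alpha2) <= alpha3 - alpha2.
    by rewrite ler_piMl ?subr_ge0 ?ltW// (lt_trans tth).
  lra.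
have [A hA] := scale_approx HN.
have [K1 K10 hK1] := hA _ _ _ h0 g0 g1 a1.
have [K0 K00 hK0] := scale_embed HN h0 g0 (le_trans (ltW g1) a1).
(* a ball of X_alpha0 that contains [x] and all its regularizations *)
pose r' := K0 * r + K1 * r + 1.
have r'0 : 0 < r' by rewrite ltr_wpDl// addr_ge0// mulr_ge0// ltW.
have [KL hKL] := Psi_lip _ r'0; have [Cg hCg] := Psi_growth _ r'0.
have K1r : 0 <= K1 * r by rewrite mulr_ge0// ltW.
pose E := `|KL| * (2 * (K1 * r)); pose F := `|Cg| * (1 + K1 * r).
have E0 : 0 <= E by rewrite mulr_ge0// mulr_ge0.
have F0 : 0 <= F by rewrite mulr_ge0// addr_ge0.
have [C hC] := gauss_telescope G X_separable HN h2 h23 a3 t0 tth th1 d0 E0 F0.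
exists C => x [z _ zx]; rewrite -{x}zx (nnorm_neg HN pg) => zr.
set x := neg_power L gam z.
pose lam n : R := 2 `^ n%:R.
have lam0 n : 0 < lam n by rewrite powR_gt0.
set sig : R := 2 `^ (- (th * delta)) in hC.
set tau : R := 2 `^ ((1 - th) * delta) in hC.
have sig0 : 0 <= sig by exact: powR_ge0.
have sig1 : sig < 1.
  rewrite /sig /powR pnatr_eq0 /= expR_lt1 pmulr_llt0 ?ln_gt0 ?ltr1n//.
  by rewrite oppr_lt0 mulr_gt0.
have tau1 : 1 <= tau.
  rewrite /tau /powR pnatr_eq0 /= -[X in X <= _](@expR0 R) ler_expR mulr_ge0 ?ln_ge0 ?ler1n//.
  by rewrite mulr_ge0 ?(ltW d0)// subr_ge0 ltW.
have lsig n : lam n `^ (alpha0 - gam) = sig ^+ n.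
  by rewrite /lam /sig powR2Xn -powRrM; congr (2 `^ _); rewrite /gam; ring.
have ltau n : lam n `^ (alpha1 - gam) = tau ^+ n.
  by rewrite /lam /tau powR2Xn -powRrM; congr (2 `^ _); rewrite /gam /delta; ring.
(* the regularizations of [x] at the scales [2^n] *)
pose xn n := A (lam n) x.
have hu n : exists u, neg_power L alpha0 u = x - xn n /\ `|u| <= K1 * r * sig ^+ n.
  have [[u uE ule] _] := hK1 z _ (lam0 n); exists u; split=> //.
  apply: (le_trans ule); rewrite lsig mulrAC ler_wpM2r ?exprn_ge0//.
  by rewrite ler_wpM2l.
have hv n : exists v, neg_power L alpha1 v = xn n /\ `|v| <= K1 * r * tau ^+ n.
  have [_ [v vE vle]] := hK1 z _ (lam0 n); exists v; split=> //.
  apply: (le_trans vle); rewrite ltau mulrAC ler_wpM2r ?exprn_ge0 ?(le_trans ler01)//.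
  by rewrite ler_wpM2l.
have [u uP] := choice hu; have [v vP] := choice hv.
have [w wE wle] := hK0 z; rewrite -/x in wE.
have [N0 N0E] := linear_pack (scale_linear HN p0).
have xnE n : xn n = neg_power L alpha0 (w - u n).
  by rewrite N0E linearB -N0E wE (uP n).1 opprB addrC subrK.
have cx : carrier (Xpow L alpha0) x by exists w.
have cxn n : carrier (Xpow L alpha0) (xn n) by exists (w - u n).
have wr : `|w| <= K0 * r by apply: (le_trans wle); rewrite ler_wpM2l.
have nx : nnorm (Xpow L alpha0) x <= r'.
  by rewrite -wE (nnorm_neg HN p0) /r'; lra.
have ur n : `|u n| <= K1 * r.
  by apply: (le_trans (uP n).2); rewrite ler_piMr// exprn_ile1// ltW.
have nxn n : nnorm (Xpow L alpha0) (xn n) <= r'.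
  rewrite xnE (nnorm_neg HN p0) /r'; apply: (le_trans (ler_normB _ _)).
  by have := ur n; lra.
have hU n : exists p : (l2 R -> X) * (Omega -> X), Psi (xn n) = neg_power L alpha2 \o p.1 /\
    gauss_operator P (fun k => W k 1) p.1 p.2.
  have [U [Y [UE UY _ _]]] := radonifying_gauss G X_separable HN p2 (Psi_rad _ (cxn n)).
  by exists (U, Y).
have [UY UYP] := choice hU.
have hV n : exists p : (l2 R -> X) * (Omega -> X), [/\ Psi (xn n) = neg_power L alpha3 \o p.1,
    gauss_operator P (fun k => W k 1) p.1 p.2 & l2_le P p.2 (F * tau ^+ n)].
  have cx1 : carrier (Xpow L alpha1) (xn n) by exists (v n) => //; exact: (vP n).1.
  have [rad radle] := hCg _ cx1 (nxn n).
  have [V [Z [VE VZ Zle _]]] := radonifying_gauss G X_separable HN p3 rad.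
  exists (V, Z); split=> //=; apply: l2_le_weaken Zle; apply: (le_trans radle).
  rewrite -(vP n).1 (nnorm_neg HN p1).
  have tn : 1 <= tau ^+ n by rewrite exprn_ege1.
  apply: (@le_trans _ _ (`|Cg| * (1 + `|v n|))).
    by apply: ler_wpM2r; [rewrite addr_ge0|exact: ler_norm].
  apply: (@le_trans _ _ (`|Cg| * (1 + K1 * r * tau ^+ n))).
    by rewrite ler_wpM2l// lerD2l (vP n).2.
  by rewrite /F -[X in _ <= X]mulrA ler_wpM2l// mulrDl mul1r lerD2r.
have [VZ VZP] := choice hV.
(* the Lipschitz condition, for the Gaussian sums *)
have diff B B' Y Y' y y' b :
    Psi y = neg_power L alpha2 \o B -> Psi y' = neg_power L alpha2 \o B' ->
    gauss_operator P (fun k => W k 1) B Y -> gauss_operator P (fun k => W k 1) B' Y' ->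
    carrier (Xpow L alpha0) y -> nnorm (Xpow L alpha0) y <= r' ->
    carrier (Xpow L alpha0) y' -> nnorm (Xpow L alpha0) y' <= r' ->
    nnorm (Xpow L alpha0) (y - y') <= b -> l2_le P (Y \- Y') (`|KL| * b).
  move=> yB yB' BY BY' cy ny cy' ny' yb.
  apply: l2_le_weaken (gauss_rad_norm G X_separable HN p2 (gauss_operatorB X_separable BY BY')).
  have [N2 N2E] := linear_pack (scale_linear HN p2).
  have -> : neg_power L alpha2 \o (B \- B') = fun h => Psi y h - Psi y' h.
    by apply/funext => h; rewrite yB yB' /= N2E linearB.
  apply: (le_trans (hKL _ _ cy ny cy' ny')).
  apply: (@le_trans _ _ (`|KL| * nnorm (Xpow L alpha0) (y - y'))).
    by apply: ler_wpM2r; [exact: normr_ge0|exact: ler_norm].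
  exact: ler_wpM2l.
have [U [Y [UE UYx _ _]]] := radonifying_gauss G X_separable HN p2 (Psi_rad _ cx).
have [B [Q [PB BQ QC]]] : exists B Q, [/\ Psi x = neg_power L (alpha2 + t * (alpha3 - alpha2)) \o B,
    gauss_operator P (fun k => W k 1) B Q & l2_le P Q C].
  apply: (hC (fun n => (UY n).1) (fun n => (VZ n).1) (fun n => (UY n).2) (fun n => (VZ n).2)).
  - by move=> n; have [] := UYP n.
  - by move=> n; have [] := VZP n.
  - move=> n h; have [e1 _] := UYP n; have [e2 _ _] := VZP n.
    by rewrite -[LHS]/((neg_power L alpha2 \o (UY n).1) h) -e1 e2.
  - move=> n; have [e1 g1'] := UYP n.+1; have [e2 g2'] := UYP n.
    rewrite /E -mulrA; apply: (diff _ _ _ _ _ _ _ e1 e2) => //.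
    rewrite !xnE (nnorm_negB HN p0) opprB addrC subrKA.
    apply: (le_trans (ler_normB _ _)); rewrite -mulrA mulrDl mul1r.
    apply: lerD; first exact: (uP n).2.
    by apply: (le_trans (uP n.+1).2); rewrite ler_wpM2l// exprS ler_piMl ?exprn_ge0// ltW.
  - by move=> n; have [] := VZP n.
  - move=> h; have [Kb Kb0 hKb] := scale_bound HN p2.
    have [N2 N2E] := linear_pack (scale_linear HN p2).
    pose c := Kb * (`|KL| * (K1 * r) / Num.sqrt (gauss_var R) * l2norm h).
    have le n : `|Psi x h - neg_power L alpha2 ((UY n).1 h)| <= c * sig ^+ n.
      have [e1 g1'] := UYP n.
      have dl : l2_le P (Y \- (UY n).2) (`|KL| * (K1 * r * sig ^+ n)).
        apply: (diff _ _ _ _ _ _ _ UE e1) => //.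
        rewrite xnE -wE (nnorm_negB HN p0) opprB addrCA subrr addr0.
        exact: (uP n).2.
      rewrite UE /= N2E -linearB -N2E; apply: (le_trans (hKb _)).
      have := gauss_operator_bound G X_separable h (gauss_operatorB X_separable UYx g1') dl.
      move=> /(ler_wpM2l Kb0)/le_trans; apply.
      by rewrite /c; apply: le_of_eq; ring.
    apply/cvgrPdist_le => e e0.
    have cs : c * sig ^+ n @[n --> \oo] --> c * 0.
      by apply: cvgMr; apply: cvg_expr; rewrite ger0_norm.
    rewrite mulr0 in cs; move/cvgrPdist_le: cs => /(_ e e0).
    apply: filterS => n; rewrite sub0r normrN => /(le_trans (ler_norm _)).
    exact: le_trans (le n).
rewrite PB; exact: (gauss_radonifying G X_separable HN pc BQ QC).
Qed.
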